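(* Assume that (W1)–(W3) and (A1)–(A5) (listed in the context) hold for the fixed integers $0\le j_1<\dots<j_m$. Suppose further that, whenever $h_{\ell_1}=h_{\ell_2}$ with $\ell_1\ne\ell_2$, one has $\xi_{\ell_1}(1)\ne\xi_{\ell_2}(1)$. Then, with $p=p(n)$, as $n\to\infty$, $$\Big(\sqrt{n_{a,j}}\,\Big(\log\lambda_{p-r+q}\big(\mathbf W(a(n)2^j)\big)-\log\lambda_{p-r+q}\big(\mathbb E\mathbf W(a(n)2^j)\big)\Big)_{q=1,\dots,r}\Big)_{j=j_1,\dots,j_m}\ \stackrel d\to\ \mathcal N(0,\Sigma_\lambda)$$ for some $\Sigma_\lambda\in\mathcal S_{\ge0}(m\cdot r,\mathbb R)$.
   Context: Notation. $\mathcal M(m_1,m_2,\mathbb R)$ is the set of real $m_1\times m_2$ matrices ($\mathcal M(m,\mathbb R)$ if square), $GL(m,\mathbb R)$ the invertible $m\times m$ ones, and $\mathcal S(m,\mathbb R)$, $\mathcal S_{\ge0}(m,\mathbb R)$, $\mathcal S_{>0}(m,\mathbb R)$ the symmetric, symmetric positive semidefinite, symmetric positive definite $m\times m$ matrices. $^*$ is transposition, $\|\cdot\|$ the spectral norm, $\lambda_1(\mathbf M)\le\dots\le\lambda_p(\mathbf M)$ the ordered eigenvalues of $\mathbf M\in\mathcal S(p,\mathbb R)$, $\mathrm{vec}_{\mathcal S}(\mathbf S)$ the vector of entries of $\mathbf S$ on and below the diagonal, $c^{\mathbf M}=\exp(\log(c)\mathbf M)$, $\operatorname{plim}$ limit in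 probability. $O_{\mathbb P}(1),o_{\mathbb P}(1),O(1),o(1)$ describe sequences of matrices whose spectral norms are bounded/vanish in probability, resp. deterministically, as $n\to\infty$. Wavelets. $\phi$ and $\psi$ are the scaling function and wavelet of an orthonormal multiresolution analysis of $L^2(\mathbb R)$, satisfying: (W1) $\int\psi^2=1$, $\int t^k\psi(t)dt=0$ for $k=0,\dots,N_\psi-1$, $\int t^{N_\psi}\psi(t)dt\ne0$, for some integer $N_\psi\ge1$; (W2) $\phi,\psi\in L^1(\mathbb R)$ are compactly supported and $\widehat\phi(0)=1$; (W3) there is $\alpha>1$ with $\sup_x|\widehat\psi(x)|(1+|x|)^\alpha<\infty$. For $j\ge0$, with $h_{j,\ell}=2^{-j/2}\int\phi(t+\ell)\psi(2^{-j}t)dt$, the wavelet coefficients of a process $Y=\{Y(t)\}_{t\in\mathbb Z}$ are $D(2^j,k)=\sum_{\ell\in\mathbb Z}Y(\ell)h_{j,2^jk-\ell}$; $D_X,D_Z$ are defined likewise from $X,Z$. Model. $r\in\mathbb N$ is fixed, $p=p(n)\ge r$ are dimensions, $\{a(n)\}$ is a dyadic sequence (powers of 2), and $0\le j_1<\dots<j_m$ are fixed integers. Observations are $Y(t)=\mathbf P(n)X(t)+Z(t)$, $t=1,\dots,n$, where $X$ is $\mathbb R^r$-valued, $Z$ and $Y$ are $\mathbb R^p$-valued stochastic processes, and $\mathbf P(n)\in\mathcal M(p,r,\mathbb R)$ is deterministic with columns of unit norm. Put $n_{a,j}=n/(a(n)2^j)$ (taken to be exactly the number of available coefficients, only coefficients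 not affected by the border being used) and $\mathbf W(a(n)2^j)=\frac1{n_{a,j}}\sum_{k=1}^{n_{a,j}}D(a(n)2^j,k)D(a(n)2^j,k)^*$; $\mathbf W_X$, $\mathbf W_Z$, $\mathbf W_{X,Z}$ are defined in the same way with $D_XD_X^*$, $D_ZD_Z^*$, $D_XD_Z^*$. The scaling matrix is $\mathbf H=\mathbf P_H\,\mathrm{diag}(h_1,\dots,h_r)\mathbf P_H^{-1}$, $\mathbf P_H\in GL(r,\mathbb R)$, $-1/2<h_1\le\dots\le h_r<\infty$. Put $\widehat{\mathbf B}_a(2^j)=\mathbf P_H^{-1}a(n)^{-\mathbf H-\frac12\mathbf I}\mathbf W_X(a(n)2^j)a(n)^{-\mathbf H^*-\frac12\mathbf I}(\mathbf P_H^* )^{-1}\in\mathcal S_{\ge0}(r,\mathbb R)$ and $\mathbf B_a(2^j)=\mathbb E\widehat{\mathbf B}_a(2^j)$. Assumptions, for $j=j_1,\dots,j_m$: (A1) For every $n$, $\mathbf W(a(n)2^j)=\mathbf P(n)\mathbf W_X(a(n)2^j)\mathbf P^*(n)+\mathbf W_Z(a(n)2^j)+\mathbf P(n)\mathbf W_{X,Z}(a(n)2^j)+\mathbf W_{X,Z}^*(a(n)2^j)\mathbf P^*(n)$ and each term on the right are well defined a.s.; all entrywise moments of these random matrices exist, and $\mathbb E\mathbf W_{X,Z}(a(n)2^j)=\mathbf 0$. (A2) $\|\mathbf W_Z(a(n)2^j)\|=O_{\mathbb P}(1)$, $\|\mathbb E\mathbf W_Z(a(n)2^j)\|=O(1)$.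 (A3) $\big(\sqrt{n_{a,j}}(\mathrm{vec}_{\mathcal S}\widehat{\mathbf B}_a(2^j)-\mathrm{vec}_{\mathcal S}\mathbf B_a(2^j))\big)_{j=j_1,\dots,j_m}\stackrel d\to\mathcal N(0,\Sigma_B)$ for some positive semidefinite $\Sigma_B$ of size $m\,r(r+1)/2$; and $\|\mathbf B_a(2^j)-\mathbf B(2^j)\|=o(1)$ for some $\mathbf B(2^j)\in\mathcal S_{>0}(r,\mathbb R)$. (A4) $a(n)\le n/2^{j_m}$, $\frac{a(n)}n+\frac n{a(n)^{h_1+3/2}}\to0$, $\frac{p(n)}{n/a(n)}=O(1)$. (A5) Let $\mathbf P(n)\mathbf P_H=\mathbf Q(n)\mathbf R(n)$ be the QR decomposition ($\mathbf Q(n)\in\mathcal M(p,r,\mathbb R)$ with orthonormal columns, $\mathbf R(n)\in GL(r,\mathbb R)$). There is a deterministic $\mathbf A\in\mathcal S_{>0}(r,\mathbb R)$ with Cholesky decomposition $\mathbf A=\mathbf R^*\mathbf R$ such that $\|\mathbf R(n)-\mathbf R\|=o(1)$. The functions $\xi_q$. Under these assumptions the deterministic limits $\xi_q(2^j)=\operatorname{plim}_{n\to\infty}\lambda_{p-r+q}(\mathbf W(a(n)2^j))/a(n)^{2h_q+1}>0$, $q=1,\dots,r$, exist and satisfy $\xi_q(2^j)=2^{j(2h_q+1)}\xi_q(1)$, where $\xi_q(1)$ is the value at octave $j=0$. *)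

(* Defs.v *)
From HB Require Import structures.
From mathcomp Require Import all_boot all_order all_algebra.
From mathcomp Require Import complex.
From mathcomp Require Import all_classical all_reals all_analysis.

Set Implicit Arguments.
Unset Strict Implicit.
Unset Printing Implicit Defensive.
Import Order.TTheory GRing.Theory Num.Theory.
Import numFieldNormedType.Exports.
Local Open Scope classical_set_scope.
Local Open Scope ring_scope.

Section matrices.
Context {R : realType}.

Definition psdmx n (M : 'M[R]_n) : Prop :=
  M^T = M /\ forall u : 'cV[R]_n, 0 <= (u^T *m M *m u) 0 0.

Definition pdmx n (M : 'M[R]_n) : Prop :=
  M^T = M /\ forall u : 'cV[R]_n, u != 0 -> 0 < (u^T *m M *m u) 0 0.

Definition euclid_norm n (u : 'cV[R]_n) : R := Num.sqrt (\sum_i u i 0 ^+ 2).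

Definition spectral_norm m n (M : 'M[R]_(m, n)) : R :=
  sup [set euclid_norm (M *m u) | u in [set u : 'cV[R]_n | euclid_norm u <= 1]].

(* The real eigenvalues in nondecreasing order, repeated according to
   multiplicity; the junk value [::] is only taken by matrices whose
   characteristic polynomial does not split over R, hence never by symmetric
   ones. *)
Definition eigenvalues n (M : 'M[R]_n) : seq R :=
  xget [::] [set s : seq R | sorted <=%R s /\
                             char_poly M = \prod_(x <- s) ('X - x%:P)].

(* Numbered from 1, as in the usual notation lambda_1 <= ... <= lambda_n. *)
Definition lambda n (i : nat) (M : 'M[R]_n) : R := (eigenvalues M)`_i.-1.

Definition expmx n (M : 'M[R]_n) : 'M[R]_n :=
  limn (series (fun k : nat => (k`!%:R : R)^-1 *: M ^+ k)).

Definition powmx n (c : R) (M : 'M[R]_n) : 'M[R]_n := expmx (ln c *: M).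

Definition lower_index (r : nat) : {set 'I_r * 'I_r} :=
  [set x : 'I_r * 'I_r | (x.2 <= x.1)%N].

Definition vecS r (S : 'M[R]_r) : 'rV[R]_#|lower_index r| :=
  \row_s S (enum_val s).1 (enum_val s).2.

(* R is upper triangular; unlike in [is_cholesky], no sign is imposed on its
   diagonal. *)
Definition is_QR p r (M : 'M[R]_(p, r)) (Q : 'M[R]_(p, r)) (Rn : 'M[R]_r) :=
  [/\ M = Q *m Rn, Q^T *m Q = 1%:M, is_trig_mx Rn^T & Rn \in unitmx].

Definition is_cholesky r (A C : 'M[R]_r) :=
  [/\ A = C^T *m C, is_trig_mx C^T & forall i, 0 < C i i].

End matrices.

Lemma card_lower_index r : #|lower_index r| = (r * r.+1)./2.
Proof.
rewrite -sum1_card (eq_bigl (fun x : 'I_r * 'I_r => xpredT x.1 && (x.2 <= x.1)%N)); last first.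
  by move=> x; rewrite inE.
rewrite -(pair_big_dep xpredT (fun i l : 'I_r => (l <= i)%N) (fun _ _ => 1%N)).
rewrite (eq_bigr (fun i : 'I_r => i.+1)); last first.
  move=> i _; by rewrite -(big_ord_widen r (fun=> 1%N) (ltn_ord i)) sum1_card card_ord.
rewrite -(big_mkord xpredT succn) mulnC -[(r.+1 * r)%N]/(r.+1 * r.+1.-1)%N -bin2.
by rewrite -bin2_sum big_nat_recl.
Qed.

Section wavelets.
Context {R : realType}.
Local Notation mu := (@lebesgue_measure R).

Definition L2 : set (R -> R) := [set f | f \in Lfun mu 2%:E].

Definition L2norm (f : R -> R) : \bar R := 'N[mu]_2%:E [EFin \o f].

Definition L2dot (f g : R -> R) : R := \int[mu]_t (f t * g t).

Record orthonormal_basis (V : set (R -> R)) (e : int -> R -> R) : Prop := {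
  onb_mem : forall k, V (e k) ;
  onb_orthonormal : forall k l, L2dot (e k) (e l) = (k == l)%:R ;
  onb_total : forall f, V f -> forall eps : R, 0 < eps ->
    exists (s : seq int) (c : int -> R),
      (L2norm (fun t => f t - \sum_(k <- s) c k * e k t)%R < eps%:E)%E }.

(* Convention: V_(j+1) is contained in V_j, larger j meaning coarser scales. *)
Record multiresolution (V : int -> set (R -> R)) (phi : R -> R) : Prop := {
  mra_L2 : forall j, V j `<=` L2 ;
  mra_zero : forall j, V j (cst 0) ;
  mra_linear : forall j c f g, V j f -> V j g -> V j (fun t => c * f t + g t) ;
  mra_closed : forall j f, L2 f ->
    (forall eps : R, 0 < eps -> exists2 g, V j g & (L2norm (fun t => f t - g t)%R < eps%:E)%E) ->
    V j f ;
  mra_nested : forall j, V (j + 1) `<=` V j ;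
  mra_dense : forall f, L2 f -> forall eps : R, 0 < eps ->
    exists j, exists2 g, V j g & (L2norm (fun t => f t - g t)%R < eps%:E)%E ;
  mra_separated : forall f, (forall j, V j f) -> {ae mu, forall t, f t = 0} ;
  mra_dilation : forall j f, V j f <-> V 0 (fun t => f (2 ^ j * t)) ;
  mra_scaling : orthonormal_basis (V 0) (fun k t => phi (t - k%:~R)) }.

(* phi is the scaling function and psi the wavelet: the integer translates of
   psi span the orthogonal complement of V_0 in V_(-1). *)
Definition mra_wavelet (phi psi : R -> R) : Prop :=
  exists2 V, multiresolution V phi &
    orthonormal_basis [set f | V (-1) f /\ forall g, V 0 g -> L2dot f g = 0]
      (fun k t => psi (t - k%:~R)).

Definition fourier (f : R -> R) (x : R) : R[i] :=
  ((\int[mu]_t (f t * cos (x * t))) +i* (- \int[mu]_t (f t * sin (x * t))))%C.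

Definition compactly_supported (f : R -> R) : Prop :=
  compact (closure [set t | f t != 0]).

Definition vanishing_moments (psi : R -> R) (N : nat) : Prop :=
  [/\ \int[mu]_t (psi t ^+ 2) = 1,
      forall k, (k < N)%N -> \int[mu]_t (t ^+ k * psi t) = 0 &
      \int[mu]_t (t ^+ N * psi t) != 0].

Definition L1_compact_support (phi psi : R -> R) : Prop :=
  [/\ mu.-integrable setT (EFin \o phi), mu.-integrable setT (EFin \o psi),
      compactly_supported phi, compactly_supported psi &
      fourier phi 0 = 1].

Definition fourier_decay (psi : R -> R) (alpha : R) : Prop :=
  has_ubound (range (fun x : R =>
    ComplexField.Normc.normc (fourier psi x) * (1 + `|x|) `^ alpha)).

Variables phi psi : R -> R.

Definition wfilter (j : nat) (l : int) : R :=
  2 `^ (- (j%:R / 2)) * \int[mu]_t (phi (t + l%:~R) * psi (2 ^- j * t)).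

Context d (T : measurableType d).

(* D(2^j, k).  The sum over the integers has finite support when phi and psi
   are compactly supported. *)
Definition wcoef p (Y : int -> T -> 'cV[R]_p) (j k : nat) (w : T) : 'cV[R]_p :=
  \sum_(l \in [set: int]) wfilter j ((2 ^ j * k)%N%:Z - l) *: Y l w.

(* Number n / 2^j of available coefficients at octave j from n observations
   (integer part when 2^j does not divide n). *)
Definition navail (n j : nat) : nat := (n %/ 2 ^ j)%N.

Definition wcov p q (U : int -> T -> 'cV[R]_p) (V : int -> T -> 'cV[R]_q)
    (n j : nat) (w : T) : 'M[R]_(p, q) :=
  (navail n j)%:R^-1 *:
    \sum_(1 <= k < (navail n j).+1) wcoef U j k w *m (wcoef V j k w)^T.

End wavelets.

Section probability.
Context {R : realType} d (T : measurableType d) (P : probability T R).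

Definition measurable_mx m n (M : T -> 'M[R]_(m, n)) : Prop :=
  forall i l, measurable_fun setT (fun w => M w i l).

Definition Emx m n (M : T -> 'M[R]_(m, n)) : 'M[R]_(m, n) :=
  \matrix_(i, l) fine ('E_P[fun w => M w i l])%E.

Definition all_moments m n (M : T -> 'M[R]_(m, n)) : Prop :=
  forall i l (k : nat), P.-integrable setT (fun w => (M w i l ^+ k)%:E).

Definition bounded_in_prob (f : nat -> T -> R) : Prop :=
  forall eps : R, 0 < eps ->
    exists C : R, \forall n \near \oo, (P [set w | (C < `|f n w|)%R] <= eps%:E)%E.

Definition cvg_in_prob (f : nat -> T -> R) (c : R) : Prop :=
  forall eps : R, 0 < eps ->
    P [set w | eps <= `|f n w - c|] @[n --> \oo] --> 0%E.

(* G has law N(0, Sigma), Sigma possibly singular: every linear combination of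
   the entries of G is univariate normal with the prescribed variance.  The
   degenerate case is separate because [normal_prob 0 0] is not [\d_0]. *)
Definition gaussian_vector N (Sigma : 'M[R]_N) (G : T -> 'rV[R]_N) : Prop :=
  measurable_mx G /\
  forall (u : 'cV[R]_N) (A : set R), measurable A ->
    let v := (u^T *m Sigma *m u) 0 0 in
    P [set w | A ((G w *m u) 0 0)] =
      (if v == 0 then \d_(0 : R) A else normal_prob 0 (Num.sqrt v) A).

End probability.

Section weak_convergence.
Context {R : realType} d (T : measurableType d) (P : probability T R).

Definition cvg_in_distr d' (T' : measurableType d') (Q : probability T' R) N
    (X : nat -> T -> 'rV[R]_N) (G : T' -> 'rV[R]_N) : Prop :=
  forall f : 'rV[R]_N -> R, continuous f -> (exists C, forall x, `|f x| <= C) ->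
    ('E_P[f \o X n] @[n --> \oo] --> 'E_Q[f \o G])%E.

Definition cvg_to_gaussian N (X : nat -> T -> 'rV[R]_N) (Sigma : 'M[R]_N) :=
  exists d' (T' : measurableType d') (Q : probability T' R) (G : T' -> 'rV[R]_N),
    gaussian_vector Q Sigma G /\ cvg_in_distr Q X G.

End weak_convergence.

(* Main.v *)
Require Import Defs.
From HB Require Import structures.
From mathcomp Require Import all_boot all_order all_algebra.
From mathcomp Require Import perm spectral.
From mathcomp Require Import complex.
From mathcomp Require Import ring lra.
From mathcomp Require Import all_classical all_reals all_analysis.
From mathcomp Require Import measurable_realfun.

Set Implicit Arguments.
Unset Strict Implicit.
Unset Printing Implicit Defensive.
Import Order.TTheory GRing.Theory Num.Theory.
Import numFieldNormedType.Exports.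
Local Open Scope classical_set_scope.
Local Open Scope ring_scope.

(** Write a = a(n), D = diag (a^(h_i + 1/2)) and P P_H = Q R.  The signal part of
    the sample wavelet covariance is P W_X P^T = Q M(Bhat) Q^T with
    M(B) = R D B D R^T (signal_factorization), and Q is an isometry, so that its
    r largest eigenvalues are those of the r x r matrix M(Bhat), the i-th of
    which has the order a^(2 h_i + 1).  Likewise the mean of W has the signal
    part Q M(B_a) Q^T.  It remains to compare W with its signal part, and to
    linearize the eigenvalues of M at B_a.

    Noise.  By the inequality of arithmetic and geometric means on the cross
    terms, W lies between (1 - eta) S - O(1/eta) and (1 + eta) S + O(1/eta) in the
    order of quadratic forms, S being the signal part
    (signal_plus_noise_forms).  With eta = a^(-h_1 - 1/2) all relative errors of
    the top r eigenvalues are O(eta), and sqrt(n_{a,j}) eta tends to zero since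
    n / a^(h_1 + 3/2) does (sampling_rates).  Hence the logarithms of the
    eigenvalues of W and of M(Bhat), and those of E W and of M(B_a), differ by
    o(1 / sqrt(n_{a,j})) (noisy_log_eigenvalue).

    Linearization.  The eigenvalues of M(B) have different orders of magnitude,
    which rules out smooth perturbation theory on M itself.  Fix q, and let
    d_i = a^(h_i + 1/2) and e_i = max(d_i, d_q).  The determinant of the block
    matrix (B, S; y S, T R^T R T), with S = diag (d_q / e_i) and
    T = diag (d_i / e_i), equals
    (-1)^r prod_i (y d_q^2 - lambda_i(M(B))) / e_i^2 (block_det_eigenvalues).
    Take y = lambda_q(M(B_a)) / d_q^2.  At B_a the determinant vanishes; at Bhat
    it is the difference of the two eigenvalues divided by d_q^2, times factors
    whose product has a nonzero limit: for h_i <> h_q one of the two terms of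
    the factor dominates, and for h_i = h_q it tends to xi_q - xi_i.  On the
    other hand the entries of the block matrix converge, so that the increment
    of the determinant between B_a and Bhat is a linear combination of the
    entries of Bhat - B_a with convergent coefficients (divided_difference_det).
    Comparing both expressions yields deterministic g_il with
    sqrt(n_{a,j}) (log lambda_q(M(Bhat)) - log lambda_q(M(B_a)))
      = sum_il g_il sqrt(n_{a,j}) (Bhat - B_a)_il + o_P(1)
    (log_eigenvalue_linearization).

    Conclusion.  The vector of the statement is a fixed linear image of the
    asymptotically Gaussian vector of all the Bhat - B_a, up to o_P(1), and
    Slutsky's theorem applies (gaussian_limit_linearization).

    All limits in probability are limits along the filter whp of sequences of
    events whose probability tends to one, so that random and deterministic
    sequences obey the same lemmas. *)

(** * Quadratic forms and the real spectral theorem *)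

Section quadratic_forms.
Context {R : realType}.

Definition qf n (M : 'M[R]_n) (u : 'cV[R]_n) : R := (u^T *m M *m u) 0 0.

Definition loewner n (M N : 'M[R]_n) := forall u, qf M u <= qf N u.

Lemma qfD n (M N : 'M[R]_n) u : qf (M + N) u = qf M u + qf N u.
Proof. by rewrite /qf mulmxDr mulmxDl mxE. Qed.

Lemma qfZ n c (M : 'M[R]_n) u : qf (c *: M) u = c * qf M u.
Proof. by rewrite /qf -scalemxAr -scalemxAl mxE. Qed.

Lemma qfN n (M : 'M[R]_n) u : qf (- M) u = - qf M u.
Proof. by rewrite -scaleN1r qfZ mulN1r. Qed.

Lemma qf_sum n I (s : seq I) (F : I -> 'M[R]_n) (u : 'cV[R]_n) :
  qf (\sum_(i <- s) F i) u = \sum_(i <- s) qf (F i) u.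
Proof.
elim: s => [|a s IH]; last by rewrite !big_cons qfD IH.
by rewrite !big_nil /qf mulmx0 mul0mx mxE.
Qed.

Lemma qf_congr p n (C : 'M[R]_(p, n)) (M : 'M[R]_n) u :
  qf (C *m M *m C^T) u = qf M (C^T *m u).
Proof. by rewrite /qf trmx_mul trmxK !mulmxA. Qed.

Lemma qf_tr n (M : 'M[R]_n) u : qf M^T u = qf M u.
Proof.
have -> : qf M^T u = (u^T *m M^T *m u)^T 0 0 by rewrite [RHS]mxE.
by rewrite !trmx_mul !trmxK mulmxA.
Qed.

Lemma qf_diag n (d : 'rV[R]_n) u :
  qf (diag_mx d) u = \sum_i d 0 i * (u i 0 ^+ 2).
Proof.
rewrite /qf mxE; apply: eq_bigr => i _; rewrite mul_mx_diag !mxE.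
by ring.
Qed.

Lemma qf1 n (u : 'cV[R]_n) : qf 1%:M u = \sum_i u i 0 ^+ 2.
Proof.
rewrite -diag_const_mx qf_diag; apply: eq_bigr => i _.
by rewrite mxE mul1r.
Qed.

Lemma qf_scalar n c (u : 'cV[R]_n) : qf c%:M u = c * qf 1%:M u.
Proof. by rewrite -[c%:M]scalemx1 qfZ. Qed.

Lemma qf1_ge0 n (u : 'cV[R]_n) : 0 <= qf 1%:M u.
Proof. by rewrite qf1; apply: sumr_ge0 => i _; rewrite sqr_ge0. Qed.

Lemma qf1_gt0 n (u : 'cV[R]_n) : u != 0 -> 0 < qf 1%:M u.
Proof.
move=> u0; rewrite lt_neqAle qf1_ge0 andbT eq_sym; apply: contraNneq u0.
rewrite qf1 => /psumr_eq0P u0; apply/eqP/colP => i; rewrite mxE.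
by apply/eqP; rewrite -sqrf_eq0 u0// => l _; rewrite sqr_ge0.
Qed.

End quadratic_forms.

Section spectral_theorem.
Context {R : realType}.

(** The Hermitian spectral theorem over R[i] gives a real eigenvalue; as the
    characteristic polynomial is real, that eigenvalue also has a real
    eigenvector. *)
Lemma sym_eigenvector n (M : 'M[R]_n.+1) : M^T = M ->
  exists a, exists2 v : 'cV[R]_n.+1, v != 0 & M *m v = a *: v.
Proof.
move=> Msym; pose A := map_mx (real_complex R) M.
have Aherm : A \is hermsymmx.
  apply: realsym_hermsym.
    apply/is_hermitianmxP; rewrite expr0 scale1r map_mx_id //.
    by rewrite /A map_trmx Msym.
  by apply/mxOverP => i l; rewrite mxE; apply/complex_realP; eexists.
have /mxOverP /(_ 0 0) /complex_realP [a sa] := hermitian_spectral_diag_real Aherm.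
have /hermitian_normalmx /orthomx_spectralP As := Aherm.
have : eigenvalue A a%:C%C.
  apply/eigenvalueP; exists (row 0 (spectralmx A)).
    rewrite {2}As -row_mul !mulmxA mulmxV ?spectral_unit// mul1mx.
    by rewrite row_mul row_diag_mx -scalemxAl -rowE sa.
  apply/eqP => r0; have : row 0 (spectralmx A) *m invmx (spectralmx A) = delta_mx 0 0.
    by rewrite rowE -mulmxA mulmxV ?spectral_unit// mulmx1.
  by rewrite r0 mul0mx => /matrixP/(_ 0 0)/eqP; rewrite !mxE eq_sym oner_eq0.
rewrite eigenvalue_root_char -map_char_poly fmorph_root -eigenvalue_root_char.
move=> /eigenvalueP[v vM v0]; exists a, v^T.
  by rewrite -(trmx0 R) (inj_eq (@trmx_inj _ _ _)).
by rewrite -{1}Msym -trmx_mul vM linearZ.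
Qed.

(** The matrix is the reflection that exchanges v and the first basis vector e:
    its mirror is orthogonal to e - v. *)
Lemma orthogonal_with_first_column n (v : 'cV[R]_n.+1) : v^T *m v = 1%:M ->
  exists2 U : 'M[R]_n.+1, U^T *m U = 1%:M & U *m delta_mx 0 0 = v.
Proof.
move=> v1; set e : 'cV[R]_n.+1 := delta_mx 0 0.
have e1 : e^T *m e = 1%:M.
  by rewrite /e trmx_delta mul_delta_mx; apply/matrixP => i l; rewrite !ord1 !mxE.
have [->|w0] := eqVneq v e.
  by exists 1%:M; rewrite ?trmx1 mul1mx.
pose w : 'cV[R]_n.+1 := e - v.
have sym : v^T *m e = e^T *m v.
  by rewrite -[RHS](trmxK) trmx_mul trmxK; apply/matrixP => i l; rewrite !ord1 [RHS]mxE.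
pose c : R := (e^T *m v) 0 0.
have ev : e^T *m v = c%:M by apply/matrixP => i l; rewrite !ord1 [RHS]mxE.
have wn : qf 1%:M w = 2 * (1 - c).
  rewrite /qf mulmx1 /w [(e - v)^T]linearB /= mulmxBl !mulmxBr e1 v1 sym ev !mxE /=; ring.
have c1 : 1 - c != 0.
  have : 0 < qf 1%:M w by rewrite qf1_gt0 // subr_eq0 eq_sym.
  by rewrite wn pmulr_rgt0 // => /lt0r_neq0.
have ww : w^T *m w = (2 * (1 - c))%:M.
  by apply/matrixP => i l; rewrite !ord1 [RHS]mxE /= -wn /qf mulmx1.
have we : w^T *m e = (1 - c)%:M.
  rewrite /w linearB /= mulmxBl e1 sym ev.
  by rewrite -[LHS](raddfB (@scalar_mx R 1)).
exists (1%:M - (1 - c)^-1 *: (w *m w^T)).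
  rewrite [_^T]linearB /= trmx1 [(_ *: _)^T]linearZ /= trmx_mul trmxK.
  rewrite mulmxBl !mulmxBr !mul1mx mulmx1 -scalemxAl -scalemxAr.
  rewrite [w *m w^T *m (w *m w^T)]mulmxA -[w *m w^T *m w]mulmxA ww.
  rewrite mul_mx_scalar -scalemxAl !scalerA opprB -addrA.
  rewrite -scalerBl -scaleNr -scalerDl (_ : _ + _ = 0 :> R) ?scale0r ?addr0//.
  field.
  exact: c1.
rewrite mulmxBl mul1mx -scalemxAl -mulmxA we mul_mx_scalar scalerA.
by rewrite mulVf // scale1r /w subKr.
Qed.

(** Deflation: in an orthonormal basis whose first vector is an eigenvector the
    matrix is block diagonal, and the lower block is treated by induction. *)
Lemma symmetric_spectral n (M : 'M[R]_n) : M^T = M ->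
  exists U : 'M[R]_n, exists2 d : 'rV[R]_n,
    U^T *m U = 1%:M & M = U^T *m diag_mx d *m U.
Proof.
elim: n M => [|n IH] M Msym.
  exists 1%:M, 0; rewrite ?trmx1 ?mul1mx //.
  by apply/matrixP => - [].
have [a [v v0 Mv]] := sym_eigenvector Msym.
pose s := Num.sqrt (qf 1%:M v).
have s0 : s != 0 by rewrite sqrtr_eq0 -ltNge qf1_gt0.
have ss : s ^+ 2 = qf 1%:M v by rewrite sqr_sqrtr // qf1_ge0.
pose v' : 'cV[R]_n.+1 := s^-1 *: v.
have v1 : v'^T *m v' = 1%:M.
  rewrite /v' [(_ *: v)^T]linearZ /= -scalemxAl -scalemxAr scalerA.
  apply/matrixP => i l; rewrite !ord1 !mxE /= mulr1n.
  rewrite (_ : \sum_j _ = qf 1%:M v); last by rewrite /qf mulmx1 mxE.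
  by rewrite -ss; field.
have Mv' : M *m v' = a *: v' by rewrite -scalemxAr Mv !scalerA mulrC.
have [U UU Ue] := orthogonal_with_first_column v1.
have UU' := mulmx1C UU.
have [M' M'E] : exists M' : 'M[R]_(1 + n), M' = U^T *m M *m U by eexists.
have M'sym : M'^T = M' by rewrite M'E !trmx_mul trmxK Msym mulmxA.
have M'e : M' *m delta_mx 0 0 = a *: delta_mx 0 (0 : 'I_1).
  by rewrite M'E -!mulmxA Ue Mv' -scalemxAr -Ue mulmxA UU mul1mx.
have M'0 i : M' i 0 = a * (i == 0)%:R.
  have := congr1 (fun N : 'cV[R]_(1 + n) => N i 0) M'e.
  by rewrite -colE !mxE /= andbT.
have l0 : lshift n (0 : 'I_1) = 0 by apply/val_inj.
have M'b : M' = block_mx a%:M 0 0 (drsubmx M').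
  rewrite -[LHS]submxK; congr block_mx.
  - by apply/matrixP => i l; rewrite !ord1 !mxE l0 M'0 eqxx mulr1.
  - apply/matrixP => i l; rewrite !ord1 !mxE l0 -[M']M'sym mxE M'0.
    by rewrite (_ : _ == _ = false) ?mulr0.
  - apply/matrixP => i l; rewrite !ord1 !mxE l0 M'0.
    by rewrite (_ : _ == _ = false) ?mulr0.
have Nsym : (drsubmx M')^T = drsubmx M' by rewrite -{2}M'sym trmx_drsub.
have [V [d VV Nd]] := IH _ Nsym.
pose V1 : 'M[R]_(1 + n) := block_mx 1%:M 0 0 V.
have V1V : V1^T *m V1 = 1%:M.
  rewrite /V1 tr_block_mx !trmx0 trmx1 mulmx_block !mulmx0 !mul0mx mulmx1.
  by rewrite VV !addr0 add0r -scalar_mx_block.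
have -> : M = U *m M' *m U^T.
  by rewrite M'E !mulmxA UU' mul1mx -mulmxA UU' mulmx1.
have M'D : M' = V1^T *m diag_mx (row_mx a%:M d : 'rV[R]_(1 + n)) *m V1.
  rewrite {1}M'b {1}Nd /V1 diag_mx_row tr_block_mx !trmx0 trmx1 !mulmx_block.
  rewrite !mulmx0 !mul0mx !mulmx1 !mul1mx !addr0 !add0r; congr block_mx.
  - by apply/matrixP => i l; rewrite !ord1 !mxE.
  - by rewrite mul0mx.
exists (V1 *m U^T), (row_mx a%:M d : 'rV[R]_(1 + n)).
  by rewrite trmx_mul trmxK mulmxA -[U *m _ *m V1]mulmxA V1V mulmx1.
by rewrite trmx_mul trmxK M'D !mulmxA.
Qed.

End spectral_theorem.

(** * Ordered eigenvalues of symmetric matrices *)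

Section characteristic_polynomials.

(** Both sides are the determinant of the block matrix (x, A; B, 1), reduced by
    column and by row operations. *)
Lemma det_scalar_sub_mulC (K : comNzRingType) m n (A : 'M[K]_(m, n))
    (B : 'M[K]_(n, m)) (x : K) :
  x ^+ n * \det (x%:M - A *m B) = x ^+ m * \det (x%:M - B *m A).
Proof.
pose M := block_mx x%:M A B 1%:M.
have L : \det (M *m block_mx 1%:M 0 (- B) 1%:M) = \det (x%:M - A *m B).
  rewrite /M mulmx_block !mulmx0 !mulmx1 mul1mx add0r subrr mulmxN add0r.
  by rewrite det_ublock det1 mulr1.
have L' : \det (block_mx 1%:M 0 (- B) x%:M *m M) = x ^+ m * \det (x%:M - B *m A).
  rewrite /M mulmx_block !mul0mx !mul1mx !addr0 mulmx1 mul_mx_scalar.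
  rewrite mul_scalar_mx scalerN addNr mulNmx addrC.
  by rewrite det_ublock det_scalar.
rewrite -L -L' !det_mulmx !det_lblock !det1 det_scalar !mul1r mulr1.
by rewrite mulrC.
Qed.

Lemma horner_char_poly (K : comNzRingType) n (A : 'M[K]_n) x :
  (char_poly A).[x] = \det (x%:M - A).
Proof.
rewrite -horner_evalE /char_poly -det_map_mx; congr (\det _).
apply/matrixP => i l; rewrite !mxE /= /horner_eval !hornerE.
by case: (i == l); rewrite !hornerE.
Qed.

Lemma char_poly_mulC_rect (K : comNzRingType) m n (A : 'M[K]_(m, n))
    (B : 'M[K]_(n, m)) :
  'X^n * char_poly (A *m B) = 'X^m * char_poly (B *m A).
Proof.
have := det_scalar_sub_mulC (map_mx polyC A) (map_mx polyC B) 'X.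
by rewrite -!map_mxM.
Qed.

Lemma char_poly_mulC (K : idomainType) n (A B : 'M[K]_n) :
  char_poly (A *m B) = char_poly (B *m A).
Proof.
have /eqP := char_poly_mulC_rect A B.
by rewrite (inj_eq (mulfI _)) ?monic_neq0 ?monicXn // => /eqP.
Qed.

End characteristic_polynomials.

Section eigenvalues_of_symmetric_matrices.
Context {R : realType}.

Lemma eigenvaluesP n (M : 'M[R]_n) (s : seq R) : sorted <=%R s ->
  char_poly M = \prod_(x <- s) ('X - x%:P) -> eigenvalues M = s.
Proof.
move=> ss Ms; have [] : [set s : seq R | sorted <=%R s /\
    char_poly M = \prod_(x <- s) ('X - x%:P)] (eigenvalues M).
  by apply: xgetPex; exists s.
move=> es Me; apply: (sorted_eq le_trans le_anti es ss).
by apply: prod_XsubC_eq; rewrite -Me -Ms.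
Qed.

Lemma eigenvalues_diag_sorted n (M U : 'M[R]_n) (d : 'rV[R]_n) :
  U^T *m U = 1%:M -> M = U^T *m diag_mx d *m U ->
  eigenvalues M = sort <=%R [seq d 0 i | i <- enum 'I_n].
Proof.
move=> UU MU; apply: eigenvaluesP; first exact: (sort_sorted le_total).
rewrite MU -mulmxA char_poly_mulC -mulmxA (mulmx1C UU) mulmx1.
rewrite char_poly_trig ?diag_mx_is_trig //.
rewrite (perm_big _ (permEl (perm_sort _ _))) /= big_map big_enum.
by apply: eq_bigr => i _; rewrite mxE eqxx mulr1n.
Qed.

Lemma eigenvalues_spectral n (M : 'M[R]_n) : M^T = M ->
  size (eigenvalues M) = n /\ sorted <=%R (eigenvalues M) /\
  exists2 U : 'M[R]_n, U^T *m U = 1%:M &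
    M = U^T *m diag_mx (\row_i (eigenvalues M)`_i) *m U.
Proof.
move=> Msym; have [U [d UU MU]] := symmetric_spectral Msym.
have eM := eigenvalues_diag_sorted UU MU.
have sz : size (eigenvalues M) = n.
  by rewrite eM size_sort size_map size_enum_ord.
split=> //; split; first by rewrite eM; exact: (sort_sorted le_total).
pose t := [tuple d 0 i | i < n].
have /tuple_permP[s es] : perm_eq (eigenvalues M) t.
  by rewrite eM perm_sort.
exists (row_perm s U).
  apply/matrixP => i l; rewrite -UU !mxE [RHS](reindex_inj (@perm_inj _ s)).
  by apply: eq_bigr => k _; rewrite !mxE.
rewrite {1}MU; apply/matrixP => i l; rewrite !mxE.
rewrite [LHS](reindex_inj (@perm_inj _ s)); apply: eq_bigr => k _.
rewrite !mul_mx_diag !mxE; congr (_ * _ * _).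
rewrite es (nth_map k) ?size_enum_ord // nth_ord_enum.
by rewrite tnth_mktuple.
Qed.

Lemma char_poly_eigenvalues n (M : 'M[R]_n) : M^T = M ->
  char_poly M = \prod_(i < n) ('X - ((eigenvalues M)`_i)%:P).
Proof.
move=> /eigenvalues_spectral[_ [_ [U UU MU]]].
rewrite {1}MU -mulmxA char_poly_mulC -mulmxA (mulmx1C UU) mulmx1.
rewrite char_poly_trig ?diag_mx_is_trig //.
by apply: eq_bigr => i _; rewrite !mxE eqxx mulr1n.
Qed.

Lemma le_eigenvalues n (M : 'M[R]_n) i l : M^T = M -> (i <= l < n)%N ->
  (eigenvalues M)`_i <= (eigenvalues M)`_l.
Proof.
move=> /eigenvalues_spectral[sz [es _]] /andP[il ln].
apply: (sorted_leq_nth le_trans lexx) => //; rewrite inE ?sz //.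
exact: leq_ltn_trans ln.
Qed.

Lemma qf_spectral n (M U : 'M[R]_n) (d : 'rV[R]_n) u :
  M = U^T *m diag_mx d *m U -> qf M u = \sum_i d 0 i * ((U *m u) i 0 ^+ 2).
Proof.
by move=> ->; rewrite -{2}[U]trmxK qf_congr trmxK qf_diag.
Qed.

Lemma qf1_orthogonal n (U : 'M[R]_n) u : U^T *m U = 1%:M ->
  qf 1%:M u = \sum_i ((U *m u) i 0 ^+ 2).
Proof.
move=> UU; rewrite -UU (_ : U^T *m U = U^T *m 1%:M *m U^T^T).
  by rewrite qf_congr trmxK qf1.
by rewrite trmxK mulmx1.
Qed.

(** The i+1 smallest eigendirections of the larger form and the n-i largest
    ones of the smaller form span spaces that meet: a nonzero vector in both
    is a zero of the singular matrix built below from n-1 coordinate forms. *)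
Lemma eigenvalues_monotone n (M N : 'M[R]_n) (i : 'I_n) :
  M^T = M -> N^T = N -> loewner M N -> (eigenvalues M)`_i <= (eigenvalues N)`_i.
Proof.
move=> Ms Ns MN.
have [_ [_ [U UU MU]]] := eigenvalues_spectral Ms.
have [_ [_ [V VV NV]]] := eigenvalues_spectral Ns.
pose E : 'M[R]_n := \matrix_(l, k)
  (if (l < i)%N then U l k else if (i < l)%N then V l k else 0).
have /det0P[v v0 vE] : \det E^T == 0.
  rewrite det_tr (expand_det_row _ i) big1 // => k _.
  by rewrite mxE ltnn mul0r.
have {vE} Ev : E *m v^T = 0 by rewrite -[E]trmxK -trmx_mul vE trmx0.
have Uv (l : 'I_n) : (l < i)%N -> (U *m v^T) l 0 = 0.
  move=> li; have := congr1 (fun A : 'cV[R]_n => A l 0) Ev.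
  rewrite !mxE => E0; rewrite -[RHS]E0; apply: eq_bigr => k _.
  by rewrite [E _ _]mxE li.
have Vv (l : 'I_n) : (i < l)%N -> (V *m v^T) l 0 = 0.
  move=> li; have := congr1 (fun A : 'cV[R]_n => A l 0) Ev.
  rewrite !mxE => E0; rewrite -[RHS]E0; apply: eq_bigr => k _.
  by rewrite [E _ _]mxE li ltnNge (ltnW li).
have vp : 0 < qf 1%:M v^T.
  by rewrite qf1_gt0 // -(trmx0 R) (inj_eq (@trmx_inj _ _ _)).
have lo : (eigenvalues M)`_i * qf 1%:M v^T <= qf M v^T.
  rewrite (qf_spectral _ MU) (qf1_orthogonal _ UU) mulr_sumr.
  apply: ler_sum => l _; have [li|il] := ltnP l i.
    by rewrite Uv // expr0n /= !mulr0.
  by rewrite ler_wpM2r ?sqr_ge0 // mxE le_eigenvalues // il /=.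
have hi : qf N v^T <= (eigenvalues N)`_i * qf 1%:M v^T.
  rewrite (qf_spectral _ NV) (qf1_orthogonal _ VV) mulr_sumr.
  apply: ler_sum => l _; have [li|il] := ltnP i l.
    by rewrite Vv // expr0n /= !mulr0.
  by rewrite ler_wpM2r ?sqr_ge0 // mxE le_eigenvalues // il /=.
by rewrite -(ler_pM2r vp); apply: le_trans lo (le_trans (MN _) hi).
Qed.

(** Scaling and shifting the larger matrix turns monotonicity into quantitative
    bounds, so that Weyl's inequalities are instances of monotonicity. *)
Lemma eigenvaluesZD n (M : 'M[R]_n) c t (i : 'I_n) : M^T = M -> 0 <= c ->
  (eigenvalues (c *: M + t%:M))`_i = c * (eigenvalues M)`_i + t.
Proof.
move=> Ms c0; have [sz [es [U UU MU]]] := eigenvalues_spectral Ms.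
set s := eigenvalues M in sz es MU *.
rewrite (@eigenvaluesP _ _ [seq c * x + t | x <- s]).
- by rewrite (nth_map 0) // sz.
- rewrite sorted_map; apply: sub_sorted es => x y xy /=.
  by rewrite lerD2r ler_wpM2l.
have -> : c *: M + t%:M = U^T *m (diag_mx (\row_(l < n) (c * s`_l + t))) *m U.
  have -> : diag_mx (\row_(l < n) (c * s`_l + t)) = 
      c *: diag_mx (\row_(l < n) s`_l) + t%:M.
    apply/matrixP => k l; rewrite !mxE.
    by case: (k == l); rewrite ?mulr1n // !mulr0n mulr0 addr0.
  rewrite mulmxDr mulmxDl -scalemxAr -scalemxAl -MU mul_mx_scalar -scalemxAl UU.
  by rewrite scalemx1.
rewrite -mulmxA char_poly_mulC -mulmxA (mulmx1C UU) mulmx1.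
rewrite char_poly_trig ?diag_mx_is_trig // big_map (big_nth 0) sz big_mkord.
by apply: eq_bigr => k _; rewrite !mxE eqxx mulr1n.
Qed.

Lemma eigenvalues_ge0 n (M : 'M[R]_n) i : M^T = M ->
  (forall u, 0 <= qf M u) -> 0 <= (eigenvalues M)`_i.
Proof.
move=> Ms M0; have [sz _] := eigenvalues_spectral Ms.
have [ni|ni] := ltnP i n; last by rewrite nth_default // sz.
have := @eigenvaluesZD n M 0 0 (Ordinal ni) Ms (lexx 0).
rewrite scale0r add0r mul0r add0r /= => e0; rewrite -{1}e0.
apply: (@eigenvalues_monotone _ _ _ (Ordinal ni)) => //.
  by rewrite tr_scalar_mx.
by move=> u; rewrite qf_scalar mul0r.
Qed.

Lemma eigenvalues_diag n (d : 'rV[R]_n) :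
  (forall i l : 'I_n, (i <= l)%N -> d 0 i <= d 0 l) ->
  forall i : 'I_n, (eigenvalues (diag_mx d))`_i = d 0 i.
Proof.
move=> dm i; rewrite (@eigenvaluesP _ _ [seq d 0 l | l <- enum 'I_n]).
- by rewrite (nth_map i) ?size_enum_ord // nth_ord_enum.
- rewrite sorted_map; have : sorted (relpre val leq) (enum 'I_n).
    by rewrite -sorted_map val_enum_ord iota_sorted.
  by apply: sub_sorted => k l /=; exact: dm.
rewrite char_poly_trig ?diag_mx_is_trig // big_map big_enum.
by apply: eq_bigr => k _; rewrite mxE eqxx mulr1n.
Qed.

Lemma eigenvalues_mulC n (A B : 'M[R]_n) :
  eigenvalues (A *m B) = eigenvalues (B *m A).
Proof. by rewrite /eigenvalues char_poly_mulC. Qed.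

(** The nonzero spectrum of Q (M Q^T) is that of (M Q^T) Q = M; the p - r added
    eigenvalues vanish and, M being positive semidefinite, come first. *)
Lemma eigenvalues_isometry p r (Q : 'M[R]_(p, r)) (M : 'M[R]_r) :
  Q^T *m Q = 1%:M -> (r <= p)%N -> M^T = M -> (forall u, 0 <= qf M u) ->
  eigenvalues (Q *m M *m Q^T) = nseq (p - r) 0 ++ eigenvalues M.
Proof.
move=> QQ rp Ms M0; have [sz [es _]] := eigenvalues_spectral Ms.
have e0 x : x \in eigenvalues M -> 0 <= x.
  by move=> /(nthP 0)[i _ <-]; exact: eigenvalues_ge0.
apply: eigenvaluesP.
  rewrite (sorted_pairwise le_trans) pairwise_cat -!(sorted_pairwise le_trans) es.
  rewrite andbT; apply/andP; split.
    by apply/allrelP => x y /nseqP[-> _] /e0.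
  by elim: (p - r)%N => //= k; case: k => //= k ->; rewrite lexx.
have := char_poly_mulC_rect Q (M *m Q^T).
have Xp : 'X^p = 'X^(p - r) * 'X^r :> {poly R} by rewrite -exprD subnK.
rewrite -[M *m _ *m Q]mulmxA QQ mulmx1 mulmxA Xp -mulrA mulrCA.
move=> /(mulfI (monic_neq0 (monicXn _ _))) ->.
rewrite (char_poly_eigenvalues Ms) big_cat /= big_nseq.
congr (_ * _); last by rewrite (big_nth 0) sz big_mkord.
by rewrite subr0 iter_mulr_1.
Qed.

End eigenvalues_of_symmetric_matrices.

Section perturbation.
Context {R : realType}.

Lemma eigenvaluesZ_le n k (N N' : 'M[R]_n) (i : 'I_n) :
  0 <= k -> N^T = N -> N'^T = N' -> (forall u, k * qf N u <= qf N' u) ->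
  k * (eigenvalues N)`_i <= (eigenvalues N')`_i.
Proof.
move=> k0 Ns N's NN'; have := eigenvaluesZD 0 i Ns k0; rewrite addr0 => <-.
apply: eigenvalues_monotone => //.
  by rewrite linearD /= linearZ /= tr_scalar_mx Ns.
by move=> u; rewrite qfD qfZ qf_scalar mul0r addr0.
Qed.

Lemma eigenvaluesZ_ge n k (N N' : 'M[R]_n) (i : 'I_n) :
  0 <= k -> N^T = N -> N'^T = N' -> (forall u, qf N' u <= k * qf N u) ->
  (eigenvalues N')`_i <= k * (eigenvalues N)`_i.
Proof.
move=> k0 Ns N's NN'; have := eigenvaluesZD 0 i Ns k0; rewrite addr0 => <-.
apply: eigenvalues_monotone => //.
  by rewrite linearD /= linearZ /= tr_scalar_mx Ns.
by move=> u; rewrite qfD qfZ qf_scalar mul0r addr0.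
Qed.

(** Replacing B by a multiple of the identity leaves a multiple of
    (C D) (C D)^T, which has the eigenvalues of D (C^T C) D, where D = diag d;
    replacing C^T C by a multiple of the identity in turn leaves one of D^2. *)
Lemma graded_eigenvalues_bounds r (C B : 'M[R]_r) (d : 'rV[R]_r) (b0 b1 a0 a1 : R) :
  B^T = B -> 0 <= b0 -> 0 <= b1 -> 0 <= a0 -> 0 <= a1 ->
  (forall u, b0 * qf 1%:M u <= qf B u <= b1 * qf 1%:M u) ->
  (forall u, a0 * qf 1%:M u <= qf (C^T *m C) u <= a1 * qf 1%:M u) ->
  (forall i, 0 <= d 0 i) -> (forall i l : 'I_r, (i <= l)%N -> d 0 i <= d 0 l) ->
  forall i : 'I_r, b0 * a0 * (d 0 i ^+ 2)
    <= (eigenvalues (C *m diag_mx d *m B *m diag_mx d *m C^T))`_i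
    <= b1 * a1 * (d 0 i ^+ 2).
Proof.
move=> Bs b00 b10 a00 a10 Bb Cb d0 dm i.
set D := diag_mx d; set M := C *m D *m B *m D *m C^T.
have Ds : D^T = D by rewrite tr_diag_mx.
have ME : M = (C *m D) *m B *m (C *m D)^T by rewrite /M trmx_mul Ds !mulmxA.
have Ms : M^T = M by rewrite ME !trmx_mul !trmxK Bs !mulmxA.
pose G := (C *m D) *m 1%:M *m (C *m D)^T.
have Gs : G^T = G by rewrite /G !trmx_mul !trmxK trmx1 !mulmxA.
pose G' := D *m (C^T *m C) *m D^T.
have G's : G'^T = G' by rewrite /G' !trmx_mul !trmxK !mulmxA.
have GG' : eigenvalues G = eigenvalues G'.
  by rewrite /G mulmx1 eigenvalues_mulC trmx_mul /G' !mulmxA Ds.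
have D2 : D *m 1%:M *m D^T = diag_mx (\row_(l < r) (d 0 l ^+ 2)).
  rewrite mulmx1 Ds /D mulmx_diag; congr diag_mx.
have eD : (eigenvalues (D *m 1%:M *m D^T))`_i = d 0 i ^+ 2.
  rewrite D2 eigenvalues_diag; first by rewrite mxE.
  move=> k l kl; rewrite !mxE.
  by rewrite ler_sqr ?nnegrE; [exact: dm|exact: d0|exact: d0].
have D2s : (D *m 1%:M *m D^T)^T = D *m 1%:M *m D^T.
  by rewrite D2 tr_diag_mx.
apply/andP; split; rewrite -mulrA.
  apply: (@le_trans _ _ (b0 * (eigenvalues G)`_i)).
    apply: (ler_wpM2l b00); rewrite GG' -eD; apply: (eigenvaluesZ_le _ a00 D2s G's).
    by move=> u; rewrite !qf_congr; have /andP[] := Cb (D^T *m u).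
  apply: (eigenvaluesZ_le _ b00 Gs Ms) => u.
  by rewrite ME !qf_congr; have /andP[] := Bb ((C *m D)^T *m u).
apply: (@le_trans _ _ (b1 * (eigenvalues G)`_i)).
  apply: (eigenvaluesZ_ge _ b10 Gs Ms) => u.
  by rewrite ME !qf_congr; have /andP[] := Bb ((C *m D)^T *m u).
apply: (ler_wpM2l b10); rewrite GG' -eD; apply: (eigenvaluesZ_ge _ a10 D2s G's).
by move=> u; rewrite !qf_congr; have /andP[] := Cb (D^T *m u).
Qed.

(** Both bounds on W are shifted multiples of S once the form of N is bounded
    by z; the factor 2 absorbs 1 + 1 / eta <= 2 / eta. *)
Lemma eigenvalues_noise_bounds p (W S N : 'M[R]_p) (eta z : R) (i : 'I_p) :
  W^T = W -> S^T = S -> 0 < eta <= 1 ->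
  (forall u, 0 <= qf N u <= z * qf 1%:M u) ->
  (forall u, (1 - eta) * qf S u + (1 - eta^-1) * qf N u <= qf W u
             <= (1 + eta) * qf S u + (1 + eta^-1) * qf N u) ->
  (1 - eta) * (eigenvalues S)`_i - z / eta <= (eigenvalues W)`_i
    <= (1 + eta) * (eigenvalues S)`_i + 2 * z / eta.
Proof.
move=> Ws Ss /andP[eta0 eta1] Nz SW; apply/andP; split.
  have := eigenvaluesZD (- (z / eta)) i Ss; move/(_ (1 - eta)) => <-.
    apply: eigenvalues_monotone => //.
      by rewrite linearD /= linearZ /= tr_scalar_mx Ss.
    move=> u; have /andP[+ _] := SW u; apply: le_trans.
    rewrite qfD qfZ qf_scalar lerD2l mulrBl mul1r.
    have /andP[N0 N1] := Nz u; rewrite mulNr ler_wpDl // lerN2.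
    rewrite (_ : z / eta * _ = eta^-1 * (z * qf 1%:M u)); last by ring.
    by rewrite ler_wpM2l // invr_ge0 ltW.
  by rewrite subr_ge0.
have := eigenvaluesZD (2 * z / eta) i Ss; move/(_ (1 + eta)) => <-.
  apply: eigenvalues_monotone => //.
    by rewrite linearD /= linearZ /= tr_scalar_mx Ss.
  move=> u; have /andP[_ ] := SW u; move/le_trans; apply.
  rewrite qfD qfZ qf_scalar lerD2l.
  have /andP[N0 N1] := Nz u.
  have e1 : 1 <= eta^-1 by rewrite invf_ge1.
  apply: (@le_trans _ _ (2 / eta * qf N u)).
    by rewrite ler_wpM2r // mulrDl mul1r lerD2r.
  rewrite (_ : 2 * z / eta * _ = 2 / eta * (z * qf 1%:M u)); last by ring.
  by rewrite ler_wpM2l // divr_ge0 // ltW.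
by rewrite addr_ge0 // ltW.
Qed.

End perturbation.

(** * The spectral norm *)

Section norms.
Context {R : realType}.

Lemma euclid_normE n (u : 'cV[R]_n) : euclid_norm u = Num.sqrt (qf 1%:M u).
Proof. by rewrite qf1. Qed.

Lemma sqr_euclid_norm n (u : 'cV[R]_n) : euclid_norm u ^+ 2 = qf 1%:M u.
Proof. by rewrite euclid_normE sqr_sqrtr // qf1_ge0. Qed.

Lemma euclid_norm_ge0 n (u : 'cV[R]_n) : 0 <= euclid_norm u.
Proof. exact: sqrtr_ge0. Qed.

Lemma le_euclid_norm n (u : 'cV[R]_n) x : 0 <= x -> qf 1%:M u <= x ^+ 2 ->
  euclid_norm u <= x.
Proof.
move=> x0 ux; rewrite euclid_normE -(ger0_norm x0) -sqrtr_sqr.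
exact: ler_wsqrtr.
Qed.

Lemma euclid_normZ n c (u : 'cV[R]_n) : euclid_norm (c *: u) = `|c| * euclid_norm u.
Proof.
rewrite !euclid_normE -sqrtr_sqr -sqrtrM ?sqr_ge0 // !qf1 mulr_sumr.
by congr Num.sqrt; apply: eq_bigr => i _; rewrite mxE exprMn.
Qed.

Lemma normr_qf_le n (M : 'M[R]_n) u :
  `|qf M u| <= (\sum_i \sum_l `|M i l|) * qf 1%:M u.
Proof.
have ui i : u i 0 ^+ 2 <= qf 1%:M u.
  by rewrite qf1 (bigD1 i) //= lerDl sumr_ge0 // => l _; rewrite sqr_ge0.
rewrite {1}/qf mxE; apply: le_trans (ler_norm_sum _ _ _) _.
rewrite exchange_big /= mulr_suml; apply: ler_sum => l _.
rewrite mxE normrM; apply: (@le_trans _ _ ((\sum_i `|u^T 0 i * M i l|) * `|u l 0|)).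
  by rewrite ler_wpM2r // ler_norm_sum.
rewrite !mulr_suml; apply: ler_sum => i _; rewrite mxE normrM.
rewrite [`|u i 0| * _]mulrC -mulrA ler_wpM2l //.
have : 0 <= (`|u i 0| - `|u l 0|) ^+ 2 by rewrite sqr_ge0.
rewrite sqrrB !real_normK ?num_real // => h; have := ui i; have := ui l.
move: h; rewrite -mulr_natr; lra.
Qed.

Lemma spectral_norm_bounded p n (M : 'M[R]_(p, n)) : exists2 K, 0 <= K &
  forall u, euclid_norm (M *m u) <= K * euclid_norm u.
Proof.
pose K2 := \sum_i \sum_l `|(M^T *m M) i l|.
have K20 : 0 <= K2 by apply: sumr_ge0 => i _; apply: sumr_ge0.
exists (Num.sqrt K2); first exact: sqrtr_ge0.
move=> u; apply: le_euclid_norm; first by rewrite mulr_ge0 ?sqrtr_ge0.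
rewrite exprMn sqr_sqrtr // sqr_euclid_norm.
apply: le_trans (normr_qf_le _ _); apply: le_trans (ler_norm _).
have -> : M^T *m M = M^T *m 1%:M *m M^T^T by rewrite mulmx1 trmxK.
by rewrite qf_congr trmxK.
Qed.

Lemma has_sup_spectral_norm p n (M : 'M[R]_(p, n)) :
  has_sup [set euclid_norm (M *m u) | u in [set u : 'cV[R]_n | euclid_norm u <= 1]].
Proof.
split; first by exists (euclid_norm (M *m 0)), 0 => //=; rewrite euclid_normE /qf mulmx0 mxE sqrtr0.
have [K K0 MK] := spectral_norm_bounded M; exists K => _ [u /= u1 <-].
by apply: le_trans (MK u) _; rewrite -[leRHS]mulr1 ler_wpM2l.
Qed.

Lemma spectral_normP p n (M : 'M[R]_(p, n)) u :
  euclid_norm (M *m u) <= spectral_norm M * euclid_norm u.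
Proof.
have [u0|u0] := eqVneq (euclid_norm u) 0.
  have [K K0 MK] := spectral_norm_bounded M.
  by rewrite u0 mulr0 (le_trans (MK u)) // u0 mulr0.
have up : 0 < euclid_norm u by rewrite lt_neqAle eq_sym u0 euclid_norm_ge0.
rewrite -ler_pdivrMr //; apply: ub_le_sup.
  by have [] := has_sup_spectral_norm M.
exists ((euclid_norm u)^-1 *: u) => /=.
  by rewrite euclid_normZ ger0_norm ?invr_ge0 ?euclid_norm_ge0 // mulVf.
by rewrite -scalemxAr euclid_normZ ger0_norm ?invr_ge0 ?euclid_norm_ge0 // mulrC.
Qed.

Lemma spectral_norm_le p n (M : 'M[R]_(p, n)) K : 0 <= K ->
  (forall u, euclid_norm (M *m u) <= K * euclid_norm u) -> spectral_norm M <= K.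
Proof.
move=> K0 MK; apply: ge_sup; first by have [] := has_sup_spectral_norm M.
move=> _ [u /= u1 <-]; apply: le_trans (MK u) _.
by rewrite -[leRHS]mulr1 ler_wpM2l.
Qed.

Lemma spectral_norm_ge0 p n (M : 'M[R]_(p, n)) : 0 <= spectral_norm M.
Proof.
apply: le_trans (ub_le_sup _ _); first exact: (euclid_norm_ge0 (M *m 0)).
  by have [] := has_sup_spectral_norm M.
by exists 0 => //=; rewrite euclid_normE /qf mulmx0 mxE sqrtr0.
Qed.

Lemma sum_mul_le n (u v : 'cV[R]_n) t : 0 < t ->
  2 * \sum_i u i 0 * v i 0 <= t * qf 1%:M u + t^-1 * qf 1%:M v.
Proof.
move=> t0; rewrite !qf1 !mulr_sumr -big_split /=; apply: ler_sum => i _.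
have : 0 <= t * (u i 0 - t^-1 * v i 0) ^+ 2 by rewrite mulr_ge0 ?sqr_ge0 ?ltW.
rewrite (_ : t * _ = t * u i 0 ^+ 2 + t^-1 * v i 0 ^+ 2 - 2 * (u i 0 * v i 0)).
  by rewrite subr_ge0.
by field; rewrite gt_eqF.
Qed.

Lemma sum_mul_le_norm n (u v : 'cV[R]_n) :
  \sum_i u i 0 * v i 0 <= euclid_norm u * euclid_norm v.
Proof.
have [v0|v0] := eqVneq (euclid_norm v) 0.
  rewrite v0 mulr0; suff -> : v = 0 by rewrite big1 // => i _; rewrite mxE mulr0.
  apply/eqP; apply: contra_eqT v0 => vn; rewrite gt_eqF //.
  by rewrite euclid_normE sqrtr_gt0 qf1_gt0.
have [u0|u0] := eqVneq (euclid_norm u) 0.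
  rewrite u0 mul0r; suff -> : u = 0 by rewrite big1 // => i _; rewrite mxE mul0r.
  apply/eqP; apply: contra_eqT u0 => un; rewrite gt_eqF //.
  by rewrite euclid_normE sqrtr_gt0 qf1_gt0.
have up : 0 < euclid_norm u by rewrite lt_neqAle eq_sym u0 euclid_norm_ge0.
have vp : 0 < euclid_norm v by rewrite lt_neqAle eq_sym v0 euclid_norm_ge0.
rewrite -(ler_pM2l (_ : 0 < 2 :> R)) //.
apply: le_trans (sum_mul_le _ _ (divr_gt0 vp up)) _.
rewrite -!sqr_euclid_norm le_eqVlt; apply/orP; left; apply/eqP.
by field; rewrite u0 v0.
Qed.

Lemma qf_le_spectral_norm n (M : 'M[R]_n) u :
  qf M u <= spectral_norm M * qf 1%:M u.
Proof.
have -> : qf M u = \sum_i u i 0 * (M *m u) i 0.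
  by rewrite /qf -mulmxA mxE; apply: eq_bigr => i _; rewrite mxE.
apply: le_trans (sum_mul_le_norm _ _) _; rewrite -sqr_euclid_norm expr2 mulrA.
by rewrite mulrC ler_wpM2r ?euclid_norm_ge0 // spectral_normP.
Qed.

Lemma euclid_normD n (u v : 'cV[R]_n) :
  euclid_norm (u + v) <= euclid_norm u + euclid_norm v.
Proof.
apply: le_euclid_norm; first by rewrite addr_ge0 ?euclid_norm_ge0.
rewrite sqrrD !sqr_euclid_norm !qf1.
have := sum_mul_le_norm u v; set c := euclid_norm u * _ => uv.
rewrite (_ : \sum_i (u + v) i 0 ^+ 2 = \sum_i u i 0 ^+ 2 +
   (\sum_i u i 0 * v i 0) *+ 2 + \sum_i v i 0 ^+ 2); last first.
  rewrite -sumrMnl -!big_split /=; apply: eq_bigr => i _.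
  by rewrite mxE sqrrD.
by rewrite !lerD2r lerD2l lerMn2r.
Qed.

Lemma spectral_normD p n (M N : 'M[R]_(p, n)) :
  spectral_norm (M + N) <= spectral_norm M + spectral_norm N.
Proof.
apply: spectral_norm_le; first by rewrite addr_ge0 ?spectral_norm_ge0.
move=> u; rewrite mulmxDl mulrDl; apply: le_trans (euclid_normD _ _) _.
by rewrite lerD // spectral_normP.
Qed.

Lemma entry_le_spectral_norm p n (M : 'M[R]_(p, n)) i l :
  `|M i l| <= spectral_norm M.
Proof.
have := spectral_normP M (delta_mx l 0).
have -> : euclid_norm (delta_mx l 0 : 'cV[R]_n) = 1.
  rewrite euclid_normE qf1 (bigD1 l) //= big1 ?addr0.
    by rewrite mxE !eqxx expr1n sqrtr1.
  by move=> k kl; rewrite mxE (negbTE kl) expr0n.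
rewrite mulr1; apply: le_trans; rewrite -colE euclid_normE -sqrtr_sqr.
apply: ler_wsqrtr; rewrite qf1 (bigD1 i) //= mxE lerDl.
by apply: sumr_ge0 => k _; rewrite sqr_ge0.
Qed.

Lemma spectral_norm_le_entries p n (M : 'M[R]_(p, n)) :
  spectral_norm M <= \sum_i \sum_l `|M i l|.
Proof.
have S0 : 0 <= \sum_i \sum_l `|M i l| by apply: sumr_ge0 => i _; apply: sumr_ge0.
apply: spectral_norm_le => // u.
have ui l : `|u l 0| <= euclid_norm u.
  rewrite euclid_normE -sqrtr_sqr; apply: ler_wsqrtr.
  by rewrite qf1 (bigD1 l) //= lerDl sumr_ge0 // => k _; rewrite sqr_ge0.
apply: (@le_trans _ _ (\sum_i `|(M *m u) i 0|)).
  apply: le_euclid_norm; first exact: sumr_ge0.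
  rewrite qf1 expr2 mulr_suml; apply: ler_sum => i _.
  rewrite -real_normK ?num_real // expr2 ler_wpM2l // (bigD1 i) //= lerDl.
  exact: sumr_ge0.
rewrite mulr_suml; apply: ler_sum => i _; rewrite mxE mulr_suml.
apply: le_trans (ler_norm_sum _ _ _) _; apply: ler_sum => l _.
by rewrite normrM ler_wpM2l.
Qed.

End norms.

(** * The characteristic polynomial of a graded matrix as a block determinant *)

Section pencil.
Context {R : realType}.

(** The Schur complement of B is D G D - y g^2 B^-1 up to the normalization by e,
    with D = diag d and G = C^T C; times det B, its determinant is up to sign the
    characteristic polynomial of C D B D C^T at y g^2.  The point of the block
    form is that its entries are affine in B and that, for a suitable e, they
    are bounded whatever the orders of magnitude in d. *)
Lemma block_det_char_poly r (C B : 'M[R]_r) (d e : 'rV[R]_r) (g y : R) :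
  B \in unitmx -> (forall i, e 0 i != 0) ->
  let S := diag_mx (\row_i (g / e 0 i)) in
  let K := diag_mx (\row_i (d 0 i / e 0 i)) in
  \det (block_mx B S (y *: S) (K *m (C^T *m C) *m K)) * \prod_i (e 0 i ^+ 2) =
  (-1) ^+ r * \det ((y * g ^+ 2)%:M - C *m diag_mx d *m B *m diag_mx d *m C^T).
Proof.
move=> Bu e0 S K; set G := C^T *m C; set D := diag_mx d; set E := diag_mx e.
have KE : K *m E = D.
  rewrite mulmx_diag; congr diag_mx; apply/rowP => i.
  by rewrite !mxE divfK.
have EK : E *m K = D by rewrite /E /K diag_mxC KE.
have SE : S *m E = g%:M.
  rewrite mulmx_diag -diag_const_mx; congr diag_mx; apply/rowP => i.
  by rewrite !mxE divfK.
have ES : E *m S = g%:M by rewrite /E /S diag_mxC SE.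
have schur : \det (block_mx B S (y *: S) (K *m G *m K)) =
    \det B * \det (K *m G *m K - y *: (S *m invmx B *m S)).
  have L1 : \det (block_mx 1%:M 0 (- (y *: (S *m invmx B))) 1%:M : 'M[R]_(r + r)) = 1.
    by rewrite det_lblock !det1 mulr1.
  rewrite -[LHS]mul1r -L1 -det_mulmx mulmx_block !mul1mx !mul0mx !addr0.
  rewrite !mulNmx -!scalemxAl -[S *m invmx B *m B]mulmxA mulVmx // mulmx1 addNr.
  by rewrite det_ublock [- _ + _]addrC.
have detE : \prod_i (e 0 i ^+ 2) = \det E * \det E.
  rewrite det_diag -big_split /=; apply: eq_bigr => i _.
  by rewrite expr2.
rewrite schur detE -mulrA [X in _ * X]mulrA [X in _ * (X * _)]mulrC.
rewrite -!det_mulmx mulmxBr mulmxBl.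
have -> : E *m (K *m G *m K) *m E = D *m G *m D.
  by rewrite !mulmxA EK -!mulmxA KE.
have -> : E *m (y *: (S *m invmx B *m S)) *m E = (y * g ^+ 2) *: invmx B.
  rewrite -scalemxAr -scalemxAl !mulmxA ES -!mulmxA SE mul_scalar_mx.
  by rewrite mul_mx_scalar !scalerA expr2 mulrA.
rewrite det_mulmx mulrC -det_mulmx mulmxBl -scalemxAl mulVmx // scalemx1.
set x := y * g ^+ 2.
have -> : D *m G *m D *m B - x%:M = - (x%:M - (D *m C^T) *m (C *m D *m B)).
  by rewrite opprB /G !mulmxA.
rewrite -scaleN1r detZ -!horner_char_poly char_poly_mulC.
by rewrite !mulmxA.
Qed.

Lemma block_det_eigenvalues r (C B : 'M[R]_r) (d e : 'rV[R]_r) (g y : R) :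
  B \in unitmx -> B^T = B -> (forall i, e 0 i != 0) ->
  let S := diag_mx (\row_i (g / e 0 i)) in
  let K := diag_mx (\row_i (d 0 i / e 0 i)) in
  let M := C *m diag_mx d *m B *m diag_mx d *m C^T in
  \det (block_mx B S (y *: S) (K *m (C^T *m C) *m K)) =
  (-1) ^+ r * \prod_(i < r) ((y * g ^+ 2 - (eigenvalues M)`_i) / e 0 i ^+ 2).
Proof.
move=> Bu Bs e0 S K M.
have Ms : M^T = M by rewrite /M !trmx_mul !trmxK !tr_diag_mx Bs !mulmxA.
have e20 : \prod_i (e 0 i ^+ 2) != 0.
  by apply/prodf_neq0 => i _; rewrite expf_neq0.
apply: (mulIf e20); rewrite block_det_char_poly // -mulrA.
rewrite -horner_char_poly -/M (char_poly_eigenvalues Ms) horner_prod.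
rewrite -big_split /=; congr (_ * _); apply: eq_bigr => i _.
by rewrite divfK ?expf_neq0 // !hornerE.
Qed.

End pencil.

(** * Divided differences and continuity *)

Section divided_differences.
Context {R : realType} (n : nat).

(** An exact form of the first order expansion: there is no remainder term, and
    the coefficients converge when both points tend to a common limit. *)
Definition divided_difference (f : 'M[R]_n -> R) (c : 'I_n -> 'I_n -> 'M[R]_n * 'M[R]_n -> R) :=
  [/\ continuous f,
      forall M N, f M - f N = \sum_i \sum_l c i l (M, N) * (M i l - N i l) &
      forall i l, continuous (c i l)].

Lemma divided_difference_cst k : exists c, divided_difference (fun=> k) c.
Proof.
exists (fun _ _ _ => 0); split=> [|M N|i l]; try exact: cst_continuous.
by rewrite subrr big1 // => i _; rewrite big1 // => l _; rewrite mul0r.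
Qed.

Lemma divided_difference_entry i l : exists c, divided_difference (fun M => M i l) c.
Proof.
exists (fun i' l' _ => ((i' == i) && (l' == l))%:R); split.
- exact: coord_continuous.
- move=> M N; rewrite (bigD1 i) //= (bigD1 l) //= !eqxx mul1r.
  rewrite big1 ?addr0; last by move=> k kl; rewrite (negbTE kl) mul0r.
  rewrite big1 ?addr0 // => k ki; rewrite big1 // => k' _.
  by rewrite (negbTE ki) mul0r.
- by move=> i' l'; exact: cst_continuous.
Qed.

Lemma divided_differenceD f g :
  (exists c, divided_difference f c) -> (exists c, divided_difference g c) ->
  exists c, divided_difference (fun M => f M + g M) c.
Proof.
move=> [c [fc fe cc]] [c' [gc ge cc']].
exists (fun i l MN => c i l MN + c' i l MN); split.
- by move=> M; exact: (cvgD (fc M) (gc M)).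
- move=> M N; rewrite opprD addrACA fe ge -big_split; apply: eq_bigr => i _.
  by rewrite -big_split; apply: eq_bigr => l _; rewrite mulrDl.
- by move=> i l MN; exact: (cvgD (cc i l MN) (cc' i l MN)).
Qed.

Lemma divided_differenceM f g :
  (exists c, divided_difference f c) -> (exists c, divided_difference g c) ->
  exists c, divided_difference (fun M => f M * g M) c.
Proof.
move=> [c [fc fe cc]] [c' [gc ge cc']].
exists (fun i l MN => f MN.1 * c' i l MN + g MN.2 * c i l MN); split.
- by move=> M; exact: (cvgM (fc M) (gc M)).
- move=> M N; rewrite (_ : _ - _ = f M * (g M - g N) + g N * (f M - f N)); last by ring.
  rewrite fe ge !mulr_sumr -big_split; apply: eq_bigr => i _.
  rewrite !mulr_sumr -big_split; apply: eq_bigr => l _ /=.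
  by rewrite mulrDl !mulrA.
- move=> i l MN.
  have f1 : f x.1 @[x --> MN] --> f MN.1 by apply: (cvg_comp _ _ cvg_fst); exact: (fc MN.1).
  have g2 : g x.2 @[x --> MN] --> g MN.2 by apply: (cvg_comp _ _ cvg_snd); exact: (gc MN.2).
  exact: (cvgD (cvgM f1 (cc' i l MN)) (cvgM g2 (cc i l MN))).
Qed.

(** The functions that have a divided difference form a ring, by the Leibniz
    rule, and the determinant is a polynomial in the entries. *)
Lemma divided_difference_det : exists c, divided_difference determinant c.
Proof.
rewrite /determinant.
have -> : (fun A : 'M[R]_n => \sum_(s : 'S_n) (-1) ^+ s * \prod_i A i (s i)) =
    \sum_(s : 'S_n) (fun A : 'M[R]_n => (-1) ^+ s * \prod_i A i (s i)).
  by apply/funext => A; rewrite fct_sumE.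
apply: (big_ind (fun f => exists c, divided_difference f c)).
- exact: divided_difference_cst.
- by move=> f g; exact: divided_differenceD.
move=> s _; apply: divided_differenceM; first exact: divided_difference_cst.
elim: (index_enum _) => [|i t IH].
  rewrite (_ : (fun _ => _) = fun=> 1); last by apply/funext => M; rewrite big_nil.
  exact: divided_difference_cst.
rewrite (_ : (fun _ => _) = fun M : 'M[R]_n => M i (s i) * \prod_(k <- t) M k (s k)).
  by apply: divided_differenceM IH; exact: divided_difference_entry.
by apply/funext => M; rewrite big_cons.
Qed.

End divided_differences.

Section continuity.
Context {R : realType}.

(** Matrices carry the topology of entrywise convergence. *)
Lemma cvg_mx_entries T (F : set_system T) {FF : Filter F} m n
    (M : T -> 'M[R]_(m, n)) (A : 'M[R]_(m, n)) :
  (forall i l, M x i l @[x --> F] --> A i l) -> M x @[x --> F] --> A.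
Proof.
move=> MA U [P UP PU]; rewrite /nbhs /=.
have : \forall x \near F, forall i l, P i l (M x i l).
  by apply: filter_forall => i; apply: filter_forall => l; apply: MA; exact: UP.
by apply: filterS => x Px; exact: PU.
Qed.

Lemma cvg_sum_seq T (F : set_system T) {FF : Filter F} I (s : seq I)
    (f : I -> T -> R) (c : I -> R) : (forall i, f i x @[x --> F] --> c i) ->
  \sum_(i <- s) f i x @[x --> F] --> \sum_(i <- s) c i.
Proof.
move=> fc; elim: s => [|i s IH].
  by rewrite big_nil; under eq_fun do rewrite big_nil; exact: cvg_cst.
rewrite big_cons; under eq_fun do rewrite big_cons.
exact: (cvgD (fc i) IH).
Qed.

Lemma cvg_prod_seq T (F : set_system T) {FF : Filter F} I (s : seq I)
    (f : I -> T -> R) (c : I -> R) : (forall i, f i x @[x --> F] --> c i) ->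
  \prod_(i <- s) f i x @[x --> F] --> \prod_(i <- s) c i.
Proof.
move=> fc; elim: s => [|i s IH].
  by rewrite big_nil; under eq_fun do rewrite big_nil; exact: cvg_cst.
rewrite big_cons; under eq_fun do rewrite big_cons.
exact: (cvgM (fc i) IH).
Qed.

Lemma lipschitz_entries_continuous m n (f : 'M[R]_(m, n) -> R) :
  (forall M N, f M <= f N + \sum_i \sum_l `|M i l - N i l|) -> continuous f.
Proof.
move=> fL M; have L N : `|f M - f N| <= \sum_i \sum_l `|M i l - N i l|.
  rewrite ler_distl fL andbT lerBlDr.
  apply: le_trans (fL N M) _; rewrite lerD2l; apply: ler_sum => i _.
  by apply: ler_sum => l _; rewrite distrC.
have S0 : (fun N : 'M[R]_(m, n) => \sum_i \sum_l `|M i l - N i l|) @ M --> (0 : R).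
  rewrite [X in _ --> X](_ : 0 = \sum_(i < m) \sum_(l < n) `|M i l - M i l|).
    apply: (@cvg_sum_seq _ (nbhs M)) => i; apply: (@cvg_sum_seq _ (nbhs M)) => l.
    apply: cvg_norm; apply: (@cvgB _ _ _ _ _ (fun=> M i l) (fun N : 'M[R]_(m, n) => N i l)).
      exact: cvg_cst.
    exact: coord_continuous.
  by rewrite big1 // => i _; rewrite big1 // => l _; rewrite subrr normr0.
apply/(@cvgrPdist_le _ _ _ (nbhs M)) => e e0.
have /(@cvgrPdist_le _ _ _ (nbhs M)) /(_ e e0) := S0.
apply: filterS => N; rewrite sub0r normrN => Ne.
exact: le_trans (L N) (le_trans (ler_norm _) Ne).
Qed.

Lemma spectral_norm_continuous m n : continuous (@spectral_norm R m n).
Proof.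
apply: lipschitz_entries_continuous => M N.
rewrite -{1}(subrK N M) addrC; apply: le_trans (spectral_normD _ _) _.
rewrite lerD2l; apply: le_trans (spectral_norm_le_entries _) _.
by apply: ler_sum => i _; apply: ler_sum => l _; rewrite !mxE.
Qed.

(** Taking the symmetric part extends the ordered eigenvalues to continuous
    functions on all matrices, as needed to see that they are measurable; they
    are Lipschitz by Weyl's inequality. *)
Lemma eigenvalue_sym_part_continuous n (i : 'I_n) :
  continuous (fun M : 'M[R]_n => (eigenvalues (2^-1 *: (M + M^T)))`_i).
Proof.
apply: lipschitz_entries_continuous => M N.
have syms (A : 'M[R]_n) : (2^-1 *: (A + A^T))^T = 2^-1 *: (A + A^T).
  by rewrite linearZ /= linearD /= trmxK addrC.
have qfs (A : 'M[R]_n) u : qf (2^-1 *: (A + A^T)) u = qf A u.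
  by rewrite qfZ qfD qf_tr; field.
rewrite -[X in _ <= X + _]mul1r.
have <- := eigenvaluesZD (\sum_i \sum_l `|M i l - N i l|) i (syms N) ler01.
apply: eigenvalues_monotone => //.
  by rewrite linearD /= scale1r syms tr_scalar_mx.
move=> u; rewrite qfD qf_scalar scale1r !qfs -lerBlDl -qfN -qfD.
apply: le_trans (ler_norm _) _; apply: le_trans (normr_qf_le _ _) _.
rewrite ler_wpM2r ?qf1_ge0 //.
by apply: ler_sum => k _; apply: ler_sum => l _; rewrite !mxE.
Qed.

(** The continuous extension of ln (1 + t) / t, by which differences of
    logarithms become products. *)
Definition ln1p_quot (t : R) : R := if t == 0 then 1 else ln (1 + t) / t.

Lemma ln1p_quotE t : ln (1 + t) = t * ln1p_quot t.
Proof.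
rewrite /ln1p_quot; case: eqVneq => [->|t0]; first by rewrite addr0 ln1 mul0r.
by rewrite mulrC divfK.
Qed.

Lemma ln1p_quot_cvg : ln1p_quot t @[t --> (0 : R)] --> (1 : R).
Proof.
have [d1 e1] := is_derive1_ln (@ltr01 R).
have : t^-1 *: (ln (t *: 1 + 1) - ln 1) @[t --> (0 : R)^'] --> (1 : R).
  by rewrite -[X in _ --> X]invr1 -e1; exact: d1.
move=> /cvgrPdist_lt L; apply/cvgrPdist_lt => e e0.
have := L e e0; rewrite !near_withinE; apply: filterS => t Lt.
rewrite /ln1p_quot; case: eqVneq => [_|t0]; first by rewrite subrr normr0.
have := Lt t0; rewrite ln1 subr0 /GRing.scale /= mulr1 [t + 1]addrC.
by rewrite mulrC.
Qed.

End continuity.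

(** * Convergence with high probability *)

Section with_high_probability.
Context {R : realType} {d} {T : measurableType d} (P : probability T R).

Lemma measurable_le_set (f : T -> R) c : measurable_fun setT f ->
  measurable [set w | f w <= c].
Proof.
move=> mf; rewrite (_ : mkset _ = setT `&` f @^-1` `]-oo, c]%classic).
  exact: mf.
by rewrite setTI; apply/seteqP; split => w /=; rewrite in_itv.
Qed.

Lemma measurable_lt_set (f : T -> R) c : measurable_fun setT f ->
  measurable [set w | f w < c].
Proof.
move=> mf; rewrite (_ : mkset _ = setT `&` f @^-1` `]-oo, c[%classic).
  exact: mf.
by rewrite setTI; apply/seteqP; split => w /=; rewrite in_itv.
Qed.

Lemma measurable_norm_comp (f : T -> R) : measurable_fun setT f ->
  measurable_fun setT (fun w => `|f w|).
Proof. by move=> mf; apply: measurableT_comp. Qed.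

(** The events, indexed by n, whose probability tends to one.  They form a
    filter, and convergence in probability is convergence along this filter:
    the ordinary calculus of limits then applies to random sequences.  The
    measurable minorants E spare measurability conditions on the events that
    arise from that calculus. *)
Definition whp : set_system (nat * T) := [set S |
  forall eps : R, 0 < eps -> exists2 E : nat -> set T,
    forall n, measurable (E n) &
    \forall n \near \oo, E n `<=` [set w | S (n, w)] /\ (P (~` E n) <= eps%:E)%E].

Lemma whp_filter : Filter whp.
Proof.
split.
- move=> eps e0; exists (fun=> setT) => //.
  by near=> n; split => //; rewrite setCT measure0 lee_fin ltW.
- move=> S S' wS wS' eps e0.
  have e2 : 0 < eps / 2 by rewrite divr_gt0.
  have [E mE hE] := wS _ e2; have [E' mE' hE'] := wS' _ e2.
  exists (fun n => E n `&` E' n); first by move=> n; exact: measurableI.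
  near=> n.
  have [ES EP] : E n `<=` [set w | S (n, w)] /\ (P (~` E n) <= (eps / 2)%:E)%E by near: n.
  have [ES' EP'] : E' n `<=` [set w | S' (n, w)] /\ (P (~` E' n) <= (eps / 2)%:E)%E by near: n.
  split; first by move=> w [/ES ? /ES' ?].
  rewrite setCI; apply: le_trans (measureU2 _ _ _) _; try exact: measurableC.
  by rewrite [eps in leRHS]splitr EFinD leeD.
- move=> S S' SS' wS eps e0; have [E mE hE] := wS _ e0; exists E => //.
  near=> n.
  have [ES EP] : E n `<=` [set w | S (n, w)] /\ (P (~` E n) <= eps%:E)%E by near: n.
  by split => // w /ES; exact: SS'.
Unshelve. all: by end_near. Qed.

#[local] Existing Instance whp_filter.

Lemma whp_proper : ProperFilter whp.
Proof.
apply: Build_ProperFilter => /(_ (1 / 2)) [|E mE hE]; first by rewrite divr_gt0.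
near \oo => n.
have [ES EP] : E n `<=` set0 /\ (P (~` E n) <= (1 / 2)%:E)%E by near: n.
move: EP; rewrite (_ : E n = set0); last by apply/seteqP; split.
by rewrite setC0 probability_setT lee_fin; lra.
Unshelve. all: by end_near. Qed.

Lemma cvg_whp_fst : x.1 @[x --> whp] --> \oo.
Proof.
move=> S [N _ NS] eps e0.
exists (fun n => if (N <= n)%N then setT else set0); first by move=> n; case: ifP.
near=> n; have Nn : (N <= n)%N by near: n; exact: nbhs_infty_ge.
rewrite Nn; split; first by move=> w _; exact: NS.
by rewrite setCT measure0 lee_fin ltW.
Unshelve. all: by end_near. Qed.

Lemma cvg_det_whp (u : nat -> R) (l : R) : u n @[n --> \oo] --> l ->
  u x.1 @[x --> whp] --> l.
Proof. by move=> ul; exact: (cvg_comp _ _ cvg_whp_fst ul). Qed.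

Lemma near_whp_fst (S : nat -> Prop) : (\forall n \near \oo, S n) ->
  \forall x \near whp, S x.1.
Proof. exact: cvg_whp_fst. Qed.

Lemma ae_whp (S : nat -> T -> Prop) : (forall n, {ae P, forall w, S n w}) ->
  \forall x \near whp, S x.1 x.2.
Proof.
move=> aS eps e0.
have /choice[A hA] n : exists A, [/\ measurable A, P A = 0 & ~` [set w | S n w] `<=` A].
  by have [A [mA PA SA]] := aS n; exists A.
exists (fun n => ~` A n); first by move=> n; have [? _ _] := hA n; exact: measurableC.
near=> n; have [mA PA SA] := hA n; split.
  by move=> w /= nA; apply: contrapT => nS; apply: nA; exact: SA.
by rewrite setCK PA lee_fin ltW.
Unshelve. all: by end_near. Qed.

Lemma cvg_in_prob_whp (f : nat -> T -> R) (l : R) :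
  (forall n, measurable_fun setT (f n)) -> cvg_in_prob P f l ->
  f x.1 x.2 @[x --> whp] --> l.
Proof.
move=> mf fl; apply/cvgrPdist_lt => e e0 eps eps0.
exists (fun n => [set w | `|f n w - l| < e]).
  move=> n; apply: measurable_lt_set; apply: measurable_norm_comp.
  exact: measurable_funB.
have /fine_cvgP[fin fc] := fl e e0.
move/cvgrPdist_le : fc => /(_ eps eps0) fc.
near=> n; split; first by move=> w /=; rewrite distrC.
have -> : ~` [set w | `|f n w - l| < e] = [set w | e <= `|f n w - l|].
  by apply/seteqP; split => w /=; rewrite leNgt => /negP.
rewrite -[X in (X <= _)%E]fineK; last by near: n.
have : `|0 - fine (P [set w | e <= `|f n w - l|])| <= eps by near: n.
by rewrite sub0r normrN lee_fin; exact/le_trans/ler_norm.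
Unshelve. all: by end_near. Qed.

Lemma bounded_in_prob_mul_cvg0 (f : nat -> T -> R) (g : nat * T -> R) :
  (forall n, measurable_fun setT (f n)) -> bounded_in_prob P f ->
  g x @[x --> whp] --> 0 -> f x.1 x.2 * g x @[x --> whp] --> 0.
Proof.
move=> mf fb g0; apply/cvgrPdist_lt => e e0 eps eps0.
have e2 : 0 < eps / 2 by rewrite divr_gt0.
have [C fC] := fb _ e2.
have C1 : 0 < `|C| + 1 by rewrite ltr_wpDl.
move/cvgrPdist_lt : g0 => /(_ _ (divr_gt0 e0 C1)) /(_ _ e2)[E mE hE].
exists (fun n => [set w | `|f n w| <= C] `&` E n).
  by move=> n; apply: measurableI => //; apply/measurable_le_set/measurable_norm_comp.
near=> n.
have [ES EP] : E n `<=` [set w | `|0 - g (n, w)| < e / (`|C| + 1)] /\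
   (P (~` E n) <= (eps / 2)%:E)%E by near: n.
split.
  move=> w /= [fw /ES /=]; rewrite !sub0r !normrN normrM => gw.
  apply: (@le_lt_trans _ _ (`|C| * `|g (n, w)|)).
    by rewrite ler_wpM2r // (le_trans fw) // ler_norm.
  apply: (@le_lt_trans _ _ (`|C| * (e / (`|C| + 1)))).
    by rewrite ler_wpM2l // ltW.
  rewrite mulrA ltr_pdivrMr // mulrC ltr_pM2l //; lra.
rewrite setCI; apply: le_trans (measureU2 _ _ _) _.
- by apply/measurableC/measurable_le_set/measurable_norm_comp.
- exact: measurableC.
rewrite [eps in leRHS]splitr EFinD leeD //.
have -> : ~` [set w | `|f n w| <= C] = [set w | C < `|f n w|].
  by apply/seteqP; split => w /=; rewrite ltNge => /negP.
by near: n.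
Unshelve. all: by end_near. Qed.

End with_high_probability.

#[local] Existing Instance whp_filter.
#[local] Existing Instance whp_proper.

(** * Measurability of continuous functions of random matrices *)

Section measurability.
Context {R : realType} {d} {T : measurableType d}.

Lemma measurable_countable_comp (C : countType) (Z : T -> C) d'
    (U : measurableType d') (g : C -> U) :
  (forall z, measurable [set w | Z w = z]) -> measurable_fun setT (g \o Z).
Proof.
move=> mZ _ A mA; rewrite setTI.
rewrite (_ : _ @^-1` _ = \bigcup_(z : C) [set w | Z w = z /\ A (g z)]).
  apply: countable_bigcupT_measurable => // z.
  have [Az|nAz] := pselect (A (g z)).
    rewrite (_ : mkset _ = [set w | Z w = z]); first exact: mZ.
    by apply/seteqP; split => w //= [].
  rewrite (_ : mkset _ = set0) //.
  by apply/seteqP; split => w //= [].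
apply/seteqP; split => [w /= Aw|w [z _ [<-]] //].
by exists (Z w).
Qed.

(** Rounding the entries to multiples of 1 / k.+1 makes X take countably many
    values, so that any function of it is measurable; f (X) is the limit of
    these functions. *)
Lemma measurable_continuous_mx m n (f : 'M[R]_(m, n) -> R) (X : T -> 'M[R]_(m, n)) :
  continuous f -> measurable_mx X -> measurable_fun setT (f \o X).
Proof.
move=> fc mX.
pose Z k w : 'M[int]_(m, n) := map_mx (fun x : R => Num.floor (k.+1%:R * x)) (X w).
pose g k (z : 'M[int]_(m, n)) : R := f (map_mx (fun a : int => a%:~R / k.+1%:R) z).
apply: (measurable_fun_cvg (h := fun k => g k \o Z k)).
  move=> k; apply: measurable_countable_comp => // z.
  rewrite (_ : mkset _ = \bigcap_(il in [set: 'I_m * 'I_n])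
      [set w | Num.floor (k.+1%:R * X w il.1 il.2) = z il.1 il.2]).
    apply: fin_bigcap_measurable => //  -[i l] _ /=.
    rewrite (_ : mkset _ = setT `&` (fun w => k.+1%:R * X w i l) @^-1`
        `[(z i l)%:~R, (z i l + 1)%:~R[%classic).
      by apply: measurable_funM => //; exact: mX.
    rewrite setTI; apply/seteqP; split => w /=; rewrite in_itv /=.
      by move=> <-; exact: floor_itv.
    by move=> h; apply: floor_def.
  apply/seteqP; split => w /=.
    by move=> <- [i l] _ /=; rewrite mxE.
  by move=> h; apply/matrixP => i l; rewrite mxE; exact: (h (i, l)).
move=> w _; rewrite /g /=.
suff : map_mx (fun a : int => a%:~R / k.+1%:R : R) (Z k w) @[k --> \oo] --> X w.
  by move=> ZX; exact: (cvg_comp _ _ ZX (fc (X w))).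
apply: cvg_mx_entries => i l.
apply/cvgrPdist_le => e e0; near=> k.
rewrite !mxE; have /andP[lo hi] := floor_itv (k.+1%:R * X w i l).
have k0 : 0 < k.+1%:R :> R by [].
have ke : k.+1%:R^-1 <= e.
  by apply: ltW; near: k; exact: (near_infty_natSinv_lt (PosNum e0)).
apply: le_trans ke; rewrite ger0_norm; last first.
  by rewrite subr_ge0 ler_pdivrMr // [X in _ <= X]mulrC.
rewrite lerBlDr -[X in _ <= X + _]mul1r -mulrDl ler_pdivlMr // mulrC.
by move: hi; rewrite intrD addrC => /ltW.
Unshelve. all: by end_near. Qed.

End measurability.

(** * Weak convergence and Slutsky's theorem *)

Section bounded_expectations.
Context {R : realType} {d} {T : measurableType d} (P : probability T R).

Lemma bounded_integrable (f : T -> R) C : measurable_fun setT f ->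
  (forall w, `|f w| <= C) -> P.-integrable setT (EFin \o f).
Proof.
move=> mf fC; apply: measurable_bounded_integrable => //.
  by rewrite [X in (X < _)%E]probability_setT ltry.
exists C; split; first exact: num_real.
by move=> x Cx w _; apply: le_trans (fC w) (ltW Cx).
Qed.

Lemma bounded_expectation_fin_num (f : T -> R) C : measurable_fun setT f ->
  (forall w, `|f w| <= C) -> 'E_P[f]%E \is a fin_num.
Proof.
move=> mf fC; rewrite unlock; apply: integrable_fin_num => //.
exact: bounded_integrable mf fC.
Qed.

(** On A the integrand is at most e, and on its complement at most 2 C. *)
Lemma expectation_distance_le (f g : T -> R) (A : set T) C e : 0 <= C -> 0 <= e ->
  measurable_fun setT f -> measurable_fun setT g -> measurable A ->
  (forall w, `|f w| <= C) -> (forall w, `|g w| <= C) ->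
  (forall w, A w -> `|f w - g w| <= e) ->
  `|fine 'E_P[f]%E - fine 'E_P[g]%E| <= e + 2 * C * fine (P (~` A)).
Proof.
move=> C0 e0 mf mg mA fC gC fg.
have If := bounded_integrable mf fC; have Ig := bounded_integrable mg gC.
have mfg : measurable_fun setT (fun w => f w - g w) by exact: measurable_funB.
have h w : `|f w - g w| <= 2 * C.
  by rewrite (le_trans (ler_normB _ _)) // mulrDl !mul1r lerD.
have mAc : measurable (~` A) by exact: measurableC.
have PAfin : P (~` A) \is a fin_num by exact: fin_num_measure.
rewrite -fineB ?(bounded_expectation_fin_num mf fC) ?(bounded_expectation_fin_num mg gC) //.
rewrite -lee_fin -[X in (_ <= X)%E]/(_ + _)%:E EFinD EFinM fineK //.
rewrite -(abse_EFin (fine _)) fineK; last first.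
  rewrite fin_numB (bounded_expectation_fin_num mf fC).
  exact: (bounded_expectation_fin_num mg gC).
rewrite unlock -integralB //; apply: le_trans (le_abse_integral _ _ _) _ => //.
  by apply/measurable_EFinP.
apply: (@le_trans _ _ (\int[P]_w (e%:E + (2 * C)%:E * (\1_(~` A) w)%:E))%E).
  apply: ge0_le_integral => //.
  - by apply/measurable_EFinP; exact: (measurable_norm_comp mfg).
  - apply: emeasurable_funD => //; apply: emeasurable_funM => //.
    by apply/measurable_EFinP; exact: measurable_indic.
  move=> w _; rewrite -EFinM -EFinD lee_fin indicE.
  have [Aw|nAw] := pselect (A w).
    by rewrite memNset ?mulr0 ?addr0 ?fg //= => /(_ Aw).
  by rewrite mem_set // mulr1 (le_trans (h w)) // lerDr.
rewrite ge0_integralD //; last 2 first.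
- by move=> w _; rewrite -EFinM lee_fin mulr_ge0 // mulr_ge0.
- by apply: emeasurable_funM => //; apply/measurable_EFinP; exact: measurable_indic.
rewrite integral_cst // [X in (_ * X + _)%E]probability_setT mule1 leeD2l //.
rewrite ge0_integralZl //.
- by rewrite integral_indic // setIT.
- by apply/measurable_EFinP; exact: measurable_indic.
- by rewrite lee_fin mulr_ge0.
Qed.

Lemma cvg_expectation_whp (f g : nat -> T -> R) C l : 0 <= C ->
  (forall n, measurable_fun setT (f n)) -> (forall n, measurable_fun setT (g n)) ->
  (forall n w, `|f n w| <= C) -> (forall n w, `|g n w| <= C) ->
  f x.1 x.2 - g x.1 x.2 @[x --> whp P] --> 0 ->
  ('E_P[g n] @[n --> \oo] --> l%:E -> 'E_P[f n] @[n --> \oo] --> l%:E)%E.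
Proof.
move=> C0 mf mg fC gC fg gl; apply/fine_cvgP; split.
  by near=> n; exact: bounded_expectation_fin_num (mf n) (fC n).
have /fine_cvgP[_ {}gl] := gl.
suff D0 : fine 'E_P[f n]%E - fine 'E_P[g n]%E @[n --> \oo] --> 0.
  have -> : fine \o (fun n => 'E_P[f n]%E) = fun n =>
     (fine 'E_P[f n]%E - fine 'E_P[g n]%E) + fine 'E_P[g n]%E.
    by apply/funext => n /=; rewrite subrK.
  by rewrite -[l]add0r; apply: cvgD.
apply/cvgrPdist_le => e e0.
have e2 : 0 < e / 2 by rewrite divr_gt0.
have C1 : 0 < 2 * C + 1 by rewrite ltr_wpDl // mulr_ge0.
move/cvgrPdist_le : fg => /(_ _ e2)/(_ _ (divr_gt0 e2 C1))[E mE hE].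
near=> n; rewrite sub0r normrN.
have [ES EP] : E n `<=` [set w | `|0 - (f n w - g n w)| <= e / 2] /\
   (P (~` E n) <= (e / 2 / (2 * C + 1))%:E)%E by near: n.
apply: le_trans (expectation_distance_le C0 (ltW e2) (mf n) (mg n) (mE n) (fC n) (gC n) _) _.
  by move=> w /ES /=; rewrite sub0r normrN.
rewrite [leRHS]splitr lerD2l.
apply: (@le_trans _ _ (2 * C * (e / 2 / (2 * C + 1)))).
  apply: ler_wpM2l; first by rewrite mulr_ge0.
  by rewrite -lee_fin fineK // fin_num_measure //; exact: measurableC.
rewrite mulrA ler_pdivrMr // mulrC ler_pM2l //; lra.
Unshelve. all: by end_near. Qed.

Lemma tail_small (f : T -> R) (eps : R) : measurable_fun setT f -> 0 < eps ->
  exists2 K : R, 0 <= K & (P [set w | (K < `|f w|)%R] <= eps%:E)%E.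
Proof.
move=> mf e0; pose F k := [set w | (k%:R < `|f w|)%R].
have mF k : measurable (F k).
  have -> : F k = ~` [set w | `|f w| <= k%:R].
    by apply/seteqP; split => w; rewrite /F /= real_ltNge ?num_real // => /negP.
  by apply/measurableC/measurable_le_set/measurable_norm_comp.
have F0 : \bigcap_k F k = set0.
  apply/seteqP; split => // w /(_ (Num.bound `|f w|) I) /=.
  rewrite /F /= real_ltNge ?num_real // => /negP; apply.
  by apply: le_trans (ltW (archi_boundP (normr_ge0 _))) _; rewrite lexx.
have : P \o F @ \oo --> P (\bigcap_k F k).
  apply: nonincreasing_cvg_mu => //.
  - by rewrite (le_lt_trans (probability_le1 _ _)) ?ltry.
  - exact: bigcap_measurable.
  - by move=> k l kl; apply/subsetPset => w /=; apply: le_lt_trans; rewrite ler_nat.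
rewrite F0 measure0 => /fine_cvgP[fin /cvgrPdist_le /(_ _ e0) fc].
near \oo => k; exists k%:R => //.
have kf : (P \o F) k \is a fin_num by near: k.
rewrite -[X in (X <= _)%E]/((P \o F) k) -(fineK kf) lee_fin.
have : `|0 - (fine \o (P \o F)) k| <= eps by near: k.
by rewrite sub0r normrN; exact/le_trans/ler_norm.
Unshelve. all: by end_near. Qed.

Lemma measurable_gt_set (f : T -> R) c : measurable_fun setT f ->
  measurable [set w | c < f w].
Proof.
move=> mf; rewrite (_ : mkset _ = ~` [set w | f w <= c]).
  exact/measurableC/measurable_le_set.
by apply/seteqP; split => w /=; rewrite ltNge => /negP.
Qed.

Lemma content_bigsetU_le I (s : seq I) (A : I -> set T) :
  (forall i, measurable (A i)) ->
  (P (\big[setU/set0]_(i <- s) A i) <= \sum_(i <- s) P (A i))%E.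
Proof.
move=> mA; elim: s => [|i s IH]; first by rewrite !big_nil measure0.
rewrite !big_cons; apply: le_trans (measureU2 _ _ _) _ => //.
  exact: bigsetU_measurable.
by rewrite leeD2l.
Qed.

Lemma expectation_le_event (f : T -> R) (A : set T) : measurable_fun setT f ->
  measurable A -> (forall w, 0 <= f w) -> (forall w, f w <= 1) ->
  (forall w, ~ A w -> f w = 0) -> ('E_P[f] <= P A)%E.
Proof.
move=> mf mA f0 f1 fA; rewrite -(expectation_indic P mA).
apply: expectation_le => //; apply: aeW => w; rewrite indicE.
have [Aw|nAw] := pselect (A w); first by rewrite mem_set.
by rewrite fA.
Qed.

Lemma event_le_expectation (f : T -> R) (A : set T) : measurable_fun setT f ->
  measurable A -> (forall w, 0 <= f w) -> (forall w, A w -> 1 <= f w) ->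
  (P A <= 'E_P[f])%E.
Proof.
move=> mf mA f0 fA; rewrite -(expectation_indic P mA).
apply: expectation_le => //; apply: aeW => w; rewrite indicE.
have [Aw|nAw] := pselect (A w); first by rewrite mem_set //; exact: fA.
by rewrite memNset.
Qed.

End bounded_expectations.

Section weak_convergence_lemmas.
Context {R : realType} {d} {T : measurableType d} (P : probability T R).
Context {d'} {T' : measurableType d'} (Q : probability T' R).

Lemma cvg_in_distr_comp N M (X : nat -> T -> 'rV[R]_N) (G : T' -> 'rV[R]_N)
    (C : 'M[R]_(N, M)) : cvg_in_distr P Q X G ->
  cvg_in_distr P Q (fun n w => X n w *m C) (fun w => G w *m C).
Proof.
move=> XG f fc [K fK]; apply: (XG (fun x => f (x *m C))); last by exists K.
move=> x; suff xC : y *m C @[y --> x] --> x *m C.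
  exact: (cvg_comp _ _ xC (fc (x *m C))).
apply: (@cvg_mx_entries _ _ (nbhs x)) => i l; rewrite mxE; under eq_fun do rewrite mxE.
apply: (@cvg_sum_seq _ _ (nbhs x)) => k.
apply: (@cvgM _ _ (nbhs x) _ (fun y : 'rV[R]_N => y i k) (fun=> C k l)).
  exact: coord_continuous.
exact: cvg_cst.
Qed.

(** A continuous function that is 0 below K and 1 above K + 1 lies between the
    indicators of the tails at K + 1 and at K; K is chosen for the limit. *)
Lemma tight_entry N (X : nat -> T -> 'rV[R]_N) (G : T' -> 'rV[R]_N) e :
  (forall n, measurable_mx (X n)) -> measurable_mx G -> cvg_in_distr P Q X G ->
  bounded_in_prob P (fun n w => X n w 0 e).
Proof.
move=> mX mG XG eps e0.
have e2 : 0 < eps / 2 by rewrite divr_gt0.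
have [K K0 GK] := tail_small Q (mG 0 e) e2.
pose g (x : 'rV[R]_N) := Num.min 1 (Num.max 0 (`|x 0 e| - K)).
have gc : continuous g.
  move=> x; apply: (@continuous_min _ _ (fun=> 1) (fun x : 'rV[R]_N => Num.max 0 (`|x 0 e| - K)) x).
    exact: cst_continuous.
  apply: (@continuous_max _ _ (fun=> 0) (fun x : 'rV[R]_N => `|x 0 e| - K) x).
    exact: cst_continuous.
  apply: (@cvgB _ _ _ (nbhs x)); last exact: cvg_cst.
  by apply: (@cvg_norm _ _ _ (nbhs x)); exact: coord_continuous.
have g0 x : 0 <= g x by rewrite /g le_min ler01 le_max lexx.
have g1 x : g x <= 1 by rewrite /g ge_min lexx.
have gn x : `|g x| <= 1 by rewrite ger0_norm.
have mgX n : measurable_fun setT (g \o X n) by exact: measurable_continuous_mx.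
have mgG : measurable_fun setT (g \o G) by exact: measurable_continuous_mx.
have := XG g gc (ex_intro _ 1 gn).
have Gfin : 'E_Q[g \o G]%E \is a fin_num.
  by apply: bounded_expectation_fin_num => // w; exact: gn.
rewrite -(fineK Gfin).
move=> /fine_cvgP[fin /cvgrPdist_le /(_ _ e2) gl].
have EG : fine 'E_Q[g \o G]%E <= eps / 2.
  rewrite -lee_fin fineK //; apply: le_trans GK.
  apply: expectation_le_event => //; first by apply/measurable_gt_set/measurable_norm_comp; exact: mG.
  - by move=> w; exact: g0.
  - by move=> w; exact: g1.
  move=> w /= /negP; rewrite -real_leNgt ?num_real // => GwK.
  by rewrite /g max_l ?min_r // subr_le0.
exists (K + 1); near=> n.
have Xfin : 'E_P[g \o X n]%E \is a fin_num by near: n.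
apply: (@le_trans _ _ 'E_P[g \o X n]%E).
  apply: event_le_expectation => //.
    by apply/measurable_gt_set/measurable_norm_comp; exact: mX.
    by move=> w; exact: g0.
  move=> w /= Kw; rewrite /g min_l // le_max; apply/orP; right.
  by rewrite lerBrDl ltW.
rewrite -(fineK Xfin) lee_fin.
have : `|fine 'E_Q[g \o G]%E - fine 'E_P[g \o X n]%E| <= eps / 2 by near: n.
by rewrite ler_distlC => /andP[_]; move: EG; lra.
Unshelve. all: by end_near. Qed.

(** Only x has to lie in the box: in Slutsky's theorem tightness puts X in the
    box, and Y is merely close to X. *)
Lemma uniformly_continuous_on_box N (f : 'rV[R]_N -> R) (K e : R) :
  continuous f -> 0 < e -> exists2 del : R, 0 < del &
    forall x y : 'rV[R]_N, (forall i, `|x 0 i| <= K) ->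
      (forall i, `|x 0 i - y 0 i| < del) -> `|f x - f y| <= e.
Proof.
move=> fc e0.
have : compact [set x : 'rV[R]_N | forall i, x 0 i \in `[-K, K]].
  by apply: (@rV_compact _ _ (fun=> `[-K, K]%classic)) => i; exact: segment_compact.
move=> /compact_near_coveringP /(_ _ (0 : R)^'+ (fun del x => forall y : 'rV[R]_N,
  (forall i, `|x 0 i - y 0 i| < del) -> `|f x - f y| <= e)).
case=> [x _|D [D0 DP]].
  have e2 : 0 < e / 2 by rewrite divr_gt0.
  have /(@cvgrPdist_le _ _ _ (nbhs x)) /(_ _ e2) := fc x.
  move=> /nbhs_ballP[rho /= rho0 fx].
  exists (ball x (rho / 2), [set del | del < rho / 2]); first split => /=.
  - by apply: nbhsx_ballx; rewrite divr_gt0.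
  - by apply: nbhs_right_lt; rewrite divr_gt0.
  move=> [x' del] /= [[_ xx'] dr] y x'y.
  have r2 : rho / 2 < rho by rewrite ltr_pdivrMr // ltr_pMr // ltr1n.
  have fx' : `|f x - f x'| <= e / 2.
    by apply: fx; split => // i l; exact: lt_trans (xx' i l) _.
  have fy : `|f x - f y| <= e / 2.
    apply: fx; split => // i l; rewrite ord1 [rho]splitr; apply: ball_triangle (xx' 0 l) _.
    by rewrite /ball /=; apply: lt_trans (x'y l) dr.
  rewrite [e]splitr (_ : f x' - f y = (f x - f y) - (f x - f x')); last by ring.
  by apply: le_trans (ler_normB _ _) _; rewrite lerD.
exists (D / 2); first by rewrite divr_gt0.
move=> x y xK xy; apply: (DP (D / 2)) xy => //=.
- rewrite sub0r normrN gtr0_norm ?divr_gt0 //.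
  by rewrite ltr_pdivrMr // ltr_pMr // ltr1n.
- by rewrite divr_gt0.
by move=> i; rewrite in_itv /= -ler_norml.
Qed.

(** Slutsky's theorem.  Weak convergence makes the sequence tight, and a
    continuous test function is uniformly continuous on the compact box that
    carries almost all the mass. *)
Lemma slutsky N (X Y : nat -> T -> 'rV[R]_N) (G : T' -> 'rV[R]_N) :
  (forall n, measurable_mx (X n)) -> (forall n, measurable_mx (Y n)) ->
  measurable_mx G -> cvg_in_distr P Q X G ->
  (forall e, Y x.1 x.2 0 e - X x.1 x.2 0 e @[x --> whp P] --> 0) ->
  cvg_in_distr P Q Y G.
Proof.
move=> mX mY mG XG YX f fc [C0 fC0].
pose C := `|C0|.
have fC x : `|f x| <= C by rewrite (le_trans (fC0 x)) // ler_norm.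
have mfG : measurable_fun setT (f \o G) by exact: measurable_continuous_mx.
have Gfin : 'E_Q[f \o G]%E \is a fin_num.
  by apply: (bounded_expectation_fin_num _ mfG) => w; exact: fC.
rewrite -(fineK Gfin).
apply: (@cvg_expectation_whp _ _ _ _ _ (fun n => f \o X n) C).
- exact: normr_ge0.
- by move=> n; exact: measurable_continuous_mx.
- by move=> n; exact: measurable_continuous_mx.
- by move=> n w; exact: fC.
- by move=> n w; exact: fC.
- apply/cvgrPdist_le => e e0 eps eps0.
  have eN : 0 < eps / 2 / N.+1%:R by rewrite !divr_gt0.
  have tX i := tight_entry i mX mG XG eN.
  have [K hK] := choice tX.
  pose K1 := \sum_i `|K i|.
  have [del del0 fu] := uniformly_continuous_on_box K1 fc e0.
  have : \forall x \near whp P, forall i, `|X x.1 x.2 0 i - Y x.1 x.2 0 i| < del.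
    apply: filter_forall => i; move/cvgrPdist_lt : (YX i) => /(_ _ del0).
    by apply: (@filterS _ (whp P)) => x; rewrite sub0r opprB.
  have e2 : 0 < eps / 2 by rewrite divr_gt0.
  move=> /(_ _ e2)[E mE hE].
  pose B n i := [set w | K i < `|X n w 0 i|].
  have mB n i : measurable (B n i) by exact: measurable_gt_set (measurable_norm_comp (mX n 0 i)).
  exists (fun n => E n `\` \big[setU/set0]_i B n i).
    by move=> n; apply: measurableD => //; apply: bigsetU_measurable.
  near=> n.
  have [ES EP] : E n `<=` [set w | forall i, `|X n w 0 i - Y n w 0 i| < del] /\
    (P (~` E n) <= (eps / 2)%:E)%E by near: n.
  have BP : forall i, (P (B n i) <= (eps / 2 / N.+1%:R)%:E)%E.
    by near: n; apply: filter_forall => i; exact: hK.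
  split.
    move=> w [/ES /= XY nB]; rewrite sub0r normrN distrC; apply: fu => // i.
    have : ~ B n i w.
      by move=> Bw; apply: nB; rewrite (bigD1 i) //=; left.
    rewrite /B /= => /negP; rewrite -real_leNgt ?num_real // => XK.
    apply: (le_trans XK); apply: le_trans (ler_norm _) _.
    by rewrite /K1 (bigD1 i) //= lerDl sumr_ge0.
  rewrite setCD; apply: le_trans (measureU2 _ _ _) _.
  - exact: measurableC.
  - exact: bigsetU_measurable.
  rewrite [eps in leRHS]splitr EFinD leeD //.
  apply: le_trans (content_bigsetU_le _ _ _) _ => //.
  apply: (@le_trans _ _ (\sum_(i < N) (eps / 2 / N.+1%:R)%:E)%E).
    by apply: lee_sum => i _; exact: BP.
  rewrite sumEFin lee_fin sumr_const card_ord -[X in X <= _]mulr_natr.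
  have NN : N.+1%:R^-1 * N%:R <= 1 :> R by rewrite mulrC ler_pdivrMr // mul1r ler_nat.
  by rewrite -[X in X <= _]mulrA -[X in _ <= X]mulr1 (ler_pM2l e2).
by rewrite fineK //; apply: XG => //; exists C.
Unshelve. all: by end_near. Qed.

End weak_convergence_lemmas.

(** * Linear images of Gaussian vectors *)

Section gaussian_vectors.
Context {R : realType}.

Lemma psdmx_congr N M (S : 'M[R]_N) (C : 'M[R]_(N, M)) :
  psdmx S -> psdmx (C^T *m S *m C).
Proof.
move=> [Ss Sp]; split; first by rewrite !trmx_mul trmxK Ss mulmxA.
by move=> u; have := Sp (C *m u); rewrite trmx_mul !mulmxA.
Qed.

Lemma measurable_mx_mulr d (T : measurableType d) m n p (X : T -> 'M[R]_(m, n))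
    (C : 'M[R]_(n, p)) : measurable_mx X -> measurable_mx (fun w => X w *m C).
Proof.
move=> mX i l; under eq_fun do rewrite mxE.
apply: measurable_sum => k; apply: measurable_funM => //; exact: mX.
Qed.

Lemma gaussian_vector_mulr d (T : measurableType d) (P : probability T R) N M
    (S : 'M[R]_N) (G : T -> 'rV[R]_N) (C : 'M[R]_(N, M)) :
  gaussian_vector P S G -> gaussian_vector P (C^T *m S *m C) (fun w => G w *m C).
Proof.
move=> [mG GS]; split; first exact: measurable_mx_mulr.
move=> u A mA v.
have ev : ((C *m u)^T *m S *m (C *m u)) 0 0 = v by rewrite /v trmx_mul !mulmxA.
have h := GS (C *m u) A mA; cbv zeta in h; rewrite ev in h.
by apply: etrans h; congr (P _); apply/seteqP; split => w /=; rewrite -mulmxA.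
Qed.

End gaussian_vectors.

(** * Positive definite matrices and relative perturbations *)

Section positive_definite_bounds.
Context {R : realType}.

Lemma pdmx_lower_bound n (M : 'M[R]_n) : pdmx M ->
  exists2 c, 0 < c & forall u, c * qf 1%:M u <= qf M u.
Proof.
move=> [Ms Mp]; have [U [d UU MU]] := symmetric_spectral Ms.
have UU' := mulmx1C UU.
have d0 i : 0 < d 0 i.
  have Ui : U *m (U^T *m delta_mx i 0) = delta_mx i 0 :> 'cV[R]_n.
    by rewrite mulmxA UU' mul1mx.
  have := Mp (U^T *m delta_mx i 0); rewrite -/(qf M _) (qf_spectral _ MU) Ui.
  rewrite (bigD1 i) //= big1 ?addr0; last first.
    by move=> k ki; rewrite mxE (negbTE ki) expr0n mulr0.
  rewrite mxE !eqxx expr1n mulr1; apply.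
  apply/eqP => U0; move: Ui; rewrite U0 mulmx0 => /matrixP/(_ i 0)/eqP.
  by rewrite !mxE !eqxx eq_sym oner_eq0.
have S0 : 0 <= \sum_i (d 0 i)^-1 by apply: sumr_ge0 => i _; rewrite invr_ge0 ltW.
have S1 : 0 < \sum_i (d 0 i)^-1 + 1 by rewrite ltr_wpDl.
exists (\sum_i (d 0 i)^-1 + 1)^-1; first by rewrite invr_gt0.
move=> u; rewrite (qf_spectral _ MU) (qf1_orthogonal _ UU) mulr_sumr.
apply: ler_sum => i _; rewrite ler_wpM2r ?sqr_ge0 //.
rewrite -[leRHS]invrK lef_pV2 ?posrE ?invr_gt0 //.
by rewrite (bigD1 i) //= -addrA lerDl addr_ge0 // sumr_ge0 // => k _; rewrite invr_ge0 ltW.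
Qed.

Lemma pdmx_gram n (C : 'M[R]_n) : C \in unitmx -> pdmx (C^T *m C).
Proof.
move=> Cu; split; first by rewrite trmx_mul trmxK.
move=> u u0; rewrite mulmxA -[_ *m u]mulmxA -trmx_mul -[X in (X *m _)]mulmx1.
apply: qf1_gt0; apply: contra_neq u0 => /(congr1 (mulmx (invmx C))).
by rewrite mulmxA mulVmx // mul1mx mulmx0.
Qed.

Lemma form_bounds_unitmx n (M : 'M[R]_n) c : 0 < c ->
  (forall u, c * qf 1%:M u <= qf M u) -> M \in unitmx.
Proof.
move=> c0 Mc; rewrite unitmxE unitfE; apply/negP => /det0P[v v0 vM].
have : 0 < qf M v^T.
  apply: lt_le_trans (Mc _); rewrite mulr_gt0 // qf1_gt0 //.
  by rewrite -(trmx0 R) (inj_eq (@trmx_inj _ _ _)).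
by rewrite /qf trmxK vM mul0mx mxE ltxx.
Qed.

(** The relative comparison of quadratic forms is invariant under congruence by
    G, however badly conditioned G is, and is inherited by each eigenvalue. *)
Lemma eigenvalues_congr_ratio n p (G : 'M[R]_(p, n)) (M N : 'M[R]_n) t (i : 'I_p) :
  M^T = M -> N^T = N -> t <= 1 ->
  (forall u, `|qf (N - M) u| <= t * qf M u) -> 0 <= t ->
  (1 - t) * (eigenvalues (G *m M *m G^T))`_i <= (eigenvalues (G *m N *m G^T))`_i
    <= (1 + t) * (eigenvalues (G *m M *m G^T))`_i.
Proof.
move=> Ms Ns t1 MN t0.
have cs (A : 'M[R]_n) : A^T = A -> (G *m A *m G^T)^T = G *m A *m G^T.
  by move=> As; rewrite !trmx_mul trmxK As mulmxA.
have h u : (1 - t) * qf M u <= qf N u <= (1 + t) * qf M u.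
  have := MN u; rewrite qfD qfN ler_distl mulrBl mulrDl mul1r => /andP[-> /=].
  by rewrite addrC.
apply/andP; split.
  apply: eigenvaluesZ_le; [by rewrite subr_ge0|exact: cs|exact: cs|].
  by move=> u; rewrite !qf_congr; have /andP[] := h (G^T *m u).
apply: eigenvaluesZ_ge; [by rewrite addr_ge0|exact: cs|exact: cs|].
by move=> u; rewrite !qf_congr; have /andP[] := h (G^T *m u).
Qed.

End positive_definite_bounds.

(** * Limits along a filter *)

Section limits_along_a_filter.
Context {R : realType} {U : Type} (F : set_system U) {FF : ProperFilter F}.
Implicit Types f g s : U -> R.

(** The filter version of boundedness in probability: along the filter of
    events of probability tending to one it is implied by tightness, and it
    is exactly what is needed to discard products with a null sequence. *)
Definition null_multiplier f := forall g, g x @[x --> F] --> (0 : R) ->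
  f x * g x @[x --> F] --> (0 : R).

Lemma null_multiplier_near_bounded f C : (\forall x \near F, `|f x| <= C) ->
  null_multiplier f.
Proof.
move=> fC g g0; apply/cvgrPdist_lt => e e0.
have C1 : 0 < `|C| + 1 by rewrite ltr_wpDl.
move/cvgrPdist_lt : g0 => /(_ _ (divr_gt0 e0 C1)) g0.
near=> x; rewrite sub0r normrN normrM.
have gx : `|g x| < e / (`|C| + 1) by rewrite -normrN -sub0r; near: x.
have fx : `|f x| <= `|C|.
  by apply: le_trans (_ : C <= _); [near: x|rewrite ler_norm].
apply: (@le_lt_trans _ _ (`|C| * (e / (`|C| + 1)))).
  by rewrite ler_pM // ltW.
rewrite mulrA ltr_pdivrMr // mulrC ltr_pM2l //; lra.
Unshelve. all: by end_near. Qed.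

Lemma cvg0_le f g : (\forall x \near F, `|f x| <= g x) ->
  g x @[x --> F] --> (0 : R) -> f x @[x --> F] --> (0 : R).
Proof.
move=> fg g0; apply/cvgrPdist_le => e e0; move/cvgrPdist_le : g0 => /(_ e e0) g0.
near=> x; rewrite sub0r normrN.
apply: (@le_trans _ _ (g x)); first by near: x.
apply: le_trans (ler_norm _) _; rewrite -normrN -sub0r; near: x; exact: g0.
Unshelve. all: by end_near. Qed.

Lemma near_gt f (l c : R) : f x @[x --> F] --> l -> c < l -> \forall x \near F, c < f x.
Proof.
move=> fl cl; move/cvgrPdist_lt : fl => /(_ (l - c)); rewrite subr_gt0 => /(_ cl).
by apply: filterS => x; rewrite ltr_norml => /andP[_]; lra.
Qed.

Lemma near_lt f (l c : R) : f x @[x --> F] --> l -> l < c -> \forall x \near F, f x < c.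
Proof.
move=> fl cl; move/cvgrPdist_lt : fl => /(_ (c - l)); rewrite subr_gt0 => /(_ cl).
by apply: filterS => x; rewrite ltr_norml => /andP[+ _]; lra.
Qed.

Lemma cvg_ge_near f (l c : R) : f x @[x --> F] --> l ->
  (\forall x \near F, c <= f x) -> c <= l.
Proof.
move=> fl fc; rewrite leNgt; apply/negP => lc.
have [x [cx]] := @filter_ex _ F _ _ (filterI fc (near_lt fl lc)).
by rewrite ltNge cx.
Qed.

Lemma cvg_eq_near f g (l : R) : (\forall x \near F, f x = g x) ->
  g x @[x --> F] --> l -> f x @[x --> F] --> l.
Proof.
move=> fg gl; apply/cvgrPdist_le => e e0; move/cvgrPdist_le : gl => /(_ e e0).
by apply: filterS2 fg => x ->.
Qed.

Lemma cvg_div1 f g (l : R) : f x @[x --> F] --> l -> f x / g x @[x --> F] --> (1 : R) ->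
  (\forall x \near F, f x != 0) -> g x @[x --> F] --> l.
Proof.
move=> fl fg f0; rewrite -[l]divr1.
apply: (@cvg_eq_near _ (fun x => f x / (f x / g x))).
  by apply: filterS f0 => x fx; rewrite invf_div mulrC divfK.
by apply: cvgM => //; apply: cvgV => //; exact: oner_neq0.
Qed.

Lemma ln_ratio_quot (a b : R) : 0 < a -> 0 < b ->
  ln a - ln b = (a / b - 1) * ln1p_quot (a / b - 1).
Proof.
by move=> a0 b0; rewrite -ln1p_quotE [1 + _]addrC subrK ln_div ?posrE.
Qed.

(** ln lam - ln mu = (lam / mu - 1) times a factor tending to 1. *)
Lemma log_ratio_null (lam mu s del : U -> R) : (\forall x \near F, 0 < mu x) ->
  (\forall x \near F, 1 <= s x) -> (\forall x \near F, `|lam x / mu x - 1| <= del x) ->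
  s x * del x @[x --> F] --> (0 : R) ->
  s x * (ln (lam x) - ln (mu x)) @[x --> F] --> (0 : R) /\ lam x / mu x @[x --> F] --> (1 : R).
Proof.
move=> mu0 s1 lm sd.
have st0 : s x * (lam x / mu x - 1) @[x --> F] --> (0 : R).
  apply: cvg0_le sd; near=> x.
  have s0 : 0 <= s x by apply: le_trans ler01 _; near: x.
  by rewrite normrM (ger0_norm s0) ler_wpM2l //; near: x.
have t0 : lam x / mu x - 1 @[x --> F] --> (0 : R).
  apply: (@cvg0_le _ (fun x => s x * del x)) => //; near=> x.
  have lx : `|lam x / mu x - 1| <= del x by near: x.
  apply: (le_trans lx); rewrite ler_peMl //; last by near: x.
  exact: le_trans (normr_ge0 _) lx.
have r1 : lam x / mu x @[x --> F] --> (1 : R).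
  rewrite -[1]add0r.
  apply: (@cvg_eq_near _ (fun x => (lam x / mu x - 1) + 1)).
    by apply: nearW => x; rewrite subrK.
  by apply: cvgD => //; exact: cvg_cst.
split => //.
apply: (@cvg_eq_near _ (fun x => s x * (lam x / mu x - 1) * ln1p_quot (lam x / mu x - 1))).
  near=> x; rewrite -mulrA -ln_ratio_quot //; last by near: x.
  have r0 : 0 < lam x / mu x by near: x; exact: (near_gt r1 ltr01).
  by rewrite -(pmulr_lgt0 _ (_ : 0 < (mu x)^-1)) // invr_gt0; near: x.
rewrite -(mul0r 1); apply: cvgM => //.
exact: (cvg_comp _ _ t0 ln1p_quot_cvg).
Unshelve. all: by end_near. Qed.

Lemma near_form_bounds n (M : U -> 'M[R]_n) (A : 'M[R]_n) : pdmx A ->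
  (forall i l, M x i l @[x --> F] --> A i l) ->
  exists c C : R, [/\ 0 < c, 0 < C & \forall x \near F, forall u,
    c * qf 1%:M u <= qf (M x) u <= C * qf 1%:M u].
Proof.
move=> Ap MA; have [c c0 Ac] := pdmx_lower_bound Ap.
pose K := \sum_i \sum_l `|A i l|.
have K0 : 0 <= K by apply: sumr_ge0 => i _; apply: sumr_ge0.
have S0 : \sum_i \sum_l `|(M x - A) i l| @[x --> F] --> (0 : R).
  rewrite [X in _ --> X](_ : 0 = \sum_(i < n) \sum_(l < n) `|A i l - A i l|).
    apply: cvg_sum_seq => i; apply: cvg_sum_seq => l.
    apply: cvg_norm; under eq_fun do rewrite !mxE.
    by apply: cvgB => //; exact: cvg_cst.
  by rewrite big1 // => i _; rewrite big1 // => l _; rewrite subrr normr0.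
have c2 : 0 < c / 2 by rewrite divr_gt0.
exists (c / 2), (K + c); split => //; first by rewrite ltr_wpDl.
near=> x => u.
have Sx : \sum_i \sum_l `|(M x - A) i l| <= c / 2.
  by apply/ltW; near: x; exact: (near_lt S0 c2).
have := normr_qf_le (M x - A) u; have := normr_qf_le A u; have := Ac u.
rewrite qfD qfN -/K; set q := qf 1%:M u => h1 h2 h3.
have q0 : 0 <= q by exact: qf1_ge0.
have h4 : `|qf (M x) u - qf A u| <= c / 2 * q.
  by apply: le_trans h3 _; rewrite ler_wpM2r.
move: h4 h2; rewrite !ler_norml => /andP[h4 h5] /andP[_ h6].
have h7 := mulr_ge0 (ltW c0) q0.
rewrite mulrDl; apply/andP; split; lra.
Unshelve. all: by end_near. Qed.

End limits_along_a_filter.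

(** * Eigenvalues of graded matrices *)

(** The relative error e1 / e2 - 1 of an eigenvalue solved from the value of a
    block determinant, with sg the sign (-1) ^+ r, sc the scale of the
    eigenvalue and cf the product of the other factors. *)
Fact relative_error_solve {R : realType} (e1 e2 sc cf Q sg : R) :
  e2 != 0 -> sc != 0 -> cf != 0 -> sg * sg = 1 ->
  (e1 / e2 - 1) * Q =
  - (sg * Q) / (e2 / sc ^+ 2 * cf) * (sg * ((e2 - e1) / sc ^+ 2 * cf)).
Proof.
move=> e20 sc0 cf0 sg1; transitivity (sg * sg * ((e1 / e2 - 1) * Q)).
  by rewrite sg1 mul1r.
field.
by rewrite e20 sc0 cf0.
Qed.

Section graded_perturbation.
Context {R : realType} {U : Type} (F : set_system U) {FF : ProperFilter F}.
Context {r : nat} (h : 'I_r -> R) (a : U -> R) (C : U -> 'M[R]_r) (Clim : 'M[R]_r).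
Hypothesis a_ge1 : forall x, 1 <= a x.
Hypothesis a_infty : (a x)^-1 @[x --> F] --> (0 : R).
Hypothesis h_sorted : forall i l : 'I_r, (i <= l)%N -> h i <= h l.
Hypothesis C_cvg : forall i l, C x i l @[x --> F] --> Clim i l.
Hypothesis Clim_unit : Clim \in unitmx.

Definition scale x : 'rV[R]_r := \row_i (a x `^ (h i + 1 / 2)).

(** When B is the normalized covariance of the signal and C the triangular
    factor of the mixing matrix, the nonzero eigenvalues of the signal part of
    the wavelet covariance are those of this matrix. *)
Definition graded (B : U -> 'M[R]_r) x : 'M[R]_r :=
  C x *m diag_mx (scale x) *m B x *m diag_mx (scale x) *m (C x)^T.

Local Notation eig B x i := (eigenvalues (graded B x))`_i.

Lemma a_gt0 x : 0 < a x. Proof. exact: lt_le_trans ltr01 (a_ge1 x). Qed.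

Lemma scale_gt0 x i : 0 < scale x 0 i.
Proof. by rewrite mxE powR_gt0 // a_gt0. Qed.

Lemma scale_le x (i l : 'I_r) : (i <= l)%N -> scale x 0 i <= scale x 0 l.
Proof. by move=> il; rewrite !mxE ler_powR // lerD2r h_sorted. Qed.

Lemma a_powR_cvg0 k : 0 < k -> a x `^ (- k) @[x --> F] --> (0 : R).
Proof.
move=> k0; apply/cvgrPdist_lt => e e0.
move/cvgrPdist_lt : a_infty => /(_ (e `^ k^-1) (powR_gt0 _ e0)).
apply: filterS => x; rewrite !sub0r !normrN.
rewrite !ger0_norm ?powR_ge0 ?invr_ge0 ?(ltW (a_gt0 x)) // => ax.
have -> : a x `^ (- k) = (a x)^-1 `^ k.
  by rewrite -powR_inv1 ?(ltW (a_gt0 x)) // -powRrM mulN1r.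
rewrite [ltRHS](_ : e = (e `^ k^-1) `^ k).
  by apply: gt0_ltr_powR ax; rewrite ?nnegrE ?powR_ge0 ?invr_ge0 ?(ltW (a_gt0 x)).
by rewrite -powRrM mulVf ?gt_eqF // powRr1 // ltW.
Qed.

Lemma scale_ratio x i l : scale x 0 i / scale x 0 l = a x `^ (h i - h l).
Proof.
have aN : a x != 0 by rewrite gt_eqF ?a_gt0.
rewrite !mxE -powRN -powRD; last by rewrite aN implybT.
by congr (_ `^ _); ring.
Qed.

Lemma scale_ratio_cvg0 i l : h i < h l ->
  scale x 0 i / scale x 0 l @[x --> F] --> (0 : R).
Proof.
move=> il; under eq_fun do rewrite scale_ratio -opprB.
by apply: a_powR_cvg0; rewrite subr_gt0.
Qed.

(** Normalizing row and column i of the pencil by the larger of the scales of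
    i and of the eigenvalue under study keeps every entry bounded. *)
Definition norming (q : 'I_r) x : 'rV[R]_r :=
  \row_i (if h i <= h q then scale x 0 q else scale x 0 i).

Lemma norming_neq0 q x i : norming q x 0 i != 0.
Proof. by rewrite mxE; case: ifP => _; rewrite gt_eqF ?scale_gt0. Qed.

Lemma norming_target_cvg q i :
  scale x 0 q / norming q x 0 i @[x --> F] --> ((h i <= h q)%R%:R : R).
Proof.
have [iq|qi] := leP (h i) (h q).
  apply: (@cvg_eq_near _ _ _ _ _ (fun=> 1)); last exact: cvg_cst.
  by apply: nearW => x; rewrite [norming _ _ _ _]mxE iq divff // gt_eqF ?scale_gt0.
apply: (@cvg_eq_near _ _ _ _ _ (fun x => scale x 0 q / scale x 0 i)).
  by apply: nearW => x; rewrite [norming _ _ _ _]mxE leNgt qi.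
exact: scale_ratio_cvg0.
Qed.

Lemma norming_own_cvg q i :
  scale x 0 i / norming q x 0 i @[x --> F] --> ((h q <= h i)%R%:R : R).
Proof.
have [iq|qi] := ltP (h i) (h q).
  apply: (@cvg_eq_near _ _ _ _ _ (fun x => scale x 0 i / scale x 0 q)).
    by apply: nearW => x; rewrite [norming _ _ _ _]mxE (ltW iq).
  exact: scale_ratio_cvg0.
apply: (@cvg_eq_near _ _ _ _ _ (fun=> 1)); last exact: cvg_cst.
apply: nearW => x; rewrite [norming _ _ _ _]mxE; case: ifP => iq.
  have hiq : h i = h q by apply/le_anti; rewrite iq.
  by rewrite scale_ratio hiq subrr powRr0.
by rewrite divff // gt_eqF ?scale_gt0.
Qed.

Lemma gram_cvg i l : ((C x)^T *m C x) i l @[x --> F] --> (Clim^T *m Clim) i l.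
Proof.
rewrite mxE; under eq_fun do rewrite mxE.
apply: cvg_sum_seq => k; rewrite mxE; under eq_fun do rewrite mxE.
by apply: cvgM; exact: C_cvg.
Qed.

Lemma graded_sym (B : U -> 'M[R]_r) x : (B x)^T = B x -> (graded B x)^T = graded B x.
Proof. by move=> Bs; rewrite /graded !trmx_mul !trmxK !tr_diag_mx Bs !mulmxA. Qed.

(** The forms of B and C^T C are eventually bounded above and below, and the
    bounds of graded_eigenvalues_bounds apply. *)
Lemma graded_eigenvalues_order (B : U -> 'M[R]_r) (Blim : 'M[R]_r) :
  (forall x, (B x)^T = B x) -> pdmx Blim ->
  (forall i l, B x i l @[x --> F] --> Blim i l) ->
  exists c K : R, [/\ 0 < c, 0 < K & \forall x \near F, forall i : 'I_r,
    c * (scale x 0 i ^+ 2) <= eig B x i <= K * (scale x 0 i ^+ 2)].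
Proof.
move=> Bs Bp BB.
have [b0 [b1 [b00 b10 hb]]] := near_form_bounds Bp BB.
have [a0 [a1 [a00 a10 hA]]] := near_form_bounds (pdmx_gram Clim_unit) gram_cvg.
exists (b0 * a0), (b1 * a1); rewrite !mulr_gt0 //; split => //.
near=> x => i.
have hbx : forall u, b0 * qf 1%:M u <= qf (B x) u <= b1 * qf 1%:M u by near: x.
have hax : forall u, a0 * qf 1%:M u <= qf ((C x)^T *m C x) u <= a1 * qf 1%:M u by near: x.
apply: graded_eigenvalues_bounds => //; try exact: ltW.
- by move=> l; rewrite ltW // scale_gt0.
- exact: scale_le.
Unshelve. all: by end_near. Qed.

Section two_matrices.
Context (B1 B2 : U -> 'M[R]_r) (B : 'M[R]_r) (s : U -> R) (xi : 'I_r -> R).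
Hypothesis B1_sym : forall x, (B1 x)^T = B1 x.
Hypothesis B2_sym : forall x, (B2 x)^T = B2 x.
Hypothesis B_pd : pdmx B.
Hypothesis B2_cvg : forall i l, B2 x i l @[x --> F] --> B i l.
Hypothesis s_inv_cvg : (s x)^-1 @[x --> F] --> (0 : R).
Hypothesis s_ge1 : \forall x \near F, 1 <= s x.
Hypothesis dev_bounded : forall i l,
  null_multiplier F (fun x => s x * (B1 x - B2 x) i l).
Hypothesis xi_cvg : forall i : 'I_r,
  eig B1 x i / (scale x 0 i ^+ 2) @[x --> F] --> xi i.
Hypothesis xi_distinct : forall i l, i != l -> h i = h l -> xi i != xi l.

Lemma dev_cvg0 i l : (B1 x - B2 x) i l @[x --> F] --> (0 : R).
Proof.
apply: (@cvg_eq_near _ _ _ _ _ (fun x => s x * (B1 x - B2 x) i l * (s x)^-1)).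
  near=> x; have s1 : 1 <= s x by near: x.
  by rewrite [s x * _]mulrC mulfK // gt_eqF // (lt_le_trans ltr01).
exact: dev_bounded.
Unshelve. all: by end_near. Qed.

Lemma perturbed_cvg i l : B1 x i l @[x --> F] --> B i l.
Proof.
rewrite -[B i l]add0r.
apply: (@cvg_eq_near _ _ _ _ _ (fun x => (B1 x - B2 x) i l + B2 x i l)).
  by apply: nearW => x; rewrite !mxE subrK.
by apply: cvgD; [exact: dev_cvg0|exact: B2_cvg].
Qed.

Lemma xi_gt0 i : 0 < xi i.
Proof.
have [c [K [c0 K0 cK]]] := graded_eigenvalues_order B1_sym B_pd perturbed_cvg.
apply: (@lt_le_trans _ _ c) => //.
apply: (cvg_ge_near (@xi_cvg i)).
near=> x; rewrite ler_pdivlMr ?exprn_gt0 ?scale_gt0 //.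
have : forall i : 'I_r, c * (scale x 0 i ^+ 2) <= eig B1 x i <= K * (scale x 0 i ^+ 2).
  by near: x.
by move=> /(_ i)/andP[].
Unshelve. all: by end_near. Qed.

Lemma near_eig_gt0 (B' : U -> 'M[R]_r) : (forall x, (B' x)^T = B' x) ->
  (forall i l, B' x i l @[x --> F] --> B i l) ->
  \forall x \near F, forall i : 'I_r, 0 < eig B' x i.
Proof.
move=> B's B'B.
have [c [K [c0 K0 cK]]] := graded_eigenvalues_order B's B_pd B'B.
near=> x => i.
have : forall i : 'I_r, c * (scale x 0 i ^+ 2) <= eig B' x i <= K * (scale x 0 i ^+ 2).
  by near: x.
move=> /(_ i)/andP[+ _]; apply: lt_le_trans.
by rewrite mulr_gt0 // exprn_gt0 // scale_gt0.
Unshelve. all: by end_near. Qed.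

(** Since B2 stays away from singularity, an entrywise small perturbation is
    small relatively to B2 as a quadratic form, hence so are the relative
    perturbations of all eigenvalues, whatever their orders of magnitude. *)
Lemma eig_ratio_cvg1 (i : 'I_r) : eig B1 x i / eig B2 x i @[x --> F] --> (1 : R).
Proof.
have [c [K [c0 K0 cK]]] := near_form_bounds B_pd B2_cvg.
pose del x := c^-1 * \sum_i \sum_l `|(B1 x - B2 x) i l|.
have del0 : del x @[x --> F] --> (0 : R).
  rewrite -(mulr0 c^-1); apply: cvgM; first exact: cvg_cst.
  rewrite [X in _ --> X](_ : 0 = \sum_(i < r) \sum_(l < r) `|0 : R|).
    apply: cvg_sum_seq => k; apply: cvg_sum_seq => l.
    by apply: cvg_norm; exact: dev_cvg0.
  by rewrite big1 // => k _; rewrite big1 // => l _; rewrite normr0.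
suff : eig B1 x i / eig B2 x i - 1 @[x --> F] --> (0 : R).
  move=> e0; rewrite -[1]add0r.
  apply: (@cvg_eq_near _ _ _ _ _ (fun x => (eig B1 x i / eig B2 x i - 1) + 1)).
    by apply: nearW => x; rewrite subrK.
  by apply: cvgD => //; exact: cvg_cst.
apply: (@cvg0_le _ _ F _ _ del _ del0); near=> x.
have e2 : 0 < eig B2 x i.
  by move: (i); near: x; exact: near_eig_gt0 B2_sym B2_cvg.
have S0 : 0 <= \sum_i \sum_l `|(B1 x - B2 x) i l|.
  by apply: sumr_ge0 => k _; apply: sumr_ge0.
have dx0 : 0 <= del x by rewrite mulr_ge0 // invr_ge0 ltW.
have dx1 : del x <= 1 by apply/ltW; near: x; exact: (near_lt del0 ltr01).
have gE (B' : U -> 'M[R]_r) : graded B' x =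
    (C x *m diag_mx (scale x)) *m B' x *m (C x *m diag_mx (scale x))^T.
  by rewrite /graded trmx_mul tr_diag_mx !mulmxA.
have := eigenvalues_congr_ratio (C x *m diag_mx (scale x)) i (B2_sym x) (B1_sym x) dx1.
rewrite -!gE => /(_ _ dx0) eb.
have h1 : forall u, c * qf 1%:M u <= qf (B2 x) u <= K * qf 1%:M u by near: x.
have hq u : `|qf (B1 x - B2 x) u| <= del x * qf (B2 x) u.
  have h2 : qf 1%:M u <= c^-1 * qf (B2 x) u.
    by rewrite ler_pdivlMl //; have /andP[] := h1 u.
  apply: le_trans (normr_qf_le _ _) _; apply: le_trans (ler_wpM2l S0 h2) _.
  by rewrite /del le_eqVlt; apply/orP; left; apply/eqP; ring.
have /andP[lo hi] := eb hq.
by rewrite ler_distl (ler_pdivlMr _ _ e2) (ler_pdivrMr _ _ e2) lo hi.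
Unshelve. all: by end_near. Qed.

Lemma xi2_cvg (i : 'I_r) : eig B2 x i / (scale x 0 i ^+ 2) @[x --> F] --> xi i.
Proof.
apply: (cvg_div1 (@xi_cvg i)).
  apply: cvg_eq_near (@eig_ratio_cvg1 i); apply: nearW => x.
  by rewrite invf_div mulrA divfK // expf_neq0 // gt_eqF ?scale_gt0.
apply: filterS (near_gt (@xi_cvg i) (xi_gt0 i)) => x.
by move=> /gt_eqF ->.
Qed.

Lemma cvg_block_mx_entries p1 p2 q1 q2
    (A : U -> 'M[R]_(p1, q1)) (A' : U -> 'M[R]_(p1, q2))
    (A'' : U -> 'M[R]_(p2, q1)) (A''' : U -> 'M[R]_(p2, q2)) (L : 'M[R]_(p1, q1)) (L' : 'M[R]_(p1, q2))
    (L'' : 'M[R]_(p2, q1)) (L''' : 'M[R]_(p2, q2)) :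
  (forall i l, A x i l @[x --> F] --> L i l) ->
  (forall i l, A' x i l @[x --> F] --> L' i l) ->
  (forall i l, A'' x i l @[x --> F] --> L'' i l) ->
  (forall i l, A''' x i l @[x --> F] --> L''' i l) ->
  block_mx (A x) (A' x) (A'' x) (A''' x) @[x --> F] --> block_mx L L' L'' L'''.
Proof.
move=> AL AL' AL'' AL'''; apply: cvg_mx_entries => i l.
rewrite /block_mx mxE; under eq_fun do rewrite mxE.
case: (fintype.split i) => k; rewrite mxE; under eq_fun do rewrite mxE.
  by case: (fintype.split l) => k'; [exact: AL|exact: AL'].
by case: (fintype.split l) => k'; [exact: AL''|exact: AL'''].
Qed.

Lemma cvg_diag_mx_entries (v : U -> 'rV[R]_r) (w : 'rV[R]_r) :
  (forall i, v x 0 i @[x --> F] --> w 0 i) ->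
  forall i l, diag_mx (v x) i l @[x --> F] --> diag_mx w i l.
Proof.
move=> vw i l; rewrite mxE; under eq_fun do rewrite mxE.
case: (i == l); last by under eq_fun do rewrite mulr0n; exact: cvg_cst.
by under eq_fun do rewrite mulr1n; exact: vw.
Qed.

Lemma cvg_mulmx_entries p1 p2 p3 (A : U -> 'M[R]_(p1, p2))
    (A' : U -> 'M[R]_(p2, p3)) (L : 'M[R]_(p1, p2)) (L' : 'M[R]_(p2, p3)) :
  (forall i l, A x i l @[x --> F] --> L i l) ->
  (forall i l, A' x i l @[x --> F] --> L' i l) ->
  forall i l, (A x *m A' x) i l @[x --> F] --> (L *m L') i l.
Proof.
move=> AL AL' i l; rewrite mxE; under eq_fun do rewrite mxE.
by apply: cvg_sum_seq => k; apply: cvgM; [exact: AL|exact: AL'].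
Qed.

Section linearization.
Context (q : 'I_r).

(* The scaled eigenvalue of the reference matrix B2: the determinant of the
   pencil vanishes at B2. *)
Let y x := eig B2 x q / (scale x 0 q ^+ 2).
Let S x := diag_mx (\row_i (scale x 0 q / norming q x 0 i)).
Let K x := diag_mx (\row_i (scale x 0 i / norming q x 0 i)).
Let pencil (B' : U -> 'M[R]_r) x :=
  block_mx (B' x) (S x) (y x *: S x) (K x *m ((C x)^T *m C x) *m K x).
Let Slim : 'M[R]_r := diag_mx (\row_i (h i <= h q)%R%:R).
Let Klim : 'M[R]_r := diag_mx (\row_i (h q <= h i)%R%:R).
Let limpencil := block_mx B Slim (xi q *: Slim) (Klim *m (Clim^T *m Clim) *m Klim).

Let S_cvg i l : S x i l @[x --> F] --> Slim i l.
Proof.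
apply: cvg_diag_mx_entries => k; rewrite mxE; under eq_fun do rewrite mxE.
exact: norming_target_cvg.
Qed.

Let K_cvg i l : K x i l @[x --> F] --> Klim i l.
Proof.
apply: cvg_diag_mx_entries => k; rewrite mxE; under eq_fun do rewrite mxE.
exact: norming_own_cvg.
Qed.

Let pencil_cvg (B' : U -> 'M[R]_r) : (forall i l, B' x i l @[x --> F] --> B i l) ->
  pencil B' x @[x --> F] --> limpencil.
Proof.
move=> B'B; apply: cvg_block_mx_entries => //.
  move=> i l; rewrite mxE; under eq_fun do rewrite mxE.
  by apply: cvgM; [exact: xi2_cvg|exact: S_cvg].
apply: cvg_mulmx_entries; last exact: K_cvg.
by apply: cvg_mulmx_entries; [exact: K_cvg|exact: gram_cvg].
Qed.

(* The factors of the pencil determinant at B1 other than the one of index q,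
   which is the difference of eigenvalues to be computed. *)
Let cofactors x := \prod_(i | i != q)
  ((y x * scale x 0 q ^+ 2 - eig B1 x i) / norming q x 0 i ^+ 2).
Let limcofactors := \prod_(i | i != q)
  (xi q * (h i <= h q)%R%:R ^+ 2 - xi i * (h q <= h i)%R%:R ^+ 2).

Let cofactors_cvg : cofactors x @[x --> F] --> limcofactors.
Proof.
rewrite /cofactors /limcofactors big_mkcond; under eq_fun do rewrite big_mkcond.
apply: cvg_prod_seq => i; case: ifP => _; last exact: cvg_cst.
apply: (@cvg_eq_near _ _ _ _ _ (fun x => y x * (scale x 0 q / norming q x 0 i) ^+ 2
   - eig B1 x i / (scale x 0 i ^+ 2) * (scale x 0 i / norming q x 0 i) ^+ 2)).
  apply: nearW => x; have e0 := norming_neq0 q x i.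
  have si : scale x 0 i != 0 by rewrite gt_eqF ?scale_gt0.
  by field; rewrite e0 si.
apply: cvgB; apply: cvgM.
- exact: xi2_cvg.
- by under eq_fun do rewrite expr2; rewrite expr2; apply: cvgM; exact: norming_target_cvg.
- exact: xi_cvg.
- by under eq_fun do rewrite expr2; rewrite expr2; apply: cvgM; exact: norming_own_cvg.
Qed.

(* A factor with h i < h q tends to xi q, one with h i > h q to - xi i, and one
   with h i = h q to xi q - xi i: this is where the xi have to be distinct. *)
Let limcofactors_neq0 : limcofactors != 0.
Proof.
apply/prodf_neq0 => i iq; have [hi|hi|hi] := ltgtP (h i) (h q).
- by rewrite expr1n expr0n mulr1 mulr0 subr0 gt_eqF ?xi_gt0.
- by rewrite expr1n expr0n mulr1 mulr0 sub0r oppr_eq0 gt_eqF ?xi_gt0.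
- by rewrite expr1n !mulr1 subr_eq0 eq_sym; exact: xi_distinct.
Qed.

Let near_unit (B' : U -> 'M[R]_r) : (forall i l, B' x i l @[x --> F] --> B i l) ->
  \forall x \near F, B' x \in unitmx.
Proof.
move=> B'B; have [c [k [c0 k0 ck]]] := near_form_bounds B_pd B'B.
apply: filterS ck => x ck; apply: (form_bounds_unitmx c0) => u.
by have /andP[] := ck u.
Qed.

Let pencil_det1 : \forall x \near F, \det (pencil B1 x) =
  (-1) ^+ r * (((eig B2 x q - eig B1 x q) / scale x 0 q ^+ 2) * cofactors x).
Proof.
apply: filterS (near_unit perturbed_cvg) => x Bu.
rewrite (block_det_eigenvalues (C x) (scale x) (scale x 0 q) (y x) Bu (B1_sym x) (norming_neq0 q x)).
rewrite (bigD1 q) //= -/(graded B1 x); congr (_ * (_ * _)).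
rewrite /y divfK ?expf_neq0 ?gt_eqF ?scale_gt0 //.
by rewrite [norming _ _ _ _]mxE lexx.
Qed.

Let pencil_det2 : \forall x \near F, \det (pencil B2 x) = 0.
Proof.
apply: filterS (near_unit B2_cvg) => x Bu.
rewrite (block_det_eigenvalues (C x) (scale x) (scale x 0 q) (y x) Bu (B2_sym x) (norming_neq0 q x)).
rewrite (bigD1 q) //= -/(graded B2 x) /y divfK ?expf_neq0 ?gt_eqF ?scale_gt0 //.
by rewrite subrr !mul0r mulr0.
Qed.

(** The pencil has the same limit at B1 and at B2, and its determinant vanishes
    at B2.  At B1 it is, by block_det_eigenvalues and up to sign, the scaled
    difference of the eigenvalues of index q times cofactors with a nonzero
    limit; by divided_difference_det it is also a linear combination of the
    entries of B1 - B2 with convergent coefficients.  Since s (B1 - B2) is a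
    null multiplier, the coefficients can be replaced by their limits. *)
Lemma log_eigenvalue_linearization : exists g : 'M[R]_r,
  s x * (ln (eig B1 x q) - ln (eig B2 x q)) -
    \sum_i \sum_l g i l * (s x * (B1 x - B2 x) i l) @[x --> F] --> (0 : R).
Proof.
have [c [_ dc cc]] := @divided_difference_det R (r + r).
pose c1 i l x := c (lshift r i) (lshift r l) (pencil B1 x, pencil B2 x).
have c1_cvg i l : c1 i l x @[x --> F] --> c (lshift r i) (lshift r l) (limpencil, limpencil).
  have pp : (pencil B1 x, pencil B2 x) @[x --> F] --> (limpencil, limpencil).
    exact: (cvg_pair (pencil_cvg perturbed_cvg) (pencil_cvg B2_cvg)).
  exact: (cvg_comp _ _ pp (cc _ _ (limpencil, limpencil))).
have cdet : \forall x \near F, \sum_i \sum_l c1 i l x * (B1 x - B2 x) i l =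
    (-1) ^+ r * (((eig B2 x q - eig B1 x q) / scale x 0 q ^+ 2) * cofactors x).
  near=> x.
  have D1 : \det (pencil B1 x) = (-1) ^+ r *
    (((eig B2 x q - eig B1 x q) / scale x 0 q ^+ 2) * cofactors x) by near: x.
  have D2 : \det (pencil B2 x) = 0 by near: x.
  transitivity (\det (pencil B1 x) - \det (pencil B2 x)); last by rewrite D1 D2 subr0.
  apply/esym; rewrite dc big_split_ord /= [X in _ + X]big1 ?addr0; last first.
    move=> i _; apply: big1 => l _; rewrite -[l]splitK; case: (fintype.split l) => k /=.
      by rewrite !block_mxEdl subrr mulr0.
    by rewrite !block_mxEdr subrr mulr0.
  apply: eq_bigr => i _; rewrite big_split_ord /= [X in _ + X]big1 ?addr0; last first.
    by move=> l _; rewrite !block_mxEur subrr mulr0.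
  by apply: eq_bigr => l _; rewrite !block_mxEul !mxE.
pose t x := eig B1 x q / eig B2 x q - 1.
have t0 : t x @[x --> F] --> (0 : R).
  rewrite -(subrr 1); apply: cvgB; [exact: eig_ratio_cvg1|exact: cvg_cst].
(* The ratio of the difference of logarithms to the pencil determinant. *)
pose k x := - ((-1) ^+ r * ln1p_quot (t x)) / (y x * cofactors x).
have k_cvg : k x @[x --> F] --> - ((-1) ^+ r * 1) / (xi q * limcofactors).
  apply: cvgM.
    apply: cvgN; apply: cvgM; first exact: cvg_cst.
    exact: (cvg_comp _ _ t0 (@ln1p_quot_cvg R)).
  apply: cvgV; first by rewrite mulf_neq0 // gt_eqF ?xi_gt0.
  by apply: cvgM => //; exact: xi2_cvg.
pose g := \matrix_(i < r, l < r) (- ((-1) ^+ r * 1) / (xi q * limcofactors) *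
   c (lshift r i) (lshift r l) (limpencil, limpencil)).
exists g.
have E : \forall x \near F, s x * (ln (eig B1 x q) - ln (eig B2 x q)) -
    \sum_i \sum_l g i l * (s x * (B1 x - B2 x) i l) =
    \sum_i \sum_l (s x * (B1 x - B2 x) i l) * (k x * c1 i l x - g i l).
  have p1 : \forall x \near F, 0 < eig B1 x q.
    by apply: filterS (near_eig_gt0 B1_sym perturbed_cvg) => x /(_ q).
  have p2 : \forall x \near F, 0 < eig B2 x q.
    by apply: filterS (near_eig_gt0 B2_sym B2_cvg) => x /(_ q).
  have p3 : \forall x \near F, cofactors x != 0.
    have := cofactors_cvg; move/cvgrPdist_lt.
    move=> /(_ `|limcofactors|); rewrite normr_gt0 => /(_ limcofactors_neq0).
    apply: filterS => x; apply: contraTneq => ->.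
    by rewrite subr0 ltxx.
  apply: filterS (filterI (filterI p1 p2) (filterI p3 cdet)) => x [[e1 e2] [cx0 cdx]].
  have sq : scale x 0 q != 0 by rewrite gt_eqF ?scale_gt0.
  have -> : ln (eig B1 x q) - ln (eig B2 x q) =
     k x * \sum_i \sum_l c1 i l x * (B1 x - B2 x) i l.
    rewrite ln_ratio_quot // -/(t x) cdx /k /y.
    by apply: relative_error_solve; [rewrite gt_eqF|exact: sq|exact: cx0|rewrite -expr2 sqrr_sign].
  rewrite mulrA mulr_sumr -sumrB; apply: eq_bigr => i _.
  rewrite mulr_sumr -sumrB; apply: eq_bigr => l _.
  by ring.
apply: cvg_eq_near E _.
rewrite [X in _ --> X](_ : 0 = \sum_(i < r) \sum_(l < r) (0 : R)); last first.
  by rewrite big1 // => i _; rewrite big1.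
apply: cvg_sum_seq => i; apply: cvg_sum_seq => l.
apply: dev_bounded; rewrite -(subrr (g i l)); apply: cvgB; last exact: cvg_cst.
by rewrite [X in _ --> X]mxE; apply: cvgM.
Unshelve. all: by end_near. Qed.

End linearization.
End two_matrices.
End graded_perturbation.

(** * Powers of the scaling matrix *)

Section matrix_powers.
Context {R : realType}.

Lemma expmx_conj n (P : 'M[R]_n) (d : 'rV[R]_n) : P \in unitmx ->
  expmx (P *m diag_mx d *m invmx P) =
  P *m diag_mx (\row_i expR (d 0 i)) *m invmx P.
Proof.
move=> Pu; rewrite /expmx.
have powE k : (P *m diag_mx d *m invmx P) ^+ k =
    P *m diag_mx (\row_i (d 0 i ^+ k)) *m invmx P.
  elim: k => [|k IH].
    rewrite expr0 (_ : \row_i _ = const_mx 1).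
      by rewrite diag_const_mx mulmx1 mulmxV.
    by apply/rowP => i; rewrite !mxE.
  rewrite exprS IH -mulmxE !mulmxA -[_ *m invmx P *m P]mulmxA mulVmx // mulmx1.
  rewrite -[_ *m diag_mx d *m _]mulmxA mulmx_diag; congr (_ *m diag_mx _ *m _).
  by apply/rowP => i; rewrite !mxE exprS.
have serE N : series (fun k : nat => (k`!%:R : R)^-1 *: (P *m diag_mx d *m invmx P) ^+ k) N
    = P *m diag_mx (\row_i series (exp_coeff (d 0 i)) N) *m invmx P.
  rewrite /series /=; under eq_bigr do rewrite powE scalemxAl scalemxAr.
  rewrite -mulmx_suml -mulmx_sumr; congr (_ *m _ *m _).
  apply/matrixP => i l; rewrite summxE !mxE -sumrMnl.
  by apply: eq_bigr => k _; rewrite !mxE /exp_coeff mulrnAr mulrC.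
apply: cvg_lim; first exact: norm_hausdorff.
rewrite (_ : series _ = fun N => P *m diag_mx (\row_i series (exp_coeff (d 0 i)) N) *m invmx P).
  apply: cvg_mx_entries => i l.
  apply: cvg_mulmx_entries; last by move=> ? ?; exact: cvg_cst.
  apply: cvg_mulmx_entries; first by move=> ? ?; exact: cvg_cst.
  apply: cvg_diag_mx_entries => k; rewrite mxE; under eq_fun do rewrite mxE.
  exact: is_cvg_series_exp_coeff.
by apply/funext => N; exact: serE.
Qed.

Lemma powmx_conj n (P : 'M[R]_n) (h : 'I_n -> R) (c : R) : 0 < c -> P \in unitmx ->
  powmx c (- (P *m diag_mx (\row_i h i) *m invmx P) - (1 / 2)%:M) =
  P *m diag_mx (\row_i (c `^ (h i + 1 / 2))^-1) *m invmx P.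
Proof.
move=> c0 Pu; rewrite /powmx.
have -> : ln c *: (- (P *m diag_mx (\row_i h i) *m invmx P) - (1 / 2)%:M) =
    P *m diag_mx (\row_i (- ((h i + 1 / 2) * ln c))) *m invmx P.
  have -> : diag_mx (\row_i (- ((h i + 1 / 2) * ln c))) =
      - ln c *: (diag_mx (\row_i h i) + (1 / 2)%:M).
    by apply/matrixP => i l; rewrite !mxE; case: (i == l); rewrite ?mulr1n ?mulr0n; ring.
  rewrite -scalemxAr -scalemxAl mulmxDr mulmxDl mul_mx_scalar -scalemxAl mulmxV //.
  by rewrite scalemx1 scaleNr -scalerN opprD.
rewrite expmx_conj //; congr (_ *m diag_mx _ *m _).
apply/rowP => i; rewrite !mxE expRN /powR gt_eqF //.
Qed.

End matrix_powers.

(** * Wavelet covariances as Gram matrices, and their expectations *)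

Section lower_triangle.
Context {R : realType}.

(** The entries above the diagonal are recovered by symmetry, so the vector of
    lower entries gives access to all of S. *)
Lemma vecS_entry r : exists sg : 'I_r -> 'I_r -> 'I_#|lower_index r|,
  forall S : 'M[R]_r, S^T = S -> forall i l, vecS S 0 (sg i l) = S i l.
Proof.
have low (i l : 'I_r) : (if (l <= i)%N then (i, l) else (l, i)) \in lower_index r.
  by case: ifP => il; rewrite inE //= ltnW // ltnNge il.
exists (fun i l => enum_rank_in (low i l) (if (l <= i)%N then (i, l) else (l, i))).
move=> S Ss i l; rewrite mxE enum_rankK_in //; case: ifP => //= _.
by rewrite -[in RHS]Ss mxE.
Qed.

End lower_triangle.

Section gram_matrices.
Context {R : realType}.

Lemma gram_sum_tr I (s : seq I) n (c : R) (x : I -> 'cV[R]_n) :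
  (c *: \sum_(k <- s) x k *m (x k)^T)^T = c *: \sum_(k <- s) x k *m (x k)^T.
Proof.
rewrite linearZ /= linear_sum /=; congr (_ *: _); apply: eq_bigr => k _.
by rewrite trmx_mul trmxK.
Qed.

Lemma qf_cross n (x y u : 'cV[R]_n) :
  qf (x *m y^T) u = (x^T *m u) 0 0 * (y^T *m u) 0 0.
Proof.
rewrite /qf mulmxA -mulmxA mxE big_ord1; congr (_ * _).
have -> : (u^T *m x) 0 0 = (u^T *m x)^T 0 0 by rewrite [RHS]mxE.
by rewrite trmx_mul trmxK.
Qed.

Lemma gram_sum_ge0 I (s : seq I) n (c : R) (x : I -> 'cV[R]_n) u : 0 <= c ->
  0 <= qf (c *: \sum_(k <- s) x k *m (x k)^T) u.
Proof.
move=> c0; rewrite qfZ qf_sum mulr_ge0 // sumr_ge0 // => k _.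
by rewrite qf_cross -expr2 sqr_ge0.
Qed.

(** Weighted arithmetic-geometric mean inequality on the cross terms of a sum
    of (P x + z)(P x + z)^T. *)
Lemma signal_plus_noise_forms I (s : seq I) p r (c eta : R) (P : 'M[R]_(p, r))
    (x : I -> 'cV[R]_r) (z : I -> 'cV[R]_p) (X : 'M[R]_r) (N : 'M[R]_p)
    (XN : 'M[R]_(r, p)) u : 0 <= c -> 0 < eta ->
  X = c *: \sum_(k <- s) x k *m (x k)^T ->
  N = c *: \sum_(k <- s) z k *m (z k)^T ->
  XN = c *: \sum_(k <- s) x k *m (z k)^T ->
  (1 - eta) * qf (P *m X *m P^T) u + (1 - eta^-1) * qf N u
    <= qf (P *m X *m P^T + N + P *m XN + XN^T *m P^T) u
    <= (1 + eta) * qf (P *m X *m P^T) u + (1 + eta^-1) * qf N u.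
Proof.
move=> c0 e0 XE NE XNE.
pose al k := ((P *m x k)^T *m u) 0 0; pose be k := ((z k)^T *m u) 0 0.
have qS : qf (P *m X *m P^T) u = c * \sum_(k <- s) al k ^+ 2.
  rewrite XE -scalemxAr -scalemxAl qfZ mulmx_sumr mulmx_suml qf_sum.
  congr (_ * _); apply: eq_bigr => k _.
  by rewrite [P *m (_ *m _)]mulmxA -[_ *m P^T]mulmxA -trmx_mul qf_cross expr2.
have qN : qf N u = c * \sum_(k <- s) be k ^+ 2.
  by rewrite NE qfZ qf_sum; congr (_ * _); apply: eq_bigr => k _; rewrite qf_cross expr2.
have qX : qf (P *m XN) u = c * \sum_(k <- s) al k * be k.
  rewrite XNE -scalemxAr qfZ mulmx_sumr qf_sum; congr (_ * _).
  by apply: eq_bigr => k _; rewrite mulmxA qf_cross.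
rewrite !qfD -trmx_mul qf_tr qX qS qN.
have amgm k : - (eta * al k ^+ 2 + eta^-1 * be k ^+ 2) <= 2 * (al k * be k)
    <= eta * al k ^+ 2 + eta^-1 * be k ^+ 2.
  have h1 : 0 <= eta * (al k - eta^-1 * be k) ^+ 2 by rewrite mulr_ge0 ?sqr_ge0 ?ltW.
  have h2 : 0 <= eta * (al k + eta^-1 * be k) ^+ 2 by rewrite mulr_ge0 ?sqr_ge0 ?ltW.
  have E1 : eta * (al k - eta^-1 * be k) ^+ 2 =
      eta * al k ^+ 2 + eta^-1 * be k ^+ 2 - 2 * (al k * be k).
    by field; rewrite gt_eqF.
  have E2 : eta * (al k + eta^-1 * be k) ^+ 2 =
      eta * al k ^+ 2 + eta^-1 * be k ^+ 2 + 2 * (al k * be k).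
    by field; rewrite gt_eqF.
  by rewrite E1 in h1; rewrite E2 in h2; apply/andP; split; lra.
set A := \sum_(k <- s) al k ^+ 2; set B := \sum_(k <- s) be k ^+ 2.
set D := \sum_(k <- s) al k * be k.
have lo : - (eta * A + eta^-1 * B) <= 2 * D.
  rewrite /A /B /D !mulr_sumr -big_split /= -sumrN; apply: ler_sum => k _.
  by have /andP[] := amgm k.
have hi : 2 * D <= eta * A + eta^-1 * B.
  rewrite /A /B /D !mulr_sumr -big_split /=; apply: ler_sum => k _.
  by have /andP[] := amgm k.
have := ler_wpM2l c0 lo; have := ler_wpM2l c0 hi.
have -> : c * (2 * D) = c * D + c * D by ring.
have -> : c * (eta * A + eta^-1 * B) = eta * (c * A) + eta^-1 * (c * B) by ring.
have -> : c * - (eta * A + eta^-1 * B) = - (eta * (c * A)) - eta^-1 * (c * B) by ring.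
rewrite !mulrBl !mulrDl !mul1r => h1 h2; apply/andP; split; lra.
Qed.

End gram_matrices.

Section expectations_of_matrices.
Context {R : realType} {d} {T : measurableType d} (P : probability T R).

Definition integrable_mx m n (M : T -> 'M[R]_(m, n)) :=
  forall i l, P.-integrable setT (fun w => (M w i l)%:E).

Lemma all_moments_integrable m n (M : T -> 'M[R]_(m, n)) :
  all_moments P M -> integrable_mx M.
Proof. by move=> mM i l; have := mM i l 1%N; under eq_fun do rewrite expr1. Qed.

Lemma integrable_mx_measurable m n (M : T -> 'M[R]_(m, n)) :
  integrable_mx M -> measurable_mx M.
Proof. by move=> iM i l; apply/measurable_EFinP; have /integrableP[] := iM i l. Qed.

Lemma EmxE m n (M : T -> 'M[R]_(m, n)) i l :
  Emx P M i l = \int[P]_w (M w i l).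
Proof. by rewrite mxE unlock. Qed.

Lemma integrable_lincomb I (s : seq I) (c : I -> R) (f : I -> T -> R) :
  (forall k, P.-integrable setT (fun w => (f k w)%:E)) ->
  P.-integrable setT (fun w => (\sum_(k <- s) c k * f k w)%:E) /\
  \int[P]_w (\sum_(k <- s) c k * f k w) = \sum_(k <- s) c k * \int[P]_w f k w.
Proof.
move=> If; elim: s => [|k s [IH1 IH2]].
  split.
    under eq_fun do rewrite big_nil; exact: integrable0.
  rewrite big_nil; under eq_Rintegral do rewrite big_nil.
  by rewrite Rintegral_cst // mul0r.
have Ik : P.-integrable setT (fun w => (c k * f k w)%:E).
  by under eq_fun do rewrite EFinM; exact: integrableZl.
split.
  by under eq_fun do rewrite big_cons EFinD; exact: integrableD.
rewrite big_cons; under eq_Rintegral do rewrite big_cons.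
by rewrite RintegralD // IH2 RintegralZl //; exact: If.
Qed.

Lemma mulmx3E m n p q (A : 'M[R]_(p, m)) (M : 'M[R]_(m, n)) (B : 'M[R]_(n, q)) i l :
  (A *m M *m B) i l = \sum_(x : 'I_m * 'I_n) A i x.1 * B x.2 l * M x.1 x.2.
Proof.
rewrite mxE -(pair_bigA _ (fun k j => A i k * B j l * M k j)) exchange_big /=.
apply: eq_bigr => j _; rewrite mxE mulr_suml; apply: eq_bigr => k _.
by rewrite mulrAC.
Qed.

Lemma integrable_mulmx m n p q (A : 'M[R]_(p, m)) (M : T -> 'M[R]_(m, n))
    (B : 'M[R]_(n, q)) : integrable_mx M ->
  integrable_mx (fun w => A *m M w *m B).
Proof.
move=> iM i l; under eq_fun do rewrite mulmx3E.
by have [] := integrable_lincomb (index_enum _)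
  (fun x : 'I_m * 'I_n => A i x.1 * B x.2 l) (fun x => iM x.1 x.2).
Qed.

Lemma Emx_mulmx m n p q (A : 'M[R]_(p, m)) (M : T -> 'M[R]_(m, n))
    (B : 'M[R]_(n, q)) : integrable_mx M ->
  Emx P (fun w => A *m M w *m B) = A *m Emx P M *m B.
Proof.
move=> iM; apply/matrixP => i l; rewrite EmxE mulmx3E.
under eq_Rintegral do rewrite mulmx3E.
have [_ ->] := integrable_lincomb (index_enum _)
  (fun x : 'I_m * 'I_n => A i x.1 * B x.2 l) (fun x => iM x.1 x.2).
by apply: eq_bigr => x _; rewrite EmxE.
Qed.

Lemma integrable_mxD m n (M N : T -> 'M[R]_(m, n)) :
  integrable_mx M -> integrable_mx N -> integrable_mx (fun w => M w + N w).
Proof. by move=> iM iN i l; under eq_fun do rewrite mxE EFinD; exact: integrableD. Qed.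

Lemma EmxD m n (M N : T -> 'M[R]_(m, n)) : integrable_mx M -> integrable_mx N ->
  Emx P (fun w => M w + N w) = Emx P M + Emx P N.
Proof.
move=> iM iN; apply/matrixP => i l; rewrite [RHS]mxE !EmxE.
under eq_Rintegral do rewrite mxE.
by rewrite RintegralD //; [exact: iM|exact: iN].
Qed.

Lemma Emx_tr m n (M : T -> 'M[R]_(m, n)) : Emx P (fun w => (M w)^T) = (Emx P M)^T.
Proof.
apply/matrixP => i l; rewrite [RHS]mxE !EmxE.
by under eq_Rintegral do rewrite mxE.
Qed.

Lemma integrable_mx_tr m n (M : T -> 'M[R]_(m, n)) :
  integrable_mx M -> integrable_mx (fun w => (M w)^T).
Proof. by move=> iM i l; under eq_fun do rewrite mxE; exact: iM. Qed.

Lemma Emx_ae_eq m n (M N : T -> 'M[R]_(m, n)) : integrable_mx M -> integrable_mx N ->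
  {ae P, forall w, M w = N w} -> Emx P M = Emx P N.
Proof.
move=> iM iN MN; apply/matrixP => i l; rewrite !EmxE /Rintegral; congr fine.
apply: ae_eq_integral => //.
- by have /integrableP[] := iM i l.
- by have /integrableP[] := iN i l.
by apply: filterS MN => w /= ->.
Qed.

Lemma Emx_qf_ge0 n (M : T -> 'M[R]_n) : integrable_mx M ->
  (forall w u, 0 <= qf (M w) u) -> forall u, 0 <= qf (Emx P M) u.
Proof.
move=> iM M0 u; rewrite /qf -Emx_mulmx // EmxE.
by apply: Rintegral_ge0 => w _; exact: M0.
Qed.

End expectations_of_matrices.

(** * Noise is negligible on the logarithmic scale *)

Section powers_and_rates.
Context {R : realType} {U : Type} (F : set_system U) {FF : ProperFilter F}.

Lemma powR_null (u : U -> R) k : 0 < k -> (forall x, 0 <= u x) ->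
  u x @[x --> F] --> (0 : R) -> u x `^ k @[x --> F] --> (0 : R).
Proof.
move=> k0 u0 ul; apply/cvgrPdist_lt => e e0.
move/cvgrPdist_lt : ul => /(_ (e `^ k^-1) (powR_gt0 _ e0)).
apply: filterS => x; rewrite !sub0r !normrN !ger0_norm ?powR_ge0 // => ux.
rewrite [ltRHS](_ : e = (e `^ k^-1) `^ k).
  by apply: gt0_ltr_powR ux; rewrite ?nnegrE ?powR_ge0.
by rewrite -powRrM mulVf ?gt_eqF // powRr1 // ltW.
Qed.

Lemma sqrt_null (u : U -> R) : u x @[x --> F] --> (0 : R) ->
  Num.sqrt (u x) @[x --> F] --> (0 : R).
Proof.
move=> u0; rewrite -(sqrtr0 R).
exact: (cvg_comp _ _ u0 (@sqrt_continuous R 0)).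
Qed.

(** With N = floor (T / c) observations, where T tends to infinity and
    T / delta to zero, the noise of relative size 1 / delta is negligible at
    the scale 1 / sqrt N. *)
Lemma sample_size_rates (T delta N : U -> R) (c : R) : 0 < c ->
  (forall x, 0 < delta x) -> (forall x, 0 <= N x) ->
  (T x)^-1 @[x --> F] --> (0 : R) -> (\forall x \near F, 0 < T x) ->
  T x / delta x @[x --> F] --> (0 : R) ->
  (\forall x \near F, N x * c <= T x) -> (\forall x \near F, T x < (N x + 1) * c) ->
  1 <= c ->
  [/\ (Num.sqrt (N x))^-1 @[x --> F] --> (0 : R),
      \forall x \near F, 1 <= Num.sqrt (N x) &
      Num.sqrt (N x) / delta x @[x --> F] --> (0 : R)].
Proof.
move=> c0 d0 N0 Tinv T0 Td NT TN c1.
have Tbig : \forall x \near F, 2 * c <= T x.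
  have c20 : 0 < (2 * c)^-1 by rewrite invr_gt0 mulr_gt0.
  near=> x; have Tx : 0 < T x by near: x.
  rewrite -lef_pV2 ?posrE ?mulr_gt0 //; apply/ltW.
  by near: x; exact: (near_lt Tinv c20).
have N1 : \forall x \near F, 1 <= N x /\ (N x)^-1 <= 2 * c * (T x)^-1.
  near=> x.
  have h1 : 2 * c <= T x by near: x.
  have h2 : T x < (N x + 1) * c by near: x.
  have Nc : T x < 2 * c * N x by move: h1 h2; rewrite mulrDl mul1r; lra.
  have Tx : 0 < T x by near: x.
  have Nx : 1 <= N x.
    have : 2 * c < (N x + 1) * c by exact: le_lt_trans h1 h2.
    by rewrite ltr_pM2r //; lra.
  split => //; rewrite ler_pdivlMr // mulrC ler_pdivrMr ?(lt_le_trans ltr01) //.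
  exact: ltW.
have Ninv : (N x)^-1 @[x --> F] --> (0 : R).
  apply: (@cvg0_le _ _ F _ _ (fun x => 2 * c * (T x)^-1)).
    by apply: filterS N1 => x [_ h]; rewrite ger0_norm // invr_ge0.
  by rewrite -(mulr0 (2 * c)); apply: cvgM => //; exact: cvg_cst.
split.
- under eq_fun do rewrite -sqrtrV //.
  exact: sqrt_null.
- by apply: filterS N1 => x [Nx _]; rewrite -(sqrtr1 R) ler_wsqrtr.
apply: (@cvg0_le _ _ F _ _ (fun x => T x / delta x)) => //.
near=> x.
have [Nx _] : 1 <= N x /\ (N x)^-1 <= 2 * c * (T x)^-1 by near: x; exact: N1.
have NTx : N x * c <= T x by near: x.
rewrite ger0_norm ?divr_ge0 ?sqrtr_ge0 ?(ltW (d0 x)) //.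
rewrite ler_wpM2r ?invr_ge0 ?(ltW (d0 x)) //.
apply: (@le_trans _ _ (N x)).
  rewrite -[leRHS]sqr_sqrtr // expr2 ler_peMr ?sqrtr_ge0 //.
  by rewrite -(sqrtr1 R) ler_wsqrtr.
by apply: le_trans NTx; rewrite ler_peMr.
Unshelve. all: by end_near. Qed.

End powers_and_rates.

Section noisy_eigenvalues.
Context {R : realType} {U : Type} (F : set_system U) {FF : ProperFilter F}.
Context {r : nat} (hr : (0 < r)%N) (h : 'I_r -> R) (a : U -> R) (C : U -> 'M[R]_r)
  (Clim : 'M[R]_r).
Hypothesis a_ge1 : forall x, 1 <= a x.
Hypothesis h_sorted : forall i l : 'I_r, (i <= l)%N -> h i <= h l.
Hypothesis h_gt : - 1 / 2 < h (Ordinal hr).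
Hypothesis C_cvg : forall i l, C x i l @[x --> F] --> Clim i l.
Hypothesis Clim_unit : Clim \in unitmx.
Context (B : U -> 'M[R]_r) (Blim : 'M[R]_r) (s z : U -> R).
Hypothesis B_sym : forall x, (B x)^T = B x.
Hypothesis B_psd : forall x u, 0 <= qf (B x) u.
Hypothesis Blim_pd : pdmx Blim.
Hypothesis B_cvg : forall i l, B x i l @[x --> F] --> Blim i l.
Context (p : U -> nat) (Q : forall x, 'M[R]_(p x, r)) (W N : forall x, 'M[R]_(p x)).
Hypothesis rp : forall x, (r <= p x)%N.
Hypothesis Q_isometry : forall x, (Q x)^T *m Q x = 1%:M.
Hypothesis W_sym : forall x, (W x)^T = W x.
Hypothesis N_bounds : forall x u, 0 <= qf (N x) u <= z x * qf 1%:M u.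
Hypothesis W_forms : \forall x \near F, forall (eta : R) u, 0 < eta <= 1 ->
  let S := Q x *m graded h a C B x *m (Q x)^T in
  is_true ((1 - eta) * qf S u + (1 - eta^-1) * qf (N x) u <= qf (W x) u
    <= (1 + eta) * qf S u + (1 + eta^-1) * qf (N x) u).
Hypothesis z_ge0 : forall x, 0 <= z x.
Hypothesis z_bounded : null_multiplier F z.
Hypothesis s_ge1 : \forall x \near F, 1 <= s x.
Hypothesis s_rate : s x / scale h a x 0 (Ordinal hr) @[x --> F] --> (0 : R).

Local Notation eig x i := (eigenvalues (graded h a C B x))`_i.
Local Notation top x i := (eigenvalues (W x))`_(p x - r + i).

Lemma qf_graded_ge0 x u : 0 <= qf (graded h a C B x) u.
Proof.
rewrite (_ : graded h a C B x =
  (C x *m diag_mx (scale h a x)) *m B x *m (C x *m diag_mx (scale h a x))^T).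
  by rewrite qf_congr.
by rewrite /graded trmx_mul tr_diag_mx !mulmxA.
Qed.

Lemma eigenvalues_embedded x (i : 'I_r) :
  (eigenvalues (Q x *m graded h a C B x *m (Q x)^T))`_(p x - r + i) = eig x i.
Proof.
rewrite eigenvalues_isometry //; last exact: qf_graded_ge0.
  by rewrite nth_cat size_nseq ltnNge leq_addr /= addKn.
exact: graded_sym.
Qed.

(** The noise is of order one while the smallest signal eigenvalue is of order
    delta^2, delta being the smallest scale; weighing the cross terms with
    eta = 1 / delta makes all relative errors of order 1 / delta. *)
Lemma noisy_log_eigenvalue (i : 'I_r) :
  s x * (ln (top x i) - ln (eig x i)) @[x --> F] --> (0 : R) /\
  top x i / eig x i @[x --> F] --> (1 : R).
Proof.
have [c [K [c0 K0 cK]]] := graded_eigenvalues_order a_ge1 h_sorted C_cvg Clim_unit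
  B_sym Blim_pd B_cvg.
pose delta x := scale h a x 0 (Ordinal hr).
have delta_gt0 x : 0 < delta x by exact: scale_gt0.
have delta_ge1 x : 1 <= delta x.
  rewrite /delta mxE -[leLHS](powRr0 (a x)) ler_powR //.
  by move: h_gt; lra.
pose del x := (1 + 2 / c * z x) / delta x.
apply: (@log_ratio_null _ _ F _ _ _ _ del) => //.
- apply: filterS cK => x /(_ i)/andP[+ _]; apply: lt_le_trans.
  by rewrite mulr_gt0 // exprn_gt0 // scale_gt0.
- near=> x.
  have cKx : forall i : 'I_r, c * (scale h a x 0 i ^+ 2) <= eig x i
    <= K * (scale h a x 0 i ^+ 2) by near: x; exact: cK.
  have Wf : forall (eta : R) u, 0 < eta <= 1 ->
    let S := Q x *m graded h a C B x *m (Q x)^T in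
    is_true ((1 - eta) * qf S u + (1 - eta^-1) * qf (N x) u <= qf (W x) u
      <= (1 + eta) * qf S u + (1 + eta^-1) * qf (N x) u) by near: x; exact: W_forms.
  have ip : (p x - r + i < p x)%N by rewrite -{2}(subnK (rp x)) ltn_add2l.
  have eta01 : 0 < (delta x)^-1 <= 1.
    by rewrite invr_gt0 delta_gt0 invf_le1 // delta_ge1.
  have Ss : (Q x *m graded h a C B x *m (Q x)^T)^T =
      Q x *m graded h a C B x *m (Q x)^T.
    by rewrite 2!trmx_mul trmxK graded_sym // mulmxA.
  have := eigenvalues_noise_bounds (Ordinal ip) (W_sym x) Ss eta01 (@N_bounds x)
    (fun u => Wf _ u eta01).
  rewrite /= eigenvalues_embedded invrK.
  have mu_lo : c * delta x ^+ 2 <= eig x i.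
    have /andP[+ _] := cKx i; apply: le_trans; apply: (ler_wpM2l (ltW c0)).
    rewrite ler_sqr ?nnegrE; [exact: scale_le|exact/ltW/delta_gt0|].
    exact/ltW/scale_gt0.
  have mu0 : 0 < eig x i.
    by apply: lt_le_trans mu_lo; rewrite mulr_gt0 // exprn_gt0.
  have zd : z x * delta x <= z x / c / delta x * eig x i.
    apply: (@le_trans _ _ (z x / c / delta x * (c * delta x ^+ 2))).
      by rewrite le_eqVlt; apply/orP; left; apply/eqP; field; rewrite !gt_eqF.
    by rewrite ler_wpM2l // !divr_ge0 // ltW.
  have zd0 : 0 <= z x * delta x by rewrite mulr_ge0 // ltW.
  rewrite ler_distl ler_pdivlMr // ler_pdivrMr // /del.
  move: (eig x i) mu0 zd => mu mu0 zd.
  move: (top x i) => lam /andP[lo hi].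
  have E : (1 + 2 / c * z x) / delta x * mu =
     (delta x)^-1 * mu + 2 * (z x / c / delta x * mu) by ring.
  rewrite [X in X <= _ <= _]mulrBl [X in _ <= _ <= X]mulrDl E mul1r.
  move: lo hi; rewrite [X in X - _ <= _ -> _]mulrBl [X in _ -> _ <= X + _ -> _]mulrDl.
  by rewrite mul1r => lo hi; apply/andP; split; lra.
have E : (fun x => s x * del x) =
    fun x => s x / delta x + 2 / c * (z x * (s x / delta x)).
  by apply/funext => x; rewrite /del; ring.
rewrite E -[X in _ --> X](addr0 0) -[X in _ --> _ + X](mulr0 (2 / c)).
apply: cvgD => //; apply: cvgM; first exact: cvg_cst.
exact: z_bounded.
Unshelve. all: by end_near. Qed.

End noisy_eigenvalues.

(** * One octave *)

Section signal_part.
Context {R : realType}.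

Lemma congr_sym m n (A : 'M[R]_(m, n)) (M : 'M[R]_n) :
  M^T = M -> (A *m M *m A^T)^T = A *m M *m A^T.
Proof. by move=> Ms; rewrite !trmx_mul trmxK Ms mulmxA. Qed.

(** For e 0 i = a `^ (h i + 1 / 2) and H = PH diag(h) PH^-1 this is
    PH^-1 a^(- H - 1 / 2). *)
Definition whitening r (PH : 'M[R]_r) (e : 'rV[R]_r) : 'M[R]_r :=
  diag_mx (\row_i (e 0 i)^-1) *m invmx PH.

(** With E = diag e and A the whitening matrix, E A = PH^-1 and hence
    P = Q C E A. *)
Lemma signal_factorization p r (P Q : 'M[R]_(p, r)) (PH C M : 'M[R]_r) (e : 'rV[R]_r) :
  PH \in unitmx -> P *m PH = Q *m C -> (forall i, e 0 i != 0) ->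
  P *m M *m P^T =
  Q *m (C *m diag_mx e *m (whitening PH e *m M *m (whitening PH e)^T)
          *m diag_mx e *m C^T) *m Q^T.
Proof.
move=> PHu PQ e0; set A := whitening PH e.
have EA : diag_mx e *m A = invmx PH.
  rewrite /A /whitening mulmxA mulmx_diag (_ : \row_j _ = const_mx 1).
    by rewrite diag_const_mx mul1mx.
  by apply/rowP => i; rewrite !mxE divff.
have PE : P = Q *m C *m diag_mx e *m A by rewrite -mulmxA EA -PQ mulmxK.
by rewrite [in LHS]PE; move: A {EA PE} => A; rewrite !trmx_mul tr_diag_mx !mulmxA.
Qed.

(** The right factor uses that the transpose of H is diagonalized by the inverse
    of the transpose of PH. *)
Lemma whitening_powmx r (PH : 'M[R]_r) (h : 'I_r -> R) (c : R) (M : 'M[R]_r) :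
  0 < c -> PH \in unitmx ->
  let H := PH *m diag_mx (\row_i h i) *m invmx PH in
  let e := \row_i (c `^ (h i + 1 / 2)) in
  invmx PH *m powmx c (- H - (1 / 2)%:M) *m M *m powmx c (- H^T - (1 / 2)%:M)
    *m invmx PH^T = whitening PH e *m M *m (whitening PH e)^T.
Proof.
move=> c0 PHu H e.
have PHtu : invmx PH^T \in unitmx by rewrite unitmx_inv unitmx_tr.
have HT : H^T = invmx PH^T *m diag_mx (\row_i h i) *m invmx (invmx PH^T).
  by rewrite /H !trmx_mul tr_diag_mx trmx_inv invmxK mulmxA.
rewrite HT !powmx_conj // invmxK !mulmxA mulVmx // mul1mx /whitening.
have -> : \row_i (e 0 i)^-1 = \row_i (c `^ (h i + 1 / 2))^-1.
  by apply/rowP => i; rewrite !mxE.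
rewrite trmx_mul tr_diag_mx -trmx_inv !mulmxA.
by rewrite -[_ *m PH^T *m (invmx PH)^T]mulmxA -trmx_mul mulVmx // trmx1 mulmx1.
Qed.

End signal_part.

Lemma cvg0_telescope {R : realType} {U : Type} (F : set_system U) {FF : ProperFilter F}
    (s l1 m1 l2 m2 v : U -> R) :
  s x * (l1 x - m1 x) @[x --> F] --> (0 : R) -> s x * (l2 x - m2 x) @[x --> F] --> (0 : R) ->
  s x * (m1 x - m2 x) - v x @[x --> F] --> (0 : R) ->
  s x * (l1 x - l2 x) - v x @[x --> F] --> (0 : R).
Proof.
move=> h1 h2 h3; have : s x * (m1 x - m2 x) - v x + s x * (l1 x - m1 x)
    - s x * (l2 x - m2 x) @[x --> F] --> (0 : R).
  rewrite -[X in _ --> X](subr0 0) -[X in _ --> X - _](addr0 0).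
  by apply: cvgB => //; apply: cvgD.
by apply: cvg_eq_near; apply: nearW => x; ring.
Qed.

Lemma top_index_lt p r (i : 'I_r) : (r <= p)%N -> (p - r + i < p)%N.
Proof. by move=> rp; rewrite -[ltnRHS](subnK rp) ltn_add2l. Qed.

Lemma measurable_eigenvalue {R : realType} d (T : measurableType d) n
    (M : T -> 'M[R]_n) (i : 'I_n) : (forall w, (M w)^T = M w) -> measurable_mx M ->
  measurable_fun setT (fun w => (eigenvalues (M w))`_i).
Proof.
move=> Ms mM.
have -> : (fun w => (eigenvalues (M w))`_i) =
    (fun A : 'M[R]_n => (eigenvalues (2^-1 *: (A + A^T)))`_i) \o M.
  have half : 2^-1 * 2%:R = 1 :> R by rewrite mulVf ?pnatr_eq0.
  by apply/funext => w /=; rewrite Ms -mulr2n -[M w *+ 2]scaler_nat scalerA half scale1r.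
by apply: measurable_continuous_mx => //; exact: eigenvalue_sym_part_continuous.
Qed.

Section one_octave.
Context {R : realType} {d} {T : measurableType d} (Pr : probability T R).
Context {r : nat} (hr : (0 < r)%N) (h : 'I_r -> R) (p : nat -> nat) (a : nat -> R)
  (N : nat -> nat) (P Q : forall n, 'M[R]_(p n, r)) (PH : 'M[R]_r)
  (C : nat -> 'M[R]_r) (Clim : 'M[R]_r).
Context (x : nat -> nat -> T -> 'cV[R]_r) (z : forall n, nat -> T -> 'cV[R]_(p n)).
Context (W WZ : forall n, T -> 'M[R]_(p n)) (WX : nat -> T -> 'M[R]_r)
  (WXZ : forall n, T -> 'M[R]_(r, p n)).
Context (Blim : 'M[R]_r) (xi : 'I_r -> R).

Local Notation s n := (Num.sqrt (N n)%:R : R).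
Local Notation A n := (whitening PH (scale h a n)).
Local Notation Bhat n w := (A n *m WX n w *m (A n)^T).
Local Notation Ba n := (Emx Pr (fun w => Bhat n w)).
Local Notation top n M i := (eigenvalues M)`_(p n - r + i).

Hypothesis rp : forall n, (r <= p n)%N.
Hypothesis a_ge1 : forall n, 1 <= a n.
Hypothesis h_sorted : forall i l : 'I_r, (i <= l)%N -> h i <= h l.
Hypothesis h_gt : - 1 / 2 < h (Ordinal hr).
Hypothesis PH_unit : PH \in unitmx.
Hypothesis P_factor : forall n, P n *m PH = Q n *m C n.
Hypothesis Q_isometry : forall n, (Q n)^T *m Q n = 1%:M.
Hypothesis C_cvg : forall i l, C n i l @[n --> \oo] --> Clim i l.
Hypothesis Clim_unit : Clim \in unitmx.
Hypothesis WXE : forall n w,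
  WX n w = (N n)%:R^-1 *: \sum_(1 <= k < (N n).+1) x n k w *m (x n k w)^T.
Hypothesis WZE : forall n w,
  WZ n w = (N n)%:R^-1 *: \sum_(1 <= k < (N n).+1) z n k w *m (z n k w)^T.
Hypothesis WXZE : forall n w,
  WXZ n w = (N n)%:R^-1 *: \sum_(1 <= k < (N n).+1) x n k w *m (z n k w)^T.
Hypothesis W_sym : forall n w, (W n w)^T = W n w.
Hypothesis W_decomposition : forall n, {ae Pr, forall w,
  W n w = P n *m WX n w *m (P n)^T + WZ n w + P n *m WXZ n w + (WXZ n w)^T *m (P n)^T}.
Hypothesis W_integrable : forall n, integrable_mx Pr (W n).
Hypothesis WX_integrable : forall n, integrable_mx Pr (WX n).
Hypothesis WZ_integrable : forall n, integrable_mx Pr (WZ n).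
Hypothesis WXZ_integrable : forall n, integrable_mx Pr (WXZ n).
Hypothesis WXZ_centered : forall n, Emx Pr (WXZ n) = 0.
Hypothesis WZ_tight : bounded_in_prob Pr (fun n w => spectral_norm (WZ n w)).
Hypothesis EWZ_bounded : exists K : R, \forall n \near \oo,
  spectral_norm (Emx Pr (WZ n)) <= K.
Hypothesis Blim_pd : pdmx Blim.
Hypothesis Ba_cvg : forall i l, Ba n i l @[n --> \oo] --> Blim i l.
Hypothesis dev_tight : forall i l,
  bounded_in_prob Pr (fun n w => s n * (Bhat n w - Ba n) i l).
Hypothesis a_infty : (a n)^-1 @[n --> \oo] --> (0 : R).
Hypothesis s_inv_cvg : (s n)^-1 @[n --> \oo] --> (0 : R).
Hypothesis s_ge1 : \forall n \near \oo, 1 <= s n.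
Hypothesis s_rate : s n / scale h a n 0 (Ordinal hr) @[n --> \oo] --> (0 : R).
Hypothesis xi_cvg : forall i : 'I_r, cvg_in_prob Pr
  (fun n w => top n (W n w) i / a n `^ (2 * h i + 1)) (xi i).
Hypothesis xi_distinct : forall i l : 'I_r, i != l -> h i = h l -> xi i != xi l.

Local Notation F := (whp Pr).

Let measurable_top n (i : 'I_r) : measurable_fun setT (fun w => top n (W n w) i).
Proof.
apply: (measurable_eigenvalue (Ordinal (top_index_lt i (rp n)))) => //.
exact: integrable_mx_measurable.
Qed.

Let N_inv_ge0 n : 0 <= (N n)%:R^-1 :> R.
Proof. by rewrite invr_ge0. Qed.

Let WX_ge0 n w u : 0 <= qf (WX n w) u.
Proof. by rewrite WXE; exact: gram_sum_ge0. Qed.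

Let WZ_ge0 n w u : 0 <= qf (WZ n w) u.
Proof. by rewrite WZE; exact: gram_sum_ge0. Qed.

Let Bhat_sym n w : (Bhat n w)^T = Bhat n w.
Proof. by apply: congr_sym; rewrite WXE gram_sum_tr. Qed.

Let Bhat_integrable n : integrable_mx Pr (fun w => Bhat n w).
Proof. exact: integrable_mulmx. Qed.

Let Ba_sym n : (Ba n)^T = Ba n.
Proof. by rewrite -Emx_tr; congr Emx; apply/funext => w; exact: Bhat_sym. Qed.

Let C_cvg_whp i l : C y.1 i l @[y --> F] --> Clim i l.
Proof. exact: (@cvg_det_whp _ _ _ Pr (fun n => C n i l)). Qed.

Let Ba_cvg_whp i l : (Ba y.1) i l @[y --> F] --> Blim i l.
Proof. exact: (@cvg_det_whp _ _ _ Pr (fun n => (Ba n) i l)). Qed.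

Let s_rate_whp : s y.1 / scale h (fun y : nat * T => a y.1) y 0 (Ordinal hr)
  @[y --> F] --> (0 : R).
Proof. exact: (@cvg_det_whp _ _ _ Pr (fun n => s n / scale h a n 0 (Ordinal hr))). Qed.

Let s_inv_whp : (s y.1)^-1 @[y --> F] --> (0 : R).
Proof. exact: (@cvg_det_whp _ _ _ Pr (fun n => (s n)^-1)). Qed.

Let s_ge1_whp : \forall y \near F, 1 <= s y.1.
Proof. exact: (@near_whp_fst _ _ _ Pr (fun n => 1 <= s n)). Qed.

Let dev_whp i l : null_multiplier F (fun y => s y.1 * (Bhat y.1 y.2 - Ba y.1) i l).
Proof.
move=> g g0; apply: (bounded_in_prob_mul_cvg0 _ (@dev_tight i l) g0) => n.
apply: measurable_funM => //; under eq_fun do rewrite mxE.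
apply: measurable_funD => //.
exact: integrable_mx_measurable (Bhat_integrable n) i l.
Qed.

Let Bhat_cvg i l : Bhat y.1 y.2 i l @[y --> F] --> Blim i l.
Proof. exact: (perturbed_cvg Ba_cvg_whp s_inv_whp s_ge1_whp dev_whp). Qed.

Let WZ_whp : null_multiplier F (fun y => spectral_norm (WZ y.1 y.2)).
Proof.
move=> g g0; apply: (bounded_in_prob_mul_cvg0 _ WZ_tight g0) => n.
apply: measurable_continuous_mx; first exact: spectral_norm_continuous.
exact: integrable_mx_measurable.
Qed.

Let EWZ_whp : null_multiplier F (fun y => spectral_norm (Emx Pr (WZ y.1))).
Proof.
have [K hK] := EWZ_bounded; apply: (@null_multiplier_near_bounded _ _ F _ _ K).
apply: (@filterS _ F _ _ _ _ (@near_whp_fst _ _ _ Pr (fun n => spectral_norm (Emx Pr (WZ n)) <= K) hK)) => y.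
by rewrite ger0_norm // spectral_norm_ge0.
Qed.

Let signal n M : P n *m M *m (P n)^T =
  Q n *m (C n *m diag_mx (scale h a n) *m (A n *m M *m (A n)^T)
    *m diag_mx (scale h a n) *m (C n)^T) *m (Q n)^T.
Proof.
apply: signal_factorization => // i.
by rewrite gt_eqF // mxE powR_gt0 // (lt_le_trans ltr01).
Qed.

Local Notation sample y :=
  (graded h (fun y : nat * T => a y.1) (fun y => C y.1) (fun y => Bhat y.1 y.2) y).
Local Notation mean y :=
  (graded h (fun y : nat * T => a y.1) (fun y => C y.1) (fun y => Ba y.1) y).

Let sample_noise (i : 'I_r) : s y.1 * (ln (top y.1 (W y.1 y.2) i) - ln (eigenvalues (sample y))`_i)
    @[y --> F] --> (0 : R) /\
  top y.1 (W y.1 y.2) i / (eigenvalues (sample y))`_i @[y --> F] --> (1 : R).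
Proof.
apply: (@noisy_log_eigenvalue _ _ F _ _ hr h (fun y => a y.1) (fun y => C y.1) Clim
  _ h_sorted h_gt C_cvg_whp Clim_unit (fun y => Bhat y.1 y.2) Blim (fun y => s y.1)
  (fun y => spectral_norm (WZ y.1 y.2)) _ _ Blim_pd Bhat_cvg (fun y => p y.1)
  (fun y => Q y.1) (fun y => W y.1 y.2) (fun y => WZ y.1 y.2)) => //.
- by move=> y u; rewrite qf_congr; exact: WX_ge0.
- by move=> y u; rewrite WZ_ge0 qf_le_spectral_norm.
- apply: (@filterS _ F _ _ _ _ (ae_whp W_decomposition)) => y WE eta u /andP[e0 e1].
  rewrite WE -signal.
  exact: (signal_plus_noise_forms _ _ (N_inv_ge0 y.1) e0 (WXE _ _) (WZE _ _) (WXZE _ _)).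
- by move=> y; exact: spectral_norm_ge0.
Qed.

Let EW_decomposition n :
  Emx Pr (W n) = P n *m Emx Pr (WX n) *m (P n)^T + Emx Pr (WZ n).
Proof.
have iX := integrable_mulmx (P n) (P n)^T (@WX_integrable n).
have iXZ := integrable_mulmx (P n) (1%:M : 'M[R]_(p n)) (@WXZ_integrable n).
have iZX := integrable_mulmx (1%:M : 'M[R]_(p n)) (P n)^T (integrable_mx_tr (@WXZ_integrable n)).
have iXN := integrable_mxD iX (@WZ_integrable n).
have iXNX := integrable_mxD iXN iXZ.
rewrite (Emx_ae_eq (@W_integrable n) (integrable_mxD iXNX iZX)); last first.
  apply: filterS (W_decomposition n) => w ->.
  by rewrite mulmx1 mul1mx.
rewrite !EmxD // !Emx_mulmx // ?WXZ_centered //; last exact: integrable_mx_tr.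
by rewrite Emx_tr WXZ_centered trmx0 mulmx0 mulmx0 mul0mx mul0mx !addr0.
Qed.

Let mean_noise (i : 'I_r) : s y.1 * (ln (top y.1 (Emx Pr (W y.1)) i) - ln (eigenvalues (mean y))`_i)
    @[y --> F] --> (0 : R) /\
  top y.1 (Emx Pr (W y.1)) i / (eigenvalues (mean y))`_i @[y --> F] --> (1 : R).
Proof.
have EWZ_ge0 n u : 0 <= qf (Emx Pr (WZ n)) u by apply: Emx_qf_ge0.
apply: (@noisy_log_eigenvalue _ _ F _ _ hr h (fun y => a y.1) (fun y => C y.1) Clim
  _ h_sorted h_gt C_cvg_whp Clim_unit (fun y => Ba y.1) Blim (fun y => s y.1)
  (fun y => spectral_norm (Emx Pr (WZ y.1))) _ _ Blim_pd Ba_cvg_whp (fun y => p y.1)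
  (fun y => Q y.1) (fun y => Emx Pr (W y.1)) (fun y => Emx Pr (WZ y.1))) => //.
- move=> y u; apply: Emx_qf_ge0 => // w v.
  by rewrite qf_congr; exact: WX_ge0.
- by move=> y; rewrite -Emx_tr; congr Emx; apply/funext => w.
- by move=> y u; rewrite EWZ_ge0 qf_le_spectral_norm.
- apply: nearW => y eta u /andP[e0 e1] /=.
  (* The cross terms are centered, so the form of the mean of W is that of its
     signal part plus that of the mean noise. *)
  have SE : Q y.1 *m mean y *m (Q y.1)^T = P y.1 *m Emx Pr (WX y.1) *m (P y.1)^T.
    by rewrite signal -(Emx_mulmx _ _ (@WX_integrable y.1)).
  have z0 := EWZ_ge0 y.1 u.
  have S0 : 0 <= qf (P y.1 *m Emx Pr (WX y.1) *m (P y.1)^T) u.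
    by rewrite qf_congr; exact: Emx_qf_ge0.
  rewrite SE EW_decomposition; move: S0; set S := P _ *m _ *m _ => S0.
  have i0 : 0 <= (eta^-1 - 1) * qf (Emx Pr (WZ y.1)) u.
    by rewrite mulr_ge0 // subr_ge0 -invf_le1 ?invrK // invr_gt0.
  have j0 := mulr_ge0 (ltW e0) S0.
  have k0 : 0 <= eta^-1 * qf (Emx Pr (WZ y.1)) u by rewrite mulr_ge0 // invr_ge0 ltW.
  rewrite qfD !mulrDl !mulNr !mul1r; move: i0; rewrite mulrBl mul1r.
  by move=> i0; apply/andP; split; lra.
- by move=> y; exact: spectral_norm_ge0.
Qed.

(** The top eigenvalues of W and of its mean are replaced by those of the two
    graded matrices at a cost of smaller order than 1 / s, and the logarithms of
    the latter are linearized.  The limits xi, given for the eigenvalues of W,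
    are those of the graded matrix since the ratios tend to one. *)
Lemma top_log_eigenvalue_linearization (q : 'I_r) : exists g : 'M[R]_r,
  s y.1 * (ln (top y.1 (W y.1 y.2) q) - ln (top y.1 (Emx Pr (W y.1)) q)) -
    \sum_i \sum_l g i l * (s y.1 * (Bhat y.1 y.2 - Ba y.1) i l) @[y --> F] --> (0 : R).
Proof.
have scale2 n (i : 'I_r) : scale h a n 0 i ^+ 2 = a n `^ (2 * h i + 1).
  rewrite mxE -powR_mulrn ?powR_ge0 // -powRrM; congr (_ `^ _); by field.
have topW (i : 'I_r) : top y.1 (W y.1 y.2) i / (scale h (fun y : nat * T => a y.1) y 0 i ^+ 2)
    @[y --> F] --> xi i.
  under eq_fun do rewrite [scale _ _ _ _ _ ^+ 2]scale2.
  apply: cvg_in_prob_whp (@xi_cvg i) => n.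
  by apply: measurable_funM => //; exact: measurable_top.
have a1 (y : nat * T) : 1 <= a y.1 by [].
have xi_sample (i : 'I_r) : (eigenvalues (sample y))`_i /
    (scale h (fun y : nat * T => a y.1) y 0 i ^+ 2) @[y --> F] --> xi i.
  have [_ ratio] := sample_noise i.
  apply: (cvg_div1 (topW i)).
    apply: cvg_eq_near ratio; apply: nearW => y.
    by rewrite -mulf_div divff ?mulr1 // invr_neq0 // expf_neq0 // gt_eqF // scale_gt0.
  have e2 : \forall y \near F, 1 / 2 < top y.1 (W y.1 y.2) i / (eigenvalues (sample y))`_i.
    by apply: (near_gt ratio); lra.
  apply: (@filterS _ F _ _ _ _ e2) => y {}e2; rewrite mulf_neq0 //.
    by apply: contraTneq e2 => ->; rewrite mul0r -leNgt; lra.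
  by rewrite invr_neq0 // expf_neq0 // gt_eqF // scale_gt0.
have a_inv : (a y.1)^-1 @[y --> F] --> (0 : R).
  exact: (@cvg_det_whp _ _ _ Pr (fun n => (a n)^-1)).
have [g gl] := log_eigenvalue_linearization a1 a_inv h_sorted C_cvg_whp Clim_unit
  (fun y => Bhat_sym y.1 y.2) (fun y => Ba_sym y.1) Blim_pd Ba_cvg_whp s_inv_whp
  s_ge1_whp dev_whp xi_sample xi_distinct q.
exists g; have [n1 _] := sample_noise q; have [n2 _] := mean_noise q.
exact: (cvg0_telescope n1 n2 gl).
Qed.

End one_octave.

(** * The joint central limit theorem *)

Lemma mx_subE {R : realType} m n (M N : 'M[R]_(m, n)) i l :
  (M - N) i l = M i l - N i l.
Proof. by rewrite !mxE. Qed.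

Lemma spectral_norm_cvg_entries {R : realType} m n (M : nat -> 'M[R]_(m, n)) A i l :
  spectral_norm (M k - A) @[k --> \oo] --> (0 : R) ->
  M k i l @[k --> \oo] --> A i l.
Proof.
move=> /cvgrPdist_le M0; apply/cvgrPdist_le => e /M0.
apply: filterS => k; rewrite sub0r normrN => Me.
rewrite distrC -mx_subE; apply: le_trans (entry_le_spectral_norm _ _ _) _.
exact: le_trans (ler_norm _) Me.
Qed.

Section sampling_rates.
Context {R : realType}.

(** With t = n / a(n), the rate condition says that 1 / t and
    n / a(n)^(h1 + 3 / 2) = t / a(n)^(h1 + 1 / 2) tend to zero.  Their product
    is a negative power of a(n), which therefore tends to infinity. *)
Lemma sampling_rates (b : nat -> nat) (j : nat) (h1 : R) :
  let a n := 2 ^+ b n : R in let s n := Num.sqrt (navail n (b n + j))%:R : R in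
  - 1 / 2 < h1 ->
  a n / n%:R + n%:R / a n `^ (h1 + 3 / 2) @[n --> \oo] --> (0 : R) ->
  [/\ (a n)^-1 @[n --> \oo] --> (0 : R), (s n)^-1 @[n --> \oo] --> (0 : R),
      \forall n \near \oo, 1 <= s n &
      s n / a n `^ (h1 + 1 / 2) @[n --> \oo] --> (0 : R)].
Proof.
move=> a s h1_gt rate.
have a0 n : 0 < a n by rewrite exprn_gt0.
have k0 : 0 < h1 + 1 / 2 by lra.
pose t n := n%:R / a n; pose del n := a n `^ (h1 + 1 / 2).
have del0 n : 0 < del n by rewrite powR_gt0.
have tdelE n : t n / del n = n%:R / a n `^ (h1 + 3 / 2).
  rewrite /t /del -mulrA -invfM; congr (_ / _).
  rewrite -{1}(powRr1 (ltW (a0 n))) -powRD; last by rewrite (gt_eqF (a0 n)) implybT.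
  by congr (_ `^ _); field.
have tinv : (t n)^-1 @[n --> \oo] --> (0 : R).
  apply: cvg0_le rate; apply: nearW => n; rewrite invf_div ger0_norm.
    by rewrite lerDl divr_ge0 // powR_ge0.
  by rewrite divr_ge0 // ltW.
have tdel : t n / del n @[n --> \oo] --> (0 : R).
  apply: cvg0_le rate; apply: nearW => n; rewrite tdelE ger0_norm.
    by rewrite lerDr divr_ge0 // ltW.
  by rewrite divr_ge0 // powR_ge0.
have t0 : \forall n \near \oo, 0 < t n.
  by near=> n; rewrite divr_gt0 // ltr0n; near: n; exact: nbhs_infty_gt.
have cardE n : (2 ^ (b n + j))%:R = 2 ^+ j * a n :> R.
  by rewrite expnD natrM !natrX mulrC.
have N_le n : (navail n (b n + j))%:R * 2 ^+ j <= t n.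
  by rewrite ler_pdivlMr // -mulrA -cardE -natrM ler_nat leq_divM.
have N_gt n : t n < ((navail n (b n + j))%:R + 1) * 2 ^+ j.
  rewrite ltr_pdivrMr // -mulrA -cardE natr1 -natrM ltr_nat.
  by apply: ltn_ceil; rewrite expn_gt0.
have c1 : 1 <= 2 ^+ j :> R by rewrite exprn_ege1 // ler1n.
have [s_inv s1 s_del] := sample_size_rates (lt_le_trans ltr01 c1) del0
  (fun n => ler0n _ (navail n (b n + j))) tinv t0 tdel (@nearW _ \oo _ _ N_le)
  (@nearW _ \oo _ _ N_gt) c1.
split => //.
have del_inv : (del n)^-1 @[n --> \oo] --> (0 : R).
  rewrite -(mulr0 0); apply: (@cvg_eq_near _ _ \oo _ _ (fun n => t n / del n * (t n)^-1)).
    by apply: filterS t0 => n tn; rewrite mulrAC divff ?mul1r // gt_eqF.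
  exact: cvgM.
apply: (@cvg_eq_near _ _ \oo _ _ (fun n => (del n)^-1 `^ (h1 + 1 / 2)^-1)).
  apply: nearW => n; rewrite -powRN -powRrM mulNr divff ?gt_eqF //.
  by rewrite powR_inv1 // ltW.
apply: powR_null del_inv; first by rewrite invr_gt0.
by move=> n; rewrite invr_ge0 ltW.
Unshelve. all: by end_near.
Qed.

End sampling_rates.

Section delta_method.
Context {R : realType} {d} {T : measurableType d} (P : probability T R).

Lemma gaussian_limit_tight N (V : nat -> T -> 'rV[R]_N) (S : 'M[R]_N) e :
  (forall n, measurable_mx (V n)) -> cvg_to_gaussian P V S ->
  bounded_in_prob P (fun n w => V n w 0 e).
Proof.
by move=> mV [d' [T' [Q [G [[mG _] VG]]]]]; exact: tight_entry VG.
Qed.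

(** The rows of coefficients c, one for each coordinate of Y, form the matrix of
    a linear map that carries the limit of V to that of Y. *)
Lemma gaussian_limit_linearization N M (V : nat -> T -> 'rV[R]_N)
    (Y : nat -> T -> 'rV[R]_M) (S : 'M[R]_N) :
  (forall n, measurable_mx (V n)) -> (forall n, measurable_mx (Y n)) ->
  psdmx S -> cvg_to_gaussian P V S ->
  (forall e, exists c : 'I_N -> R,
     Y x.1 x.2 0 e - \sum_i c i * V x.1 x.2 0 i @[x --> whp P] --> (0 : R)) ->
  exists2 S', psdmx S' & cvg_to_gaussian P Y S'.
Proof.
move=> mV mY psdS [d' [T' [Q [G [GS VG]]]]] lin.
have [c hc] := choice lin.
pose C : 'M[R]_(N, M) := \matrix_(i, e) c e i.
exists (C^T *m S *m C); first exact: psdmx_congr.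
exists d', T', Q, (fun w => G w *m C); split; first exact: gaussian_vector_mulr.
apply: (@slutsky _ _ _ _ _ _ _ _ (fun n w => V n w *m C)) => //.
- by move=> n; exact: measurable_mx_mulr.
- by have [mG _] := GS; exact: measurable_mx_mulr.
- exact: cvg_in_distr_comp.
move=> e; apply: (@cvg_eq_near _ _ _ (whp_proper P)) (hc e).
apply: (@nearW _ (whp P)) => x; rewrite mxE; congr (_ - _).
by apply: eq_bigr => i _; rewrite mxE mulrC.
Qed.

End delta_method.

Theorem theorem3p2 (R : realType)
  (d : measure_display) (T : measurableType d) (Pr : probability T R)
  (phi psi : R -> R) (Npsi : nat) (alpha : R)
  (hmra : mra_wavelet phi psi)
  (hNpsi : (1 <= Npsi)%N)
  (W1 : vanishing_moments psi Npsi)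
  (W2 : L1_compact_support phi psi)
  (halpha : 1 < alpha)
  (W3 : fourier_decay psi alpha)
  (* dimensions, dyadic scales a(n) = 2 ^ b(n), octaves j_1 < ... < j_m *)
  (r : nat) (hr : (0 < r)%N) (p : nat -> nat) (hp : forall n, (r <= p n)%N)
  (b : nat -> nat) (a := fun n : nat => 2 ^+ b n : R)
  (m : nat) (hm : (0 < m)%N) (j : 'I_m -> nat)
  (hj : forall k l : 'I_m, (k < l)%N -> (j k < j l)%N)
  (X : int -> T -> 'cV[R]_r)
  (Y Z : forall n : nat, int -> T -> 'cV[R]_(p n))
  (P : forall n : nat, 'M[R]_(p n, r))
  (hX : forall t, measurable_mx (X t))
  (hY : forall n t, measurable_mx (Y n t))
  (hZ : forall n t, measurable_mx (Z n t))
  (hP : forall n l, euclid_norm (col l (P n)) = 1)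
  (hobs : forall (n : nat) (t : int), 1 <= t <= n%:Z ->
    forall w, Y n t w = P n *m X t w + Z n t w)
  (* sample wavelet covariances at scale a(n) 2 ^ j_k *)
  (nav := fun (n : nat) (k : 'I_m) => navail n (b n + j k))
  (W := fun (n : nat) (k : 'I_m) => wcov phi psi (Y n) (Y n) n (b n + j k))
  (WX := fun (n : nat) (k : 'I_m) => wcov phi psi X X n (b n + j k))
  (WZ := fun (n : nat) (k : 'I_m) => wcov phi psi (Z n) (Z n) n (b n + j k))
  (WXZ := fun (n : nat) (k : 'I_m) => wcov phi psi X (Z n) n (b n + j k))
  (PH : 'M[R]_r) (hPH : PH \in unitmx) (h : 'I_r -> R)
  (h1 := h (Ordinal hr))
  (hh1 : - 1 / 2 < h1)
  (hh : forall i l : 'I_r, (i <= l)%N -> h i <= h l)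
  (H := PH *m diag_mx (\row_i h i) *m invmx PH)
  (Bhat := fun (n : nat) (k : 'I_m) (w : T) =>
    invmx PH *m powmx (a n) (- H - (1 / 2)%:M) *m WX n k w
      *m powmx (a n) (- H^T - (1 / 2)%:M) *m invmx PH^T)
  (Ba := fun (n : nat) (k : 'I_m) => Emx Pr (Bhat n k))
  (A1_decomposition : forall n k, {ae Pr, forall w,
    W n k w = P n *m WX n k w *m (P n)^T + WZ n k w
              + P n *m WXZ n k w + (WXZ n k w)^T *m (P n)^T})
  (A1_moments : forall n k, [/\ all_moments Pr (W n k), all_moments Pr (WX n k),
    all_moments Pr (WZ n k) & all_moments Pr (WXZ n k)])
  (A1_centered : forall n k, Emx Pr (WXZ n k) = 0)
  (A2_prob : forall k, bounded_in_prob Pr (fun n w => spectral_norm (WZ n k w)))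
  (A2_mean : forall k,
    (fun n => spectral_norm (Emx Pr (WZ n k))) =O_\oo (fun=> 1 : R))
  (SigmaB : 'M[R]_(m * #|lower_index r|)) (hSigmaB : psdmx SigmaB)
  (A3_clt : cvg_to_gaussian Pr
    (fun n w => mxvec (\matrix_(k < m, s < #|lower_index r|)
      (Num.sqrt (nav n k)%:R * (vecS (Bhat n k w) - vecS (Ba n k)) 0 s)))
    SigmaB)
  (B : 'I_m -> 'M[R]_r) (hB : forall k, pdmx (B k))
  (A3_mean : forall k, spectral_norm (Ba n k - B k) @[n --> \oo] --> (0 : R))
  (A4_scale : \forall n \near \oo, a n <= n%:R / 2 ^+ (\max_(k < m) j k)%N)
  (A4_rate : a n / n%:R + n%:R / a n `^ (h1 + 3 / 2) @[n --> \oo] --> (0 : R))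
  (A4_dim : (fun n => (p n)%:R / (n%:R / a n)) =O_\oo (fun=> 1 : R))
  (Q : forall n : nat, 'M[R]_(p n, r)) (Rn : nat -> 'M[R]_r) (A Rlim : 'M[R]_r)
  (A5_QR : forall n, is_QR (P n *m PH) (Q n) (Rn n))
  (A5_posdef : pdmx A)
  (A5_cholesky : is_cholesky A Rlim)
  (A5_cvg : spectral_norm (Rn n - Rlim) @[n --> \oo] --> (0 : R))
  (* the functions xi_q; [xi q i] stands for xi_q(2 ^ i) *)
  (xi : 'I_r -> nat -> R)
  (hxi : forall (q : 'I_r) (k : 'I_m),
    cvg_in_prob Pr
      (fun n w => lambda (p n - r + q.+1) (W n k w) / a n `^ (2 * h q + 1))
      (xi q (j k)))
  (hxi_scaling : forall (q : 'I_r) (k : 'I_m),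
    xi q (j k) = 2 `^ ((j k)%:R * (2 * h q + 1)) * xi q 0%N)
  (hxi_distinct : forall l1 l2 : 'I_r, l1 != l2 -> h l1 = h l2 ->
    xi l1 0%N != xi l2 0%N) :
  exists2 Sigma : 'M[R]_(m * r), psdmx Sigma &
    cvg_to_gaussian Pr
      (fun n w => mxvec (\matrix_(k < m, q < r)
        (Num.sqrt (nav n k)%:R *
          (ln (lambda (p n - r + q.+1) (W n k w)) -
           ln (lambda (p n - r + q.+1) (Emx Pr (W n k)))))))
      Sigma.
Proof.
have a_ge1 n : 1 <= a n by rewrite exprn_ege1 // ler1n.
have a_gt0 n : 0 < a n by exact: lt_le_trans (a_ge1 n).
have W_sym n k w : (W n k w)^T = W n k w by exact: gram_sum_tr.
have WX_sym n k w : (WX n k w)^T = WX n k w by exact: gram_sum_tr.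
have iW n k : integrable_mx Pr (W n k).
  by have [? _ _ _] := A1_moments n k; exact: all_moments_integrable.
have iWX n k : integrable_mx Pr (WX n k).
  by have [_ ? _ _] := A1_moments n k; exact: all_moments_integrable.
have iWZ n k : integrable_mx Pr (WZ n k).
  by have [_ _ ? _] := A1_moments n k; exact: all_moments_integrable.
have iWXZ n k : integrable_mx Pr (WXZ n k).
  by have [_ _ _ ?] := A1_moments n k; exact: all_moments_integrable.
pose D n := whitening PH (scale h a n).
have BhatE n k : Bhat n k = fun w => D n *m WX n k w *m (D n)^T.
  by apply/funext => w; exact: whitening_powmx.
have iBhat n k : integrable_mx Pr (Bhat n k) by rewrite BhatE; exact: integrable_mulmx.
have Bhat_sym n k w : (Bhat n k w)^T = Bhat n k w.
  by rewrite BhatE; exact: congr_sym.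
have Ba_sym n k : (Ba n k)^T = Ba n k.
  by rewrite -Emx_tr; congr Emx; apply/funext => w; exact: Bhat_sym.
(* The entries of the given asymptotically Gaussian vector are, up to sg, those
   of the normalized deviations of Bhat. *)
have [sg sgE] := @vecS_entry R r.
set V := (fun n w => mxvec _) in A3_clt.
have VE n w k s : V n w 0 (mxvec_index k s) =
    Num.sqrt (nav n k)%:R * (vecS (Bhat n k w) - vecS (Ba n k)) 0 s.
  by rewrite /V mxvecE mxE.
have V_dev n w k i l : V n w 0 (mxvec_index k (sg i l)) =
    Num.sqrt (nav n k)%:R * (Bhat n k w - Ba n k) i l.
  by rewrite VE !mx_subE !sgE.
have V_measurable n : measurable_mx (V n).
  move=> i e; rewrite ord1; case/mxvec_indexP: e => k s.
  under eq_fun do rewrite VE mx_subE mxE.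
  apply: measurable_funM => //; apply: measurable_funD => //.
  exact: integrable_mx_measurable (iBhat n k) _ _.
have A_pd : pdmx (Rlim^T *m Rlim) by have [<- _ _] := A5_cholesky.
have Rlim_unit : Rlim \in unitmx.
  have [c c0 Ac] := pdmx_lower_bound A_pd.
  by have := form_bounds_unitmx c0 Ac; rewrite unitmx_mul => /andP[].
have Rn_cvg i l : Rn n i l @[n --> \oo] --> Rlim i l.
  exact: (@spectral_norm_cvg_entries _ _ _ Rn).
have Ba_cvg k i l : Ba n k i l @[n --> \oo] --> B k i l.
  exact: (@spectral_norm_cvg_entries _ _ _ (fun n => Ba n k)).
have lambdaE n q (M : 'M[R]_(p n)) : lambda (p n - r + q.+1) M = (eigenvalues M)`_(p n - r + q).
  by rewrite /lambda addnS.
have linearization (k : 'I_m) (q : 'I_r) : exists g : 'M[R]_r,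
    Num.sqrt (nav y.1 k)%:R * (ln (lambda (p y.1 - r + q.+1) (W y.1 k y.2)) -
      ln (lambda (p y.1 - r + q.+1) (Emx Pr (W y.1 k)))) -
    \sum_i \sum_l g i l * V y.1 y.2 0 (mxvec_index k (sg i l)) @[y --> whp Pr] --> (0 : R).
  have [a_inf s_inf s1 s_rate] := sampling_rates (j k) hh1 A4_rate.
  have xi_k (i : 'I_r) : cvg_in_prob Pr (fun n w =>
      (eigenvalues (W n k w))`_(p n - r + i) / a n `^ (2 * h i + 1)) (xi i (j k)).
    by have := hxi i k; under eq_fun do under eq_fun do rewrite lambdaE.
  have xi_k_distinct (i l : 'I_r) : i != l -> h i = h l -> xi i (j k) != xi l (j k).
    move=> il hil; rewrite !hxi_scaling hil (inj_eq (mulfI _)) ?hxi_distinct //.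
  have EWZ_bounded : exists K : R, \forall n \near \oo,
      spectral_norm (Emx Pr (WZ n k)) <= K.
    have /eqOP[K [_ /(_ (K + 1))]] := A2_mean k.
    rewrite ltrDl ltr01 => /(_ isT) hK; exists ((K + 1) * `|1 : R|).
    by apply: filterS hK => n; exact/le_trans/ler_norm.
  have dev_k i l : bounded_in_prob Pr (fun n w => Num.sqrt (nav n k)%:R *
      (D n *m WX n k w *m (D n)^T - Emx Pr (fun w => D n *m WX n k w *m (D n)^T)) i l).
    have := gaussian_limit_tight (mxvec_index k (sg i l)) V_measurable A3_clt.
    by under eq_fun do under eq_fun do rewrite V_dev /Ba BhatE.
  have Ba_k i l : Emx Pr (fun w => D n *m WX n k w *m (D n)^T) i l @[n --> \oo] --> B k i l.
    by have := @Ba_cvg k i l; under eq_fun do rewrite /Ba BhatE.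
  have factor n : P n *m PH = Q n *m Rn n by have [] := A5_QR n.
  have isometry n : (Q n)^T *m Q n = 1%:M by have [] := A5_QR n.
  have s_scale : Num.sqrt (nav n k)%:R / scale h a n 0 (Ordinal hr) @[n --> \oo] --> (0 : R).
    by under eq_fun do rewrite mxE.
  have [g gl] := @top_log_eigenvalue_linearization R d T Pr r hr h p a
    (fun n => nav n k) P Q PH Rn Rlim
    (fun n l w => wcoef phi psi X (b n + j k) l w)
    (fun n l w => wcoef phi psi (Z n) (b n + j k) l w)
    (fun n => W n k) (fun n => WZ n k) (fun n => WX n k) (fun n => WXZ n k)
    (B k) (fun i => xi i (j k)) hp a_ge1 hh hh1 hPH factor isometry Rn_cvg Rlim_unit
    (fun n w => erefl) (fun n w => erefl) (fun n w => erefl) (fun n w => W_sym n k w)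
    (fun n => A1_decomposition n k) (fun n => iW n k) (fun n => iWX n k)
    (fun n => iWZ n k) (fun n => iWXZ n k) (fun n => A1_centered n k)
    (A2_prob k) EWZ_bounded (hB k) Ba_k dev_k a_inf s_inf s1 s_scale xi_k xi_k_distinct q.
  exists g; apply: (@cvg_eq_near _ _ _ (whp_proper Pr)) gl.
  apply: (@nearW _ (whp Pr)) => y; rewrite !lambdaE; congr (_ - _).
  by apply: eq_bigr => i _; apply: eq_bigr => l _; rewrite V_dev /Ba BhatE.
apply: (gaussian_limit_linearization V_measurable _ hSigmaB A3_clt).
  move=> n i e; rewrite ord1; case/mxvec_indexP: e => k q.
  under eq_fun do rewrite mxvecE mxE !lambdaE.
  apply: measurable_funM => //; apply: measurable_funB => //.
  apply: measurableT_comp; first exact: measurable_ln.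
  apply: (measurable_eigenvalue (Ordinal (top_index_lt q (hp n)))) => //.
  exact: integrable_mx_measurable.
move=> e; case/mxvec_indexP: e => k q; have [g gl] := linearization k q.
(* The coefficient of the coordinate e collects the entries (i, l) that sg sends
   to it; a pair i != l and its transpose share one coordinate. *)
exists (fun e => \sum_i \sum_l g i l * (e == mxvec_index k (sg i l))%:R).
apply: (@cvg_eq_near _ _ _ (whp_proper Pr)) gl.
apply: (@nearW _ (whp Pr)) => y; rewrite mxvecE mxE; congr (_ - _).
under eq_bigr do rewrite mulr_suml.
rewrite exchange_big; apply: eq_bigr => i _ /=.
under eq_bigr do rewrite mulr_suml.
rewrite exchange_big; apply: eq_bigr => l _ /=.
rewrite (bigD1 (mxvec_index k (sg i l))) //= eqxx mulr1 big1 ?addr0 //.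
by move=> e /negbTE ->; rewrite mulr0 mul0r.
Qed.
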